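(* Let $G$ be a simply connected solvable Lie group with Lie algebra $\mathfrak g$, and let $\Gamma\subset G$ be a lattice, so that $\Gamma\backslash G$ is a solvmanifold. If $(\omega,\theta)$ is an LCS structure of the second kind on $\mathfrak g$, then the LCS structure induced by $(\omega,\theta)$ on the solvmanifold $\Gamma\backslash G$ is of the second kind.
   Context: Lie algebras are real and finite-dimensional. A lattice in a simply connected Lie group $G$ is a discrete subgroup $\Gamma$ such that $\Gamma\backslash G$ is compact; if $G$ is solvable, $\Gamma\backslash G$ is called a solvmanifold. A locally conformal symplectic (LCS) structure on a manifold $M$ is a pair $(\omega,\theta)$ with $\omega$ a non-degenerate $2$-form and $\theta$ a closed $1$-form (the Lee form) such that $d\omega=\theta\wedge\omega$. Put $\mathfrak X_\omega(M)=\{X\in\mathfrak X(M): L_X\omega=0\}$, where $L$ is the Lie derivative. For $X\in\mathfrak X_\omega(M)$ the function $\theta(X)$ is constant, and the Lie algebra morphism $\theta|_{\mathfrak X_\omega(M)}:\mathfrak X_\omega(M)\to\mathbb R$ is called the Lee morphism. The LCS structure is of the first kind if the Lee morphism is surjective (i.e. there is $X\in\mathfrak X_\omega(M)$ with $\theta(X)\ne0$), and of the second kind if it is identically zero. An LCS structure on a Lie algebra $\mathfrak g$ is a pair $(\omega,\theta)$ with $\omega\in\bigwedge^2\mathfrak g^*$ non-degenerate, $\theta\in\mathfrak g^*$ closed, and $d\omega=\theta\wedge\omega$, where $d$ is the Chevalley–Eilenberg differential (so $d\alpha(X,Y)=-\alpha([X,Y])$ for $\alpha\in\mathfrak g^*$).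 Put $\mathfrak g_\omega=\{X\in\mathfrak g:\omega([X,Y],Z)+\omega(Y,[X,Z])=0\ \text{for all } Y,Z\in\mathfrak g\}$, a Lie subalgebra. The LCS structure on $\mathfrak g$ is of the first kind if $\theta|_{\mathfrak g_\omega}:\mathfrak g_\omega\to\mathbb R$ is surjective, and of the second kind if $\theta|_{\mathfrak g_\omega}$ is identically zero. An LCS structure $(\omega,\theta)$ on $\mathfrak g$ corresponds to a left invariant LCS structure on $G$; since left invariant forms on $G$ descend to $\Gamma\backslash G$, it induces an LCS structure on $\Gamma\backslash G$. *)

(* Defs.v *)
From HB Require Import structures.
From mathcomp Require Import all_boot all_order all_algebra.
From mathcomp Require Import all_classical all_reals all_analysis.
From mathcomp Require Import ring.
Set Implicit Arguments.
Unset Strict Implicit.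
Unset Printing Implicit Defensive.
Import Order.TTheory GRing.Theory Num.Theory.
Import numFieldNormedType.Exports.
Local Open Scope classical_set_scope.
Local Open Scope ring_scope.

Section SmoothOn.
Context {R : realType}.

Fixpoint Ck_on n (k : nat) (U : set 'rV[R]_n) (f : 'rV[R]_n -> R) : Prop :=
  (forall x, U x -> {for x, continuous f}) /\
  if k is k'.+1 then
    forall i : 'I_n,
      (forall x, U x -> derivable f x 'e_i) /\ Ck_on k' U ('D_'e_i f)
  else True.

(* Only meaningful when [U] is open, which is the case in all uses below. *)
Definition smooth_on n (U : set 'rV[R]_n) (f : 'rV[R]_n -> R) : Prop :=
  forall k, Ck_on k U f.

Definition smooth_map_on n m (U : set 'rV[R]_n) (f : 'rV[R]_n -> 'rV[R]_m) :
    Prop :=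
  forall j : 'I_m, smooth_on U (fun x => f x 0 j).

Section Closure.
Variables (n : nat) (U : set 'rV[R]_n) (oU : open U).
Implicit Types f g : 'rV[R]_n -> R.

Lemma Ck_on_ext k f g :
  (forall x, U x -> f x = g x) -> Ck_on k U f -> Ck_on k U g.
Proof.
have nearU (f1 g1 : 'rV[R]_n -> R) x : (forall y, U y -> f1 y = g1 y) ->
    U x -> {near x, f1 =1 g1}.
  by move=> fg Ux; near=> y; apply: fg; near: y; exact: open_nbhs_nbhs.
have ctsU (f1 g1 : 'rV[R]_n -> R) : (forall y, U y -> f1 y = g1 y) ->
    (forall x, U x -> {for x, continuous f1}) ->
    (forall x, U x -> {for x, continuous g1}).
  move=> fg cf x Ux; have := cf _ Ux; rewrite /prop_for /continuous_at.
  rewrite -(fg _ Ux); apply: cvg_trans.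
  exact: (near_eq_cvg (nearU _ _ _ fg Ux)).
elim: k f g => [|k IH] f g fg /= [cf df]; split => //; try exact: ctsU cf.
move=> i; have [df1 df2] := df i; split.
  by move=> x Ux; apply: near_eq_derivable (df1 _ Ux); exact: nearU.
by apply: IH df2 => x Ux; apply: near_eq_derive; exact: nearU.
Unshelve. all: by end_near. Qed.

Lemma Ck_onW k f : Ck_on k.+1 U f -> Ck_on k U f.
Proof.
elim: k f => [|k IH] f [cf df]; split=> // i.
by have [df1 df2] := df i; split=> //; exact: IH.
Qed.

Lemma Ck_on_cst k (a : R) : Ck_on k U (cst a).
Proof.
elim: k a => [|k IH] a; split=> //; try by move=> x _; exact: cst_continuous.
move=> i; split; first by move=> x _; exact: derivable_cst.
by apply: Ck_on_ext (IH 0) => x _; rewrite derive_cst.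
Qed.

Lemma Ck_onD k f g : Ck_on k U f -> Ck_on k U g -> Ck_on k U (f + g).
Proof.
elim: k f g => [|k IH] f g [cf df] [cg dg]; split=> //;
  try by move=> x Ux; apply: continuousD; [exact: cf|exact: cg].
move=> i; have [df1 df2] := df i; have [dg1 dg2] := dg i; split.
  by move=> x Ux; apply: derivableD; [exact: df1|exact: dg1].
apply: Ck_on_ext (IH _ _ df2 dg2) => x Ux.
by rewrite deriveD//; [exact: df1|exact: dg1].
Qed.

Lemma Ck_onM k f g : Ck_on k U f -> Ck_on k U g -> Ck_on k U (f * g).
Proof.
elim: k f g => [|k IH] f g Cf Cg;
  have [cf df] := Cf; have [cg dg] := Cg; split=> //;
  try by move=> x Ux; apply: continuousM; [exact: cf|exact: cg].
move=> i; have [df1 df2] := df i; have [dg1 dg2] := dg i; split.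
  by move=> x Ux; apply: derivableM; [exact: df1|exact: dg1].
apply: Ck_on_ext (Ck_onD (IH _ _ (Ck_onW Cf) dg2) (IH _ _ (Ck_onW Cg) df2)).
by move=> x Ux; rewrite deriveM//; [exact: df1|exact: dg1].
Qed.

End Closure.
End SmoothOn.

(* [chart_inv] is total, but only its values on the open set
   [chart_fun @` chart_dom] are relevant. *)
Record chart (R : realType) (n : nat) (M : topologicalType) := Chart {
  chart_dom : set M ;
  chart_fun : M -> 'rV[R]_n ;
  chart_inv : 'rV[R]_n -> M ;
  chart_dom_open : open chart_dom ;
  chart_cod_open : open (chart_fun @` chart_dom) ;
  chart_funK : forall x, chart_dom x -> chart_inv (chart_fun x) = x ;
  chart_fun_continuous :
    forall x, chart_dom x -> {for x, continuous chart_fun} ;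
  chart_inv_continuous :
    forall v, (chart_fun @` chart_dom) v -> {for v, continuous chart_inv}
}.

Definition chart_cod R n M (c : chart R n M) : set 'rV[R]_n :=
  chart_fun c @` chart_dom c.

HB.mixin Record isManifold (R : realType) (n : nat) M of Topological M := {
  atlas : set (chart R n M) ;
  atlas_cover : forall x : M, exists2 c, atlas c & chart_dom c x ;
  atlas_compatible : forall c d, atlas c -> atlas d ->
    smooth_map_on (chart_fun c @` (chart_dom c `&` chart_dom d))
                  (chart_fun d \o chart_inv c) ;
  manifold_hausdorff : hausdorff_space M ;
  manifold_second_countable : @second_countable M
}.

#[short(type="manifoldType")]
HB.structure Definition Manifold (R : realType) (n : nat) :=
  {M of isManifold R n M & Topological M}.

Arguments atlas {R n} s.

HB.mixin Record isLieGroup (R : realType) (n : nat) G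
    of Manifold R n G & Group G := {
  lie_mul_continuous : continuous (fun xy : G * G => (xy.1 * xy.2)%g) ;
  lie_inv_continuous : continuous (fun x : G => (x^-1)%g) ;
  lie_mul_smooth : forall c1 c2 c3 : chart R n G,
    atlas G c1 -> atlas G c2 -> atlas G c3 ->
    let mul12 (v : 'rV[R]_(n + n)) :=
      (chart_inv c1 (lsubmx v) * chart_inv c2 (rsubmx v))%g in
    smooth_map_on
      [set v | [/\ chart_cod c1 (lsubmx v), chart_cod c2 (rsubmx v)
                 & chart_dom c3 (mul12 v)]]
      (chart_fun c3 \o mul12) ;
  lie_inv_smooth : forall c1 c2 : chart R n G, atlas G c1 -> atlas G c2 ->
    smooth_map_on
      [set v | chart_cod c1 v /\ chart_dom c2 (chart_inv c1 v)^-1%g]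
      (fun v => chart_fun c2 (chart_inv c1 v)^-1%g)
}.

#[short(type="lieGroupType")]
HB.structure Definition LieGroup (R : realType) (n : nat) :=
  {G of isLieGroup R n G & Manifold R n G & Group G}.

Section SolvableGroup.
Variable G : groupType.

Definition is_subgroup (H : set G) : Prop :=
  H 1%g /\ forall x y, H x -> H y -> H (x * y^-1)%g.

Definition subgroup_gen (A : set G) : set G :=
  \bigcap_(H in [set H | is_subgroup H /\ A `<=` H]) H.

Fixpoint derived_series (k : nat) : set G :=
  if k is k'.+1 then
    subgroup_gen [set z | exists x y,
      [/\ derived_series k' x, derived_series k' y & z = [~ x, y]%g]]
  else setT.

Definition solvable_group : Prop := exists k, derived_series k = [set 1%g].

End SolvableGroup.

Section SimplyConnected.
Variables (R : realType) (T : topologicalType).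

Definition path_connected : Prop := forall x y : T, exists f : R -> T,
  [/\ {within `[0, 1], continuous f}, f 0 = x & f 1 = y].

Definition loops_contractible : Prop := forall f : R -> T,
  {within `[0, 1], continuous f} -> f 0 = f 1 ->
  exists H : R * R -> T,
    [/\ {within `[0, 1] `*` `[0, 1], continuous H},
        forall t, t \in `[0, 1] -> H (0, t) = f t /\ H (1, t) = f 0 &
        forall s, s \in `[0, 1] -> H (s, 0) = f 0 /\ H (s, 1) = f 0].

Definition simply_connected : Prop := path_connected /\ loops_contractible.

End SimplyConnected.

(* Vector fields and forms only depend on the algebra of smooth functions, and
   are defined from it; the instances used are [manifold_smooth] on a manifold
   and [quotient_smooth] on the quotient of a Lie group by a subgroup. *)
Record smooth_structure (R : realType) (M : Type) := SmoothStructure {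
  smooth :> set (M -> R) ;
  smooth_cst : forall a : R, smooth (cst a) ;
  smoothD : forall f g, smooth f -> smooth g -> smooth (f + g) ;
  smoothM : forall f g, smooth f -> smooth g -> smooth (f * g)
}.

Section SmoothFunctions.
Context {R : realType} {M : Type} (S : smooth_structure R M).

Definition smooth_pred : {pred (M -> R)} := fun f => `[< smooth S f >].

Lemma smooth_predP f : reflect (smooth S f) (f \in smooth_pred).
Proof. exact: asboolP. Qed.

Lemma smoothZ (a : R) f : smooth S f -> smooth S (a *: f).
Proof.
move=> Sf; have -> : a *: f = cst a * f by apply/funext.
by apply: smoothM => //; exact: smooth_cst.
Qed.

Lemma smoothB f g : smooth S f -> smooth S g -> smooth S (f - g).
Proof. by move=> Sf Sg; rewrite -scaleN1r; apply/smoothD/smoothZ. Qed.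

Fact smooth_subring_closed : subring_closed smooth_pred.
Proof.
split; first by apply/smooth_predP; exact: smooth_cst.
- by move=> f g /smooth_predP Sf /smooth_predP Sg; exact/smooth_predP/smoothB.
- by move=> f g /smooth_predP Sf /smooth_predP Sg; exact/smooth_predP/smoothM.
Qed.

Fact smooth_submod_closed : submod_closed smooth_pred.
Proof.
split; first by apply/smooth_predP; exact: smooth_cst.
move=> a f g /smooth_predP Sf /smooth_predP Sg.
by apply/smooth_predP/smoothD => //; exact: smoothZ.
Qed.

HB.instance Definition _ :=
  GRing.isSubringClosed.Build (M -> R) smooth_pred smooth_subring_closed.
HB.instance Definition _ :=
  GRing.isSubmodClosed.Build R (M -> R) smooth_pred smooth_submod_closed.

Record smooth_fun := SmoothFun {
  smooth_fun_val :> M -> R ;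
  smooth_fun_valP : smooth_fun_val \in smooth_pred
}.

HB.instance Definition _ := [isSub for smooth_fun_val].
HB.instance Definition _ := [Choice of smooth_fun by <:].
HB.instance Definition _ := GRing.SubChoice_isSubComPzRing.Build
  (M -> R) smooth_pred smooth_fun smooth_subring_closed.
HB.instance Definition _ := [SubZmodule_isSubLmodule of smooth_fun by <:].

Definition to_smooth f (Sf : smooth S f) : smooth_fun :=
  SmoothFun (introT (smooth_predP f) Sf).

Lemma smooth_funP (f : smooth_fun) : smooth S f.
Proof. exact/smooth_predP/smooth_fun_valP. Qed.

End SmoothFunctions.


Section VectorFields.
Context {R : realType} {M : Type} (S : smooth_structure R M).
Local Notation C := (smooth_fun S).

Lemma smooth_fun_eq (f g : C) : (forall p, f p = g p) -> f = g.
Proof. by move=> fg; apply/val_inj/funext. Qed.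

(* Derivations at [p].  On a Hausdorff second countable manifold, derivations of
   the algebra of globally defined smooth functions are tangent vectors, and
   derivations of this algebra into itself are smooth vector fields. *)
Definition tangent_pred (p : M) : {pred (C -> R)} := fun v =>
  `[< (forall (a : R) (f g : C), v (a *: f + g) = a * v f + v g) /\
      (forall f g : C, v (f * g) = v f * g p + f p * v g) >].

Fact tangent_submod_closed p : submod_closed (tangent_pred p).
Proof.
split.
  have z f : (0 : C -> R) f = 0 by [].
  by apply/asboolP; split=> [a f g|f g]; rewrite !z ?mulr0 ?mul0r ?addr0.
move=> a u v /asboolP[ul uM] /asboolP[vl vM]; apply/asboolP; split.
  by move=> b f g; rewrite !fctE ul vl /GRing.scale/=; ring.
by move=> f g; rewrite !fctE uM vM /GRing.scale/=; ring.
Qed.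

HB.instance Definition _ p :=
  GRing.isSubmodClosed.Build R (C -> R) (tangent_pred p)
    (tangent_submod_closed p).

Record tangent (p : M) := Tangent {
  tangent_val :> C -> R ;
  tangent_valP : tangent_val \in tangent_pred p
}.

HB.instance Definition _ p := [isSub for @tangent_val p].
HB.instance Definition _ p := [Choice of tangent p by <:].
HB.instance Definition _ p := [SubChoice_isSubLmodule of tangent p by <:].

Definition vfield_pred : {pred (C -> C)} := fun X =>
  `[< (forall (a : R) (f g : C), X (a *: f + g) = a *: X f + X g) /\
      (forall f g : C, X (f * g) = X f * g + f * X g) >].

Fact vfield_submod_closed : submod_closed vfield_pred.
Proof.
split.
  have z f : (0 : C -> C) f = 0 by [].
  apply/asboolP; split=> [a f g|f g]; first by rewrite !z scaler0 addr0.
  by rewrite !z mulr0 mul0r addr0.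
move=> a X Y /asboolP[Xl XM] /asboolP[Yl YM]; apply/asboolP; split.
  move=> b f g; rewrite !fctE Xl Yl; apply: smooth_fun_eq => p.
  by rewrite /= !fctE /GRing.scale/=; ring.
move=> f g; rewrite !fctE XM YM; apply: smooth_fun_eq => p.
by rewrite /= !fctE /GRing.scale/=; ring.
Qed.

HB.instance Definition _ :=
  GRing.isSubmodClosed.Build R (C -> C) vfield_pred vfield_submod_closed.

Record vfield := VField {
  vfield_val :> C -> C ;
  vfield_valP : vfield_val \in vfield_pred
}.

HB.instance Definition _ := [isSub for vfield_val].
HB.instance Definition _ := [Choice of vfield by <:].
HB.instance Definition _ := [SubChoice_isSubLmodule of vfield by <:].

Lemma vfieldP (X : vfield) (a : R) (f g : C) :
  X (a *: f + g) = a *: X f + X g.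
Proof. by have /asboolP[Xl _] := vfield_valP X. Qed.

Lemma vfieldM (X : vfield) (f g : C) : X (f * g) = X f * g + f * X g.
Proof. by have /asboolP[_ XM] := vfield_valP X. Qed.

Lemma vfield_eq (X Y : vfield) : (forall f p, X f p = Y f p) -> X = Y.
Proof.
by move=> XY; apply/val_inj/funext => f; apply: smooth_fun_eq => p.
Qed.

Lemma vfieldB (X : vfield) (f g : C) : X (f - g) = X f - X g.
Proof.
by rewrite -[- g]scaleN1r addrC vfieldP scaleN1r addrC.
Qed.

Lemma vfieldD (X : vfield) (f g : C) : X (f + g) = X f + X g.
Proof. by rewrite -[f]scale1r vfieldP !scale1r. Qed.

Fact vfield_bracket_subproof (X Y : vfield) :
  (fun f => X (Y f) - Y (X f)) \in vfield_pred.
Proof.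
apply/asboolP; split=> [a f g|f g]; apply: smooth_fun_eq => p.
  by rewrite !vfieldP /= !fctE /GRing.scale/=; ring.
by rewrite !vfieldM !vfieldD !vfieldM /= !fctE; ring.
Qed.

Definition vfield_bracket (X Y : vfield) : vfield :=
  VField (vfield_bracket_subproof X Y).

Fact vfield_at_subproof (X : vfield) p : (fun f => X f p) \in tangent_pred p.
Proof.
by apply/asboolP; split=> [a f g|f g]; rewrite ?vfieldP ?vfieldM.
Qed.

Definition vfield_at (X : vfield) (p : M) : tangent p :=
  Tangent (vfield_at_subproof X p).

End VectorFields.

HB.mixin Record isLieAlgebra (R : realType) L of GRing.Lmodule R L := {
  lie : L -> L -> L ;
  lieP : forall (a : R) (x y z : L),
    lie (a *: x + y) z = a *: lie x z + lie y z ;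
  liexx : forall x : L, lie x x = 0 ;
  lie_jacobi : forall x y z : L,
    lie x (lie y z) + lie y (lie z x) + lie z (lie x y) = 0
}.

#[short(type="lieAlgType")]
HB.structure Definition LieAlgebra (R : realType) :=
  {L of isLieAlgebra R L & GRing.Lmodule R L}.

Section VFieldLie.
Context {R : realType} {M : Type} (S : smooth_structure R M).

Fact vfield_bracketP (a : R) (X Y Z : vfield S) :
  vfield_bracket (a *: X + Y) Z = a *: vfield_bracket X Z + vfield_bracket Y Z.
Proof.
apply: vfield_eq => f p.
by rewrite /= !fctE/= vfieldP /= !fctE/= /GRing.scale/=; ring.
Qed.

Fact vfield_bracketxx (X : vfield S) : vfield_bracket X X = 0.
Proof. by apply: vfield_eq => f p /=; rewrite subrr. Qed.

Fact vfield_jacobi (X Y Z : vfield S) :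
  vfield_bracket X (vfield_bracket Y Z) + vfield_bracket Y (vfield_bracket Z X)
    + vfield_bracket Z (vfield_bracket X Y) = 0.
Proof.
apply: vfield_eq => f p; rewrite /= !fctE/= !vfieldB/= !fctE.
by apply: (@etrans _ _ 0) => //; ring.
Qed.

HB.instance Definition _ := isLieAlgebra.Build R (vfield S)
  vfield_bracketP vfield_bracketxx vfield_jacobi.

End VFieldLie.

Section LieAlgebraLCS.
Context {R : realType} {L : lieAlgType R}.

Definition ce_diff1 (theta : L -> R) (x y : L) : R := - theta (lie x y).

Definition ce_diff2 (omega : L -> L -> R) (x y z : L) : R :=
  - omega (lie x y) z + omega (lie x z) y - omega (lie y z) x.

Record lie_lcs := LieLCS {
  lie_omega : L -> L -> R ;
  lie_theta : L -> R ;
  lie_omega_linear : forall (a : R) (x y z : L),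
    lie_omega (a *: x + y) z = a * lie_omega x z + lie_omega y z ;
  lie_omega_alternating : forall x, lie_omega x x = 0 ;
  lie_omega_nondegenerate :
    forall x, (forall y, lie_omega x y = 0) -> x = 0 ;
  lie_theta_linear : forall (a : R) (x y : L),
    lie_theta (a *: x + y) = a * lie_theta x + lie_theta y ;
  lie_theta_closed : forall x y, ce_diff1 lie_theta x y = 0 ;
  lie_lcsP : forall x y z, ce_diff2 lie_omega x y z =
    lie_theta x * lie_omega y z - lie_theta y * lie_omega x z
      + lie_theta z * lie_omega x y
}.

Definition lie_automorphisms (s : lie_lcs) : set L :=
  [set x | forall y z,
     lie_omega s (lie x y) z + lie_omega s y (lie x z) = 0].

Definition lie_second_kind (s : lie_lcs) : Prop :=
  forall x, lie_automorphisms s x -> lie_theta s x = 0.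

End LieAlgebraLCS.
Arguments lie_lcs {R} L.

Section Forms.
Context {R : realType} {M : Type} (S : smooth_structure R M).
Local Notation C := (smooth_fun S).

Record form1 := Form1 {
  form1_val :> forall p : M, tangent S p -> R ;
  form1_linear : forall p (a : R) (u v : tangent S p),
    form1_val (a *: u + v) = a * form1_val u + form1_val v ;
  form1_smooth : forall X : vfield S,
    smooth S (fun p => form1_val (vfield_at X p))
}.

Record form2 := Form2 {
  form2_val :> forall p : M, tangent S p -> tangent S p -> R ;
  form2_linear : forall p (a : R) (u v w : tangent S p),
    form2_val (a *: u + v) w = a * form2_val u w + form2_val v w ;
  form2_alternating : forall p (u : tangent S p), form2_val u u = 0 ;
  form2_smooth : forall X Y : vfield S,
    smooth S (fun p => form2_val (vfield_at X p) (vfield_at Y p))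
}.

Definition eval1 (theta : form1) (X : vfield S) : C :=
  to_smooth (form1_smooth theta X).

Definition eval2 (omega : form2) (X Y : vfield S) : C :=
  to_smooth (form2_smooth omega X Y).

Definition diff1 (theta : form1) (X Y : vfield S) : C :=
  X (eval1 theta Y) - Y (eval1 theta X) - eval1 theta (lie X Y).

Definition diff2 (omega : form2) (X Y Z : vfield S) : C :=
  X (eval2 omega Y Z) - Y (eval2 omega X Z) + Z (eval2 omega X Y)
  - eval2 omega (lie X Y) Z + eval2 omega (lie X Z) Y
  - eval2 omega (lie Y Z) X.

Definition lie_derivative2 (X : vfield S) (omega : form2) (Y Z : vfield S) :
    C :=
  X (eval2 omega Y Z) - eval2 omega (lie X Y) Z - eval2 omega Y (lie X Z).

Record lcs := LCS {
  lcs_omega : form2 ;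
  lcs_theta : form1 ;
  lcs_nondegenerate : forall p (u : tangent S p),
    (forall v : tangent S p, lcs_omega p u v = 0) -> u = 0 ;
  lcs_closed : forall X Y, diff1 lcs_theta X Y = 0 ;
  lcsP : forall X Y Z, diff2 lcs_omega X Y Z =
    eval1 lcs_theta X * eval2 lcs_omega Y Z
      - eval1 lcs_theta Y * eval2 lcs_omega X Z
      + eval1 lcs_theta Z * eval2 lcs_omega X Y
}.

Definition lcs_automorphisms (s : lcs) : set (vfield S) :=
  [set X | forall Y Z, lie_derivative2 X (lcs_omega s) Y Z = 0].

Definition second_kind (s : lcs) : Prop :=
  forall X, lcs_automorphisms s X -> eval1 (lcs_theta s) X = 0.

End Forms.

Section Pushforward.
Context {R : realType} {M N : Type}.
Variables (S : smooth_structure R M) (S' : smooth_structure R N).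
Variables (phi : M -> N).
Hypothesis phi_smooth : forall f, smooth S' f -> smooth S (f \o phi).

Definition comp_smooth (f : smooth_fun S') : smooth_fun S :=
  to_smooth (phi_smooth (smooth_funP f)).

Fact pushforward_subproof p (v : tangent S p) :
  (v \o comp_smooth) \in tangent_pred (phi p).
Proof.
have /asboolP[vl vM] := tangent_valP v; apply/asboolP; split=> [a f g|f g] /=.
  by rewrite -vl; congr (v _); exact: smooth_fun_eq.
by rewrite (_ : comp_smooth _ = comp_smooth f * comp_smooth g) ?vM//;
  exact: smooth_fun_eq.
Qed.

Definition pushforward p (v : tangent S p) : tangent S' (phi p) :=
  Tangent (pushforward_subproof v).

End Pushforward.

Section ManifoldSmooth.
Context {R : realType} {n : nat} (M : manifoldType R n).

Definition manifold_smooth_def : set (M -> R) :=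
  [set f : M -> R | forall c : chart R n M, atlas M c ->
     smooth_on (chart_cod c) (f \o chart_inv c)].

Fact manifold_smooth_cst (a : R) : manifold_smooth_def (cst a).
Proof. by move=> c _ k; apply: Ck_on_cst; exact: chart_cod_open. Qed.

Fact manifold_smoothD f g :
  manifold_smooth_def f -> manifold_smooth_def g -> manifold_smooth_def (f + g).
Proof.
move=> Sf Sg c Ac k; apply: Ck_onD; first exact: chart_cod_open.
- exact: Sf.
- exact: Sg.
Qed.

Fact manifold_smoothM f g :
  manifold_smooth_def f -> manifold_smooth_def g -> manifold_smooth_def (f * g).
Proof.
move=> Sf Sg c Ac k; apply: Ck_onM; first exact: chart_cod_open.
- exact: Sf.
- exact: Sg.
Qed.

Definition manifold_smooth : smooth_structure R M :=
  SmoothStructure manifold_smooth_cst manifold_smoothD manifold_smoothM.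

End ManifoldSmooth.

Section LieAlgebraOfLieGroup.
Context {R : realType} {n : nat} (G : lieGroupType R n).
Local Notation S := (manifold_smooth G).

(* [X] is left invariant if [X (f \o L_a) = X f \o L_a] for all [a] and [f];
   here [g] stands for the smooth function [f \o L_a]. *)
Definition left_invariant_pred : {pred vfield S} := fun X =>
  `[< forall (a : G) (f g : smooth_fun S),
        (forall x, g x = f (a * x)%g) -> forall x, X g x = X f (a * x)%g >].

Fact left_invariant_submod_closed : submod_closed left_invariant_pred.
Proof.
split; first exact/asboolP.
move=> c X Y /asboolP XL /asboolP YL; apply/asboolP => a f g fg x.
by rewrite /= !fctE/= (XL _ _ _ fg) (YL _ _ _ fg).
Qed.

HB.instance Definition _ := GRing.isSubmodClosed.Build R (vfield S)
  left_invariant_pred left_invariant_submod_closed.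

Record lie_algebra := LeftInvariant {
  left_invariant_val :> vfield S ;
  left_invariant_valP : left_invariant_val \in left_invariant_pred
}.

HB.instance Definition _ := [isSub for left_invariant_val].
HB.instance Definition _ := [Choice of lie_algebra by <:].
HB.instance Definition _ := [SubChoice_isSubLmodule of lie_algebra by <:].

Fact left_invariant_lie (X Y : lie_algebra) :
  lie (left_invariant_val X) (left_invariant_val Y) \in left_invariant_pred.
Proof.
have /asboolP XL := left_invariant_valP X.
have /asboolP YL := left_invariant_valP Y.
apply/asboolP => a f g fg x; rewrite /= !fctE/=.
by rewrite (XL a (Y f) (Y g)) ?(YL a (X f) (X g))//; [exact: XL|exact: YL].
Qed.

Definition lie_algebra_bracket (X Y : lie_algebra) : lie_algebra :=
  LeftInvariant (left_invariant_lie X Y).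

Fact lie_algebra_bracketP (a : R) (X Y Z : lie_algebra) :
  lie_algebra_bracket (a *: X + Y) Z =
  a *: lie_algebra_bracket X Z + lie_algebra_bracket Y Z.
Proof. by apply/val_inj; exact: vfield_bracketP. Qed.

Fact lie_algebra_bracketxx (X : lie_algebra) : lie_algebra_bracket X X = 0.
Proof. by apply/val_inj; exact: vfield_bracketxx. Qed.

Fact lie_algebra_jacobi (X Y Z : lie_algebra) :
  lie_algebra_bracket X (lie_algebra_bracket Y Z)
    + lie_algebra_bracket Y (lie_algebra_bracket Z X)
    + lie_algebra_bracket Z (lie_algebra_bracket X Y) = 0.
Proof. by apply/val_inj; exact: vfield_jacobi. Qed.

HB.instance Definition _ := isLieAlgebra.Build R lie_algebra
  lie_algebra_bracketP lie_algebra_bracketxx lie_algebra_jacobi.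

End LieAlgebraOfLieGroup.

Section Quotient.
Context {R : realType} {n : nat} {G : lieGroupType R n} (Gamma : groupClosed G).
Local Open Scope quotient_scope.

(* The relation whose classes are the cosets [Gamma x]. *)
Definition coset_rel : rel G := fun x y => (y * x^-1)%g \in Gamma.

Fact coset_rel_refl : reflexive coset_rel.
Proof. by move=> x; rewrite /coset_rel mulgV gpred1. Qed.

Fact coset_rel_sym : symmetric coset_rel.
Proof. by move=> x y; exact: gpredFC. Qed.

Fact coset_rel_trans : transitive coset_rel.
Proof.
move=> y x z xy yz; rewrite /coset_rel.
by have := gpredM _ _ yz xy; rewrite mulgA mulgVK.
Qed.

Canonical coset_equiv : equiv_rel G :=
  EquivRel coset_rel coset_rel_refl coset_rel_sym coset_rel_trans.

Definition coset_space : Type := quotient_topology {eq_quot coset_equiv}.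
HB.instance Definition _ := Topological.on coset_space.
HB.instance Definition _ := Quotient.on coset_space.

Definition coset_proj (x : G) : coset_space := \pi_coset_space x.

Definition lattice : Prop :=
  (forall x, x \in Gamma -> \forall y \near x, y \in Gamma -> y = x) /\
  compact [set: coset_space].

(* For discrete [Gamma] the projection is a covering map, and the manifold
   structure of the quotient is the one for which it is a local
   diffeomorphism: a function is smooth if and only if its lift to [G] is. *)
Definition quotient_smooth : smooth_structure R coset_space :=
  @SmoothStructure R coset_space
    [set f : coset_space -> R | smooth (manifold_smooth G) (f \o coset_proj)]
    (fun a => smooth_cst (manifold_smooth G) a)
    (fun f g Sf Sg => smoothD Sf Sg)
    (fun f g Sf Sg => smoothM Sf Sg).

Definition dcoset_proj (x : G) (v : tangent (manifold_smooth G) x) :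
    tangent quotient_smooth (coset_proj x) :=
  pushforward (S' := quotient_smooth) (phi := coset_proj) (fun f Sf => Sf) v.

(* The structure [t] on [Gamma \ G] is induced by [s] if its pullback to [G] is
   the left invariant structure determined by [s], that is, takes the constant
   values [lie_omega s X Y] and [lie_theta s X] on left invariant fields. *)
Definition induced_lcs (s : lie_lcs (lie_algebra G)) (t : lcs quotient_smooth) :
    Prop :=
  forall (X Y : lie_algebra G) (x : G),
    lcs_omega t (coset_proj x)
        (dcoset_proj (vfield_at X x)) (dcoset_proj (vfield_at Y x))
      = lie_omega s X Y /\
    lcs_theta t (coset_proj x) (dcoset_proj (vfield_at X x)) = lie_theta s X.

End Quotient.
Arguments coset_proj {R n G} Gamma x.

(* Main.v *)
Require Import Defs.
From HB Require Import structures.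
From mathcomp Require Import all_boot all_order all_algebra.
From mathcomp Require Import all_classical all_reals all_analysis.
From mathcomp Require Import ring lra.

(** Let [X] be an infinitesimal automorphism of the structure [(om, th)] induced
    on the quotient of [G] by [Gamma]; the claim is that [th(X) = 0].  The idea
    is to average [X] to a left invariant automorphism.

    Solvable groups are amenable: there is a right invariant mean on the bounded
    functions on [G] ([solvable_mean]).  On [Gamma]-invariant functions it plays
    the role of the integral over the compact quotient.  It kills the
    derivatives along left invariant fields ([mean_lfield]) and is strictly
    positive ([mean_gt0]), so that no integration on manifolds is needed.

    Let [eta(Y) = om(X, Y)] for [Y] in the Lie algebra [g].  The equations
    [L_X om = 0] and [d om = th /\ om] give [d eta = th /\ eta - th(X) om]
    ([diff_eta]).  Let [u] be a function with [Y u = 0] for all [Y] in [g].  The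
    linear functional [Y |-> mean (u eta(Y))] on [g] equals [om(X', _)] for some
    [X'] in [g], by nondegeneracy.  Averaging the previous equation shows that
    [X'] is an automorphism of the structure on [g], and that
    [th(X') = mean (u th(X))].  As the structure on [g] is of the second kind,
    [mean (u th(X)) = 0] ([mean_lee]).

    If [th(X)] is constant, then [u = th(X)] gives [mean (th(X) ^ 2) = 0], hence
    [th(X) = 0] by strict positivity.  In general
    [d(th(X)) /\ om = 0] ([dlee_omega]), which forces [th(X)] to be constant
    unless [g] has dimension at most two.  In dimension two, either [g] is
    abelian, all its elements are automorphisms and [th = 0]; or it is the Lie
    algebra of the affine group of the line, which is not unimodular and thus has
    no lattice.  This last fact is also proved with the mean
    ([no_affine_lattice]).

    Vector fields are derivations of the algebra of smooth functions, so that
    several facts of differential geometry are needed in this form: the values of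
    the left invariant fields span the derivations at each point of the quotient
    ([tangent_quotient]), by Hadamard's expansion and bump functions on the
    quotient, and the invariant fields on the two sides commute
    ([lfield_rfield]).  Forms are linear in the left argument and vanish on
    pairs of equal vectors; that [om] is skew-symmetric, hence bilinear, is again
    a consequence of the structure equation and of the strict positivity of the
    mean ([form2_skew]). *)

Set Implicit Arguments.
Unset Strict Implicit.
Unset Printing Implicit Defensive.
Import Order.TTheory GRing.Theory Num.Theory.
Import numFieldNormedType.Exports.
Local Open Scope classical_set_scope.
Local Open Scope ring_scope.

(** * Functions of class C^1 *)

Section Directional.
Context {R : realType}.

Lemma is_derive_line (V : normedModType R) (f : V -> R) (x v : V) (t : R) :
  derivable f (x + t *: v) v ->
  is_derive t 1 (fun s : R => f (x + s *: v)) ('D_v f (x + t *: v)).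
Proof.
move=> df.
have E : (fun h : R => h^-1 *: (f (x + (h *: 1 + t) *: v) - f (x + t *: v))) =
         (fun h : R => h^-1 *: (f (h *: v + (x + t *: v)) - f (x + t *: v))).
  by apply/funext => h; rewrite scalerDl [h *: 1]mulr1 addrCA.
by split; rewrite /derivable /derive E.
Qed.

Lemma segment_MVT (V : normedModType R) (f : V -> R) (x v : V) :
  (forall t : R, t \in `[0, 1]%R -> derivable f (x + t *: v) v) ->
  exists2 t : R, t \in `[0, 1]%R & f (x + v) - f x = 'D_v f (x + t *: v).
Proof.
move=> df.
have dl (t : R) : t \in `[0, 1]%R ->
    is_derive t 1 (fun s : R => f (x + s *: v)) ('D_v f (x + t *: v)).
  by move=> /df; exact: is_derive_line.
pose g (s : R) := f (x + s *: v); pose dg (t : R) := 'D_v f (x + t *: v).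
have gd : forall t : R, t \in `]0, 1[%R -> is_derive t (1 : R) g (dg t).
  by move=> t t01; apply: dl; apply: subset_itv_oo_cc.
have gc : {within `[(0 : R), 1], continuous g}.
  by apply: derivable_within_continuous => t /dl [].
have [t t01 E] := MVT_segment (@ler01 R) gd gc.
rewrite /g /dg in E.
by exists t => //; move: E; rewrite scale1r scale0r addr0 subr0 mulr1.
Qed.

Lemma near_dist (V : normedModType R) (p : V) (e : R) :
  0 < e -> \forall q \near p, `|q - p| < e.
Proof.
move=> e0; have := nbhsx_ballx p e e0; apply: filterS => q.
by rewrite -ball_normE /= distrC.
Qed.

Lemma near_norm (V : normedModType R) (e : R) :
  0 < e -> \forall h \near (0 : V), `|h| < e.
Proof. by move=> /(near_dist (0 : V)); apply: filterS => q; rewrite subr0. Qed.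

Lemma coord_le_norm n (v : 'rV[R]_n) i : `|v 0 i| <= `|v|.
Proof. by rewrite [leRHS]/Num.Def.normr/= mx_normrE (le_bigmax _ _ (0, i)). Qed.

Lemma norm_le_coord n (v : 'rV[R]_n) (e : R) :
  0 <= e -> (forall i, `|v 0 i| <= e) -> `|v| <= e.
Proof.
move=> e0 ve; rewrite [leLHS]/Num.Def.normr/= mx_normrE bigmax_le// => -[i j] _.
by rewrite ord1.
Qed.

(** The formula for the differential in terms of partial derivatives, which are
    what the definition of class C^k provides. *)
Definition gradient_form n (f : 'rV[R]_n -> R) (p h : 'rV[R]_n) : R :=
  \sum_i h 0 i * 'D_'e_i f p.

Lemma Ck_on_continuous n k (U : set 'rV[R]_n) (f : 'rV[R]_n -> R) x :
  Ck_on k U f -> U x -> {for x, continuous f}.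
Proof. by case: k => [|k] [+ _]; apply. Qed.

Lemma derivable_scale (V : normedModType R) (f : V -> R) x v (a : R) :
  derivable f x v -> derivable f x (a *: v) /\ 'D_(a *: v) f x = a * 'D_v f x.
Proof.
have [->|a0] := eqVneq a 0.
  rewrite scale0r mul0r => _; split; first exact: derivable0.
  exact: derive0.
move=> df.
suff H : (fun h : R => h^-1 *: (f (h *: (a *: v) + x) - f x)) @ 0^' -->
    a * 'D_v f x.
  by split; [apply/cvg_ex; exists (a * 'D_v f x)|exact: cvg_lim H].
have -> : (fun h : R => h^-1 *: (f (h *: (a *: v) + x) - f x)) =
    (fun h : R => a * ((h * a)^-1 *: (f ((h * a) *: v + x) - f x))).
  apply/funext => h; rewrite scalerA [h * a]mulrC invfM /GRing.scale/=.
  by rewrite -!mulrA mulVKf// [a * h]mulrC.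
apply: cvgM; first exact: cvg_cst.
rewrite /derive.
have ha : (fun h : R => h * a) @ 0^' --> 0^'.
  move=> A /= [e /= e0 eA]; exists (e / `|a|) => /=.
    by rewrite divr_gt0// normr_gt0.
  move=> h; rewrite /= !sub0r !normrN ltr_pdivlMr ?normr_gt0// => he h0.
  apply: eA; last by rewrite mulf_neq0.
  by rewrite /= sub0r normrN normrM.
exact: (@cvg_comp _ _ _ (fun h : R => h * a)
  (fun k : R => k^-1 *: (f (k *: v + x) - f x)) _ _ _ ha df).
Qed.

(** Differentiability locally uniformly in the base point.  This is what
    compactness and integration with respect to a parameter consume below; it
    follows from the mean value theorem applied along the coordinate directions,
    by continuity of the partial derivatives. *)
Lemma strong_diff n (U : set 'rV[R]_n) (f : 'rV[R]_n -> R) p :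
  open U -> Ck_on 1 U f -> U p -> forall e, 0 < e ->
  \forall q \near p & h \near (0 : 'rV[R]_n),
    `|f (q + h) - f q - gradient_form f q h| <= e * `|h|.
Proof.
move=> oU [cf df] Up e e0.
pose e' := e / (n%:R + 1).
have n0 : 0 < (n%:R + 1 : R) by rewrite ltr_wpDl.
have e'0 : 0 < e' by rewrite divr_gt0.
have : \forall q \near p, U q /\
    forall i : 'I_n, `|'D_'e_i f q - 'D_'e_i f p| < e' / 2.
  near=> q; split; first by near: q; exact: open_nbhs_nbhs.
  move=> i; rewrite distrC; move: i; near: q; apply: filter_forall => i.
  have [_ [+ _]] := df i; move=> /(_ p Up)/cvgrPdist_lt; apply.
  by rewrite divr_gt0.
move=> /nbhs_ballP[d /= d0 dp].
have {}dp q : `|q - p| < d -> U q /\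
    forall i : 'I_n, `|'D_'e_i f q - 'D_'e_i f p| < e' / 2.
  by move=> qp; apply: dp; rewrite -ball_normE /= distrC.
have d2 : 0 < d / 2 by rewrite divr_gt0.
near=> q h => /=.
have qd : `|q - p| < d / 2.
  near: q; exact: (@near_dist 'rV[R]_n p _ d2).
have hd : `|h| < d / 2.
  near: h; exact: (@near_norm 'rV[R]_n _ d2).
(* the vertices of the path from [q] to [q + h] with edges parallel to the axes *)
pose s (j : nat) : 'rV[R]_n := \row_i (if (i < j)%N then h 0 i else 0).
have sS (j : 'I_n) : s j.+1 = s j + h 0 j *: 'e_j.
  apply/rowP => i; rewrite !mxE eqxx/= ltnS leq_eqVlt.
  have [->|ij] := eqVneq i j.
    by rewrite eqxx ltnn/= mulr1 add0r.
  by move: (ij); rewrite -val_eqE => /negbTE ->/=; rewrite mulr0 addr0.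
have step (j : 'I_n) : `|f (q + s j.+1) - f (q + s j) - h 0 j * 'D_'e_j f q|
    <= e' * `|h|.
  have near_seg (t : R) : t \in `[0, 1]%R ->
      `|(q + s j + t *: (h 0 j *: 'e_j)) - p| < d.
    rewrite in_itv/= => /andP[t0 t1].
    rewrite -[q + s j + _]addrA addrAC [d]splitr.
    apply: le_lt_trans (ler_normD _ _) _; apply: ltrD => //.
    apply: le_lt_trans hd; apply: norm_le_coord => // i; rewrite !mxE eqxx/=.
    have [->|ij] := eqVneq i j.
      rewrite ltnn add0r mulr1 normrM ger0_norm//.
      by apply: le_trans (coord_le_norm h j); rewrite ler_piMl.
    rewrite !mulr0 addr0; case: ifP => _; last by rewrite normr0.
    exact: coord_le_norm.
  have [|t t01 E] := @segment_MVT _ f (q + s j) (h 0 j *: 'e_j).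
    move=> t /near_seg /dp[Ut _]; have [dj _] := df j.
    by have [] := derivable_scale (h 0 j) (dj _ Ut).
  rewrite sS addrA E.
  have /near_seg/dp[Ut Dt] := t01; have [dj _] := df j.
  have [_ ->] := derivable_scale (h 0 j) (dj _ Ut).
  rewrite -mulrBr normrM mulrC ler_pM//; last exact: coord_le_norm.
  have qd' : `|q - p| < d by apply: lt_trans qd _; rewrite ltr_pdivrMr// ltr_pMr// ltr1n.
  have [_ Dq] := dp _ qd'.
  rewrite -(subrKA ('D_'e_j f p)) (le_trans (ler_normD _ _))//.
  rewrite [e']splitr lerD// ltW//; rewrite distrC; exact: Dq.
have -> : f (q + h) - f q = \sum_(j < n) (f (q + s j.+1) - f (q + s j)).
  rewrite -(big_mkord xpredT (fun j => f (q + s j.+1) - f (q + s j))).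
  rewrite telescope_sumr//.
  have -> : s 0 = 0 by apply/rowP => i; rewrite !mxE.
  have -> : s n = h by apply/rowP => i; rewrite !mxE ltn_ord.
  by rewrite addr0.
rewrite -sumrB.
apply: le_trans (ler_norm_sum _ _ _) _.
apply: le_trans (ler_sum _ (fun j _ => step j)) _.
rewrite sumr_const card_ord -mulr_natl mulrA ler_wpM2r//.
by rewrite /e' mulrCA -ler_pdivlMl ?ltr_pwDr// ?mulVf ?gt_eqF// ler_pdivrMr// mul1r lerDl.
Unshelve. all: by end_near. Qed.

End Directional.

Section Composition.
Context {R : realType}.

Lemma Ck_on_differentiable n k (U : set 'rV[R]_n) (f : 'rV[R]_n -> R) p :
  open U -> Ck_on k.+1 U f -> U p -> differentiable f p.
Proof.
move=> oU /= [cf df] Up.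
have C1f : Ck_on 1 U f.
  split=> // i; have [dfi dfC] := df i; split=> //.
  by split=> // x Ux; exact: Ck_on_continuous dfC Ux.
have lin : linear (gradient_form f p).
  move=> a u v; rewrite /gradient_form /GRing.scale/= mulr_sumr -big_split/=.
  by apply: eq_bigr => i _; rewrite !mxE; ring.
pose dM := GRing.isLinear.Build _ _ _ _ _ lin.
pose dL : {linear 'rV[R]_n -> R} := HB.pack (gradient_form f p) dM.
have cd : continuous dL.
  apply: continuous_big => [|i _ h]; first exact: add_continuous.
  exact: (cvgM (@coord_continuous R 1 n 0 i h) (cvg_cst _)).
have E : f \o shift p = cst (f p) + dL +o_ (0 : 'rV[R]_n) id.
  apply/eqaddoP => e e0.
  have /= := strong_diff oU C1f Up e0.
  move=> [[A B]/= [nA nB] AB]; near=> h => /=.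
  have := AB (p, h); rewrite /= => H.
  rewrite -[X in `|X|]/(f (h + p) - (f p + gradient_form f p h)).
  rewrite opprD addrA [h + p]addrC; apply: H; split; last by near: h.
  exact: nbhs_singleton.
apply/diff_locallyP.
by rewrite (diff_unique cd E).
Unshelve. all: by end_near. Qed.

Lemma derive_gradient n k (U : set 'rV[R]_n) (f : 'rV[R]_n -> R) p v :
  open U -> Ck_on k.+1 U f -> U p -> 'D_v f p = gradient_form f p v.
Proof.
move=> oU Cf Up; have df := Ck_on_differentiable oU Cf Up.
rewrite deriveE// {1}(row_sum_delta v) linear_sum /gradient_form.
by apply: eq_bigr => i _; rewrite linearZ/= deriveE.
Qed.

Lemma chain_rule (V W : normedModType R) (F : V -> W) (f : W -> R) (x v : V) :
  derivable F x v -> differentiable f (F x) ->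
  is_derive x v (f \o F) ('D_('D_v F x) f (F x)).
Proof.
move=> dF df.
pose G (t : R) := F (t *: v + x).
have G0 : G 0 = F x by rewrite /G scale0r add0r.
have dG : is_derive (0 : R) 1 G ('D_v F x).
  split; first exact: ((derivable1P F x v).1 dF).
  rewrite /derive; congr (lim (_ @ 0^')); apply/funext => h.
  by rewrite /G /= addr0 scale0r add0r [h *: 1]mulr1.
have dG' : differentiable G 0 by apply/derivable1_diffP.
have dfG : differentiable f (G 0) by rewrite G0.
have dfFG : differentiable (f \o G) 0 by exact: differentiable_comp.
split.
  by apply: ((derivable1P (f \o F) x v).2); apply/derivable1_diffP.
have -> : 'D_v (f \o F) x = 'D_1 (f \o G) 0.
  rewrite /derive; congr (lim (_ @ 0^')); apply/funext => h.
  by rewrite /G /= addr0 scale0r add0r [h *: 1]mulr1.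
rewrite deriveE// diff_comp//=.
have <- : 'D_1 G 0 = 'd G 0 1 by exact: deriveE.
by rewrite derive_val -deriveE// G0.
Qed.

End Composition.

(** * Calculus of smooth functions *)

Section SmoothCalculus.
Context {R : realType}.

Lemma Ck_onS n k (U V : set 'rV[R]_n) f :
  V `<=` U -> Ck_on k U f -> Ck_on k V f.
Proof.
move=> VU; elim: k f => [|k IH] f [cf df]; split=> //;
  try by move=> x /VU; exact: cf.
by move=> i; have [d1 d2] := df i; split; [move=> x /VU; exact: d1|exact: IH].
Qed.

Lemma Ck_on_local n k (U : set 'rV[R]_n) f :
  (forall x, U x -> exists2 V : set 'rV[R]_n, V x & Ck_on k V f) ->
  Ck_on k U f.
Proof.
elim: k f => [|k IH] f fU; split=> //;
  try by move=> x /fU[V Vx /Ck_on_continuous]; exact.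
move=> i; split.
  by move=> x /fU[V Vx [_ /(_ i)[+ _]]]; exact.
by apply: IH => x /fU[V Vx [_ /(_ i)[_ +]]]; exists V.
Qed.

Lemma smooth_onS n (U V : set 'rV[R]_n) f :
  V `<=` U -> smooth_on U f -> smooth_on V f.
Proof. by move=> VU fU k; exact: Ck_onS (fU k). Qed.

Lemma smooth_on_local n (U : set 'rV[R]_n) f :
  (forall x, U x -> exists2 V : set 'rV[R]_n, V x & smooth_on V f) ->
  smooth_on U f.
Proof.
by move=> fU k; apply: Ck_on_local => x /fU[V Vx /(_ k)]; exists V.
Qed.

Lemma smooth_on_ext n (U : set 'rV[R]_n) f g : open U ->
  (forall x, U x -> f x = g x) -> smooth_on U f -> smooth_on U g.
Proof. by move=> oU fg fU k; exact: Ck_on_ext (fU k). Qed.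

Lemma smooth_on_continuous n (U : set 'rV[R]_n) f x :
  smooth_on U f -> U x -> {for x, continuous f}.
Proof. by move=> /(_ 0)/Ck_on_continuous; exact. Qed.

Lemma smooth_on_differentiable n (U : set 'rV[R]_n) f x : open U ->
  smooth_on U f -> U x -> differentiable f x.
Proof. by move=> oU /(_ 1)/(Ck_on_differentiable oU); exact. Qed.

Lemma smooth_on_partial n (U : set 'rV[R]_n) f i :
  smooth_on U f -> smooth_on U ('D_'e_i f).
Proof. by move=> fU k; have [_ /(_ i)[]] := fU k.+1. Qed.

Lemma Ck_on_sum n k (U : set 'rV[R]_n) (I : Type) (r : seq I)
    (F : I -> 'rV[R]_n -> R) : open U ->
  (forall i, Ck_on k U (F i)) -> Ck_on k U (fun x => \sum_(i <- r) F i x).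
Proof.
move=> oU FU; elim: r => [|i r IH].
  by apply: (Ck_on_ext oU) (Ck_on_cst oU k (0 : R)) => x _; rewrite big_nil.
by apply: (Ck_on_ext oU) (Ck_onD oU (FU i) IH) => x _; rewrite big_cons.
Qed.

Lemma smooth_on_sum n (U : set 'rV[R]_n) (I : Type) (r : seq I)
    (F : I -> 'rV[R]_n -> R) : open U ->
  (forall i, smooth_on U (F i)) -> smooth_on U (fun x => \sum_(i <- r) F i x).
Proof. by move=> oU FU k; apply: Ck_on_sum => // i; exact: FU. Qed.

Lemma smooth_on_cst n (U : set 'rV[R]_n) (a : R) :
  open U -> smooth_on U (fun=> a).
Proof. by move=> oU k; exact: Ck_on_cst. Qed.

Lemma smooth_onD n (U : set 'rV[R]_n) f g : open U ->
  smooth_on U f -> smooth_on U g -> smooth_on U (fun x => f x + g x).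
Proof. by move=> oU fU gU k; exact: Ck_onD. Qed.

Lemma smooth_onM n (U : set 'rV[R]_n) f g : open U ->
  smooth_on U f -> smooth_on U g -> smooth_on U (fun x => f x * g x).
Proof. by move=> oU fU gU k; exact: Ck_onM. Qed.

Lemma derive_coord n (x v : 'rV[R]_n) i :
  is_derive x v (fun y : 'rV[R]_n => y 0 i) (v 0 i).
Proof.
have D (h : R) : h != 0 -> h^-1 *: ((h *: v + x) 0 i - x 0 i) = v 0 i.
  by move=> h0; rewrite !mxE addrK scalerA mulVf// scale1r.
have C : (fun h : R => h^-1 *: ((h *: v + x) 0 i - x 0 i)) @ 0^' --> v 0 i.
  apply: cvg_near_cst; near=> h; apply: D.
  by near: h; exact: nbhs_dnbhs_neq.
by split; [apply/cvg_ex; exists (v 0 i)|exact: cvg_lim C].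
Unshelve. all: by end_near. Qed.

Lemma smooth_on_coord n (U : set 'rV[R]_n) i :
  open U -> smooth_on U (fun y : 'rV[R]_n => y 0 i).
Proof.
move=> oU [|k]; split=> //;
  try by move=> x Ux; exact: (@coord_continuous R 1 n 0 i x).
move=> j; split; first by move=> x _; have [] := derive_coord x 'e_j i.
apply: (Ck_on_ext oU) (Ck_on_cst oU k (('e_j : 'rV[R]_n) 0 i)) => x _.
by have [_ ->] := derive_coord x 'e_j i.
Qed.

Lemma continuous_rV (T : topologicalType) n (F : T -> 'rV[R]_n) x :
  (forall j, {for x, continuous (fun y => F y 0 j)}) -> {for x, continuous F}.
Proof.
move=> cF; apply/cvgrPdist_le => e e0; near=> y.
apply: norm_le_coord => [|j]; first exact: ltW.
rewrite !mxE; move: j; near: y; apply: filter_forall => j.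
by have /cvgrPdist_le := cF j; exact.
Unshelve. all: by end_near. Qed.

Lemma Ck_on_comp n m k (U : set 'rV[R]_n) (V : set 'rV[R]_m)
    (F : 'rV[R]_n -> 'rV[R]_m) (f : 'rV[R]_m -> R) :
  open U -> open V -> (forall x, U x -> V (F x)) ->
  (forall j, Ck_on k U (fun x => F x 0 j)) -> Ck_on k V f ->
  Ck_on k U (f \o F).
Proof.
move=> oU oV UV.
have C0 l g : (forall j, Ck_on l U (fun x => F x 0 j)) -> Ck_on l V g ->
    forall x, U x -> {for x, continuous (g \o F)}.
  move=> CF Cg x Ux; apply: continuous_comp.
    by apply: continuous_rV => j; exact: Ck_on_continuous (CF j) Ux.
  exact: Ck_on_continuous Cg (UV _ Ux).
elim: k f => [|k IH] f CF Cf; split; try exact: C0 CF Cf; first by [].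
move=> i.
have dF x : U x -> derivable F x 'e_i.
  move=> Ux; apply/derivable_mxP => j1 j; rewrite ord1.
  by have [_ /(_ i)[+ _]] := CF j; exact.
have dfF x : U x -> is_derive x 'e_i (f \o F) ('D_('D_'e_i F x) f (F x)).
  move=> Ux; apply: chain_rule; first exact: dF.
  exact: Ck_on_differentiable oV Cf (UV _ Ux).
split; first by move=> x /dfF [].
apply: (@Ck_on_ext _ _ _ oU _ (fun x => \sum_j
    'D_'e_i (fun y => F y 0 j) x * ('D_'e_j f \o F) x)).
  move=> x Ux; have [_ ->] := dfF x Ux.
  rewrite (derive_gradient _ oV Cf (UV _ Ux)) /gradient_form.
  by apply: eq_bigr => j _; rewrite derive_mx ?mxE//; exact: dF.
apply: (Ck_on_sum _ oU) => j; apply: (Ck_onM oU).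
  by have [_ /(_ i)[]] := CF j.
apply: IH; first by move=> l; exact: Ck_onW (CF l).
by have [_ /(_ j)[]] := Cf.
Qed.

Lemma smooth_on_comp n m (U : set 'rV[R]_n) (V : set 'rV[R]_m)
    (F : 'rV[R]_n -> 'rV[R]_m) (f : 'rV[R]_m -> R) :
  open U -> open V -> (forall x, U x -> V (F x)) ->
  smooth_map_on U F -> smooth_on V f -> smooth_on U (f \o F).
Proof.
move=> oU oV UV FU fV k; apply: Ck_on_comp UV _ (fV k) => // j; exact: FU.
Qed.

Lemma smooth_on_derive n (U : set 'rV[R]_n) (f : 'rV[R]_n -> R) v :
  open U -> smooth_on U f -> smooth_on U ('D_v f).
Proof.
move=> oU fU.
apply: (smooth_on_ext oU (f := fun p => gradient_form f p v)).
  by move=> x Ux; rewrite (derive_gradient _ oU (fU 1)).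
apply: (smooth_on_sum _ oU) => i; apply: (smooth_onM oU).
  exact: smooth_on_cst.
exact: smooth_on_partial.
Qed.

Lemma smooth_on_derivable n (U : set 'rV[R]_n) (f : 'rV[R]_n -> R) x v :
  open U -> smooth_on U f -> U x -> derivable f x v.
Proof.
by move=> oU fU Ux; apply: diff_derivable; exact: smooth_on_differentiable fU Ux.
Qed.

End SmoothCalculus.

(** * Mixed derivatives *)

Section Schwarz.
Context {R : realType}.

Lemma derive_translate (V W : normedModType R) (f : V -> W) (a x v : V) :
  (derivable (fun y => f (y + a)) x v <-> derivable f (x + a) v) /\
  'D_v (fun y => f (y + a)) x = 'D_v f (x + a).
Proof.
have E : (fun h : R => h^-1 *: (f (h *: v + x + a) - f (x + a))) =
         (fun h : R => h^-1 *: (f (h *: v + (x + a)) - f (x + a))).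
  by apply/funext => h; rewrite addrA.
by rewrite /derivable /derive /= E.
Qed.

(** Two applications of the mean value theorem.  The left-hand side is symmetric
    in [v] and [w], the right-hand side is not: comparing the two choices gives
    the equality of mixed derivatives. *)
Lemma second_difference n (U : set 'rV[R]_n) (f : 'rV[R]_n -> R) p v w d s :
  open U -> smooth_on U f -> (forall q, `|q - p| < d -> U q) ->
  s != 0 -> `|s| * (`|v| + `|w|) < d ->
  exists2 q, `|q - p| < d &
    f (p + s *: v + s *: w) - f (p + s *: v) - (f (p + s *: w) - f p) =
    s ^+ 2 * 'D_w ('D_v f) q.
Proof.
move=> oU fU pU s0 sd.
have near_seg (a b : R) : `|a| <= 1 -> `|b| <= 1 ->
    `|p + a *: (s *: v) + b *: (s *: w) - p| < d.
  move=> a1 b1; rewrite -[p + _ + _]addrA addrAC subrr add0r.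
  apply: le_lt_trans sd; rewrite mulrDr.
  apply: le_trans (ler_normD _ _) _.
  by rewrite !normrZ lerD// ler_piMl// mulr_ge0.
have abs01 (t : R) : t \in `[0, 1]%R -> `|t| <= 1.
  by rewrite in_itv/= => /andP[t0 t1]; rewrite ger0_norm.
pose g x := f (x + s *: w) - f x.
have dg (x : 'rV[R]_n) : U x -> U (x + s *: w) ->
    is_derive x (s *: v) g (s * ('D_v f (x + s *: w) - 'D_v f x)).
  move=> Ux Uxw; rewrite mulrBr.
  have [H1 H2] := derive_translate f (s *: w) x (s *: v).
  have df1 := smooth_on_derivable (v := v) oU fU Uxw.
  have df2 := smooth_on_derivable (v := v) oU fU Ux.
  have [d1 e1] := derivable_scale s df1; have [d2 e2] := derivable_scale s df2.
  have d1' := H1.2 d1.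
  split; first exact: derivableB.
  by rewrite (deriveB d1' d2) H2 e1 e2.
have UU (a b : R) : `|a| <= 1 -> `|b| <= 1 ->
    U (p + a *: (s *: v) + b *: (s *: w)).
  by move=> a1 b1; apply: pU; exact: near_seg.
have one1 : `|1 : R| <= 1 by rewrite normr1.
have zero1 : `|0 : R| <= 1 by rewrite normr0.
have [|t t01] := @segment_MVT R _ g p (s *: v).
  move=> t /abs01 t1; have Ut := UU _ _ t1 zero1; have Ut' := UU _ _ t1 one1.
  rewrite scale0r addr0 in Ut; rewrite scale1r in Ut'.
  by have [] := dg _ Ut Ut'.
rewrite /g => ->.
have t1 := abs01 _ t01.
have Ut := UU _ _ t1 zero1; have Ut' := UU _ _ t1 one1.
rewrite scale0r addr0 in Ut; rewrite scale1r in Ut'.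
have [_ ->] := dg _ Ut Ut'.
have Df := smooth_on_derive v oU fU.
have [|r r01 ->] := @segment_MVT R _ ('D_v f) (p + t *: (s *: v)) (s *: w).
  move=> r /abs01 r1; have Ur := UU _ _ t1 r1.
  by have [] := derivable_scale s (smooth_on_derivable (v := w) oU Df Ur).
have Ur := UU _ _ t1 (abs01 _ r01).
have [_ ->] := derivable_scale s (smooth_on_derivable (v := w) oU Df Ur).
exists (p + t *: (s *: v) + r *: (s *: w)); first exact: near_seg (abs01 _ r01).
by rewrite mulrA expr2.
Qed.

Lemma half_dist (e x y z : R) :
  `|y - x| < e / 2 -> `|z - x| < e / 2 -> `|y - z| <= e.
Proof. by rewrite !ltr_norml ler_norml; lra. Qed.

Lemma derive_commute n (U : set 'rV[R]_n) (f : 'rV[R]_n -> R) p v w :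
  open U -> smooth_on U f -> U p -> 'D_w ('D_v f) p = 'D_v ('D_w f) p.
Proof.
move=> oU fU Up.
have cont v' w' : {for p, continuous ('D_w' ('D_v' f))}.
  by apply: (smooth_on_continuous _ Up); do 2!apply: smooth_on_derive => //.
apply/eqP; rewrite -subr_eq0 -normr_le0.
apply/ler_addgt0Pr => e e0; rewrite add0r.
have e2 : 0 < e / 2 by rewrite divr_gt0.
have : \forall q \near p, U q /\ (`|'D_w ('D_v f) p - 'D_w ('D_v f) q| < e / 2 /\
    `|'D_v ('D_w f) p - 'D_v ('D_w f) q| < e / 2).
  apply: filterI; first exact: open_nbhs_nbhs.
  apply: filterI.
    by have /cvgrPdist_lt := cont v w; exact.
  by have /cvgrPdist_lt := cont w v; exact.
move=> /nbhs_ballP[d /= d0 dp].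
have {}dp q : `|q - p| < d -> U q /\
    (`|'D_w ('D_v f) p - 'D_w ('D_v f) q| < e / 2 /\
     `|'D_v ('D_w f) p - 'D_v ('D_w f) q| < e / 2).
  by move=> qp; apply: dp; rewrite -ball_normE /= distrC.
have dU q : `|q - p| < d -> U q by move=> /dp[].
pose s := d / 2 / (`|v| + `|w| + 1).
have vw0 : 0 < `|v| + `|w| + 1 by rewrite ltr_wpDl// addr_ge0.
have s0 : 0 < s by rewrite !divr_gt0.
have sd : `|s| * (`|v| + `|w|) < d.
  rewrite gtr0_norm// /s mulrAC ltr_pdivrMr//.
  have x0 : 0 <= `|v| + `|w| by rewrite addr_ge0.
  move: (`|v| + `|w|) x0 => x x0; have := mulr_ge0 (ltW d0) x0; lra.
have sd' : `|s| * (`|w| + `|v|) < d by rewrite [`|w| + _]addrC.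
have [q qd E] := second_difference oU fU dU (lt0r_neq0 s0) sd.
have [q' qd' E'] := second_difference oU fU dU (lt0r_neq0 s0) sd'.
have EE : 'D_w ('D_v f) q = 'D_v ('D_w f) q'.
  apply: (@mulfI _ (s ^+ 2)); first by rewrite expf_neq0// gt_eqF.
  move: E E'; move: ('D_w _ _) ('D_v _ _) => x y <- <-.
  by rewrite [p + s *: w + _]addrAC; ring.
have [_ [H _]] := dp _ qd; have [_ [_]] := dp _ qd'.
rewrite -EE; move: H; move: ('D_w _ q) ('D_w _ p) ('D_v _ p) => x y z.
exact: half_dist.
Qed.

End Schwarz.

(** * Integration over the unit interval *)

Section Integral01.
Context {R : realType}.
Implicit Types F G P : R -> R.

Definition continuous01 F : Prop :=
  forall t : R, t \in `[0, 1]%R -> {for t, continuous F}.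

(** Integration enters only through primitives on the unit interval, so that
    linearity and bounds come from the mean value theorem. *)
Definition primitive01 F P : Prop :=
  {within `[0, 1], continuous P} /\
  forall t : R, t \in `]0, 1[%R -> is_derive t 1 P (F t).

Lemma primitive01_exists F : continuous01 F -> exists P, primitive01 F P.
Proof.
move=> cF; pose mu := @lebesgue_measure R.
have cF' : {within `[0, 1], continuous F}.
  by apply: continuous_in_subspaceT => t /[1!inE]; exact: cF.
have iF : mu.-integrable `[0, 1] (EFin \o F).
  by apply: continuous_compact_integrable => //; exact: segment_compact.
exists (fun x => parameterized_integral mu 0 x F); split.
  by apply: parameterized_integral_continuous.
move=> t /[dup] t01; rewrite in_itv/= => /andP[t0 t1].
have ct : {for t, continuous F} by apply: cF; exact: subset_itv_oo_cc.
have [d1 e1] := continuous_FTC1_closed t1 iF t0 ct.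
by split; [exact: d1|rewrite -derive1E; exact: e1].
Qed.

Lemma primitive01_unique F P Q : primitive01 F P -> primitive01 F Q ->
  P 1 - P 0 = Q 1 - Q 0.
Proof.
move=> [cP dP] [cQ dQ].
have dPQ (t : R) : t \in `]0, 1[%R -> is_derive t 1 (P - Q) (cst 0 t).
  move=> t01; have dPt := dP t t01; have dQt := dQ t t01.
  by have := is_deriveB dPt dQt; rewrite subrr.
have cPQ : {within `[0, 1], continuous (P - Q)}.
  exact: within_continuousB.
have [c _] := MVT (@ltr01 R) dPQ cPQ.
by rewrite /cst mul0r !fctE; lra.
Qed.

Definition integral01 F : R := let P := get (primitive01 F) in P 1 - P 0.

Lemma integral01E F P : primitive01 F P -> integral01 F = P 1 - P 0.
Proof.
move=> FP; have H : primitive01 F (get (primitive01 F)).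
  by apply: getPex; exists P.
exact: primitive01_unique H FP.
Qed.

Lemma integral01_linear (a : R) F G : continuous01 F -> continuous01 G ->
  integral01 (fun t => a * F t + G t) = a * integral01 F + integral01 G.
Proof.
move=> /primitive01_exists[P FP] /primitive01_exists[Q GQ].
rewrite (integral01E FP) (integral01E GQ).
have [[cP dP] [cQ dQ]] := (FP, GQ).
rewrite (@integral01E _ (a *: P + Q)); first by rewrite !fctE /GRing.scale/=; ring.
split.
  apply: within_continuousD => // x.
  apply: (@cvg_comp _ _ _ P (fun y => a * y) _ (nbhs (P x))); first exact: cP.
  exact: mulrl_continuous.
move=> t t01; have dPt := dP t t01; have dQt := dQ t t01.
exact: is_deriveD.
Qed.

Lemma integral01_bound F (C : R) : continuous01 F ->
  (forall t : R, t \in `[0, 1]%R -> `|F t| <= C) -> `|integral01 F| <= C.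
Proof.
move=> /primitive01_exists[P FP] FC; rewrite (integral01E FP).
have [cP dP] := FP.
have [c c01 ->] := MVT (@ltr01 R) dP cP.
by rewrite subr0 mulr1; apply: FC; exact: subset_itv_oo_cc.
Qed.

Lemma continuous01_linear (a : R) F G : continuous01 F -> continuous01 G ->
  continuous01 (fun t => a * F t + G t).
Proof.
move=> cF cG t t01; apply: continuousD; last exact: cG.
by apply: continuousM; [exact: cst_continuous|exact: cF].
Qed.

Lemma integral01_sum n (F : 'I_n -> R -> R) : (forall i, continuous01 (F i)) ->
  integral01 (fun t => \sum_i F i t) = \sum_i integral01 (F i).
Proof.
move=> cF.
suff [] : continuous01 (fun t => \sum_i F i t) /\
  integral01 (fun t => \sum_i F i t) = \sum_i integral01 (F i) by [].
have c0 : continuous01 (fun _ => 0) by move=> t _; exact: cst_continuous.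
elim: (index_enum _) => [|i r [IH1 IH2]].
  rewrite big_nil.
  have -> : (fun t : R => \sum_(i <- [::]) F i t) = (fun=> 0 : R).
    by apply/funext => t; rewrite big_nil.
  split=> //; have := integral01_linear (-1) c0 c0.
  by rewrite mulr0 addr0 mulN1r addNr.
rewrite big_cons -IH2.
have -> : (fun t : R => \sum_(j <- i :: r) F j t) =
    (fun t => 1 * F i t + \sum_(j <- r) F j t).
  by apply/funext => t; rewrite big_cons mul1r.
by rewrite integral01_linear// mul1r; split=> //; exact: continuous01_linear.
Qed.

End Integral01.

(** * Hadamard's expansion *)

Section Hadamard.
Context {R : realType}.

Lemma is_derive_estimate (V W : normedModType R) (f : V -> W) (w v : V) c :
  (forall e, 0 < e ->
    \forall h \near (0 : R), `|f (w + h *: v) - f w - h *: c| <= e * `|h|) ->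
  is_derive w v f c.
Proof.
move=> H.
have C : (fun h : R => h^-1 *: (f (h *: v + w) - f w)) @ 0^' --> c.
  apply/cvgrPdist_le => e e0; near=> h.
  have h0 : h != 0 by near: h; exact: nbhs_dnbhs_neq.
  rewrite distrC -[X in _ - X](scale1r c) -(mulVf h0) -scalerA -scalerBr.
  rewrite normrZ normfV ler_pdivrMl ?normr_gt0// mulrC [h *: v + w]addrC.
  near: h; apply: nbhs_dnbhs; exact: H.
by split; [apply/cvg_ex; exists c|exact: cvg_lim C].
Unshelve. all: by end_near. Qed.

Lemma near_comp (T S : topologicalType) (F : T -> S) (x : T) (y : S)
    (A : set S) : F z @[z --> x] --> y -> nbhs y A -> nbhs x (fun z => A (F z)).
Proof. by move=> Fy /Fy. Qed.

Lemma near_translate (V : normedModType R) (A : set V) w :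
  open A -> A w -> \forall h \near (0 : V), A (w + h).
Proof.
move=> oA Aw; have /nbhs_ballP[d /= d0 dA] := open_nbhs_nbhs (conj oA Aw).
apply: filterS (near_norm V d0) => h hd; apply: dA.
by rewrite -ball_normE /= opprD addrA subrr sub0r normrN.
Qed.

Lemma near_diff (V : normedModType R) (A : set V) (w : V) :
  nbhs 0 A -> \forall w' \near w, A (w' - w).
Proof.
move=> /nbhs_ballP[d /= d0 dA].
apply: filterS (near_dist w d0) => w' wd; apply: dA.
by rewrite -ball_normE /= sub0r normrN.
Qed.

Lemma near_scale (V : normedModType R) (A : set V) (v : V) :
  nbhs 0 A -> \forall h \near (0 : R), A (h *: v).
Proof.
move=> A0; have c0 : h *: v @[h --> (0 : R)] --> (0 : V).
  by rewrite -[X in _ --> X](scale0r v); apply: cvgZr_tmp; exact: cvg_id.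
exact: near_comp c0 A0.
Qed.

Variables (n : nat) (U : set 'rV[R]_n) (p : 'rV[R]_n).
Hypothesis oU : open U.
Hypothesis starU : forall w (t : R), U w -> t \in `[0, 1]%R ->
  U (p + t *: (w - p)).

(** Compactness of the segment from [p] to [w]: a property that holds for small
    increments locally uniformly on [U] holds uniformly along the segment. *)
Lemma near_segment (Q : 'rV[R]_n -> 'rV[R]_n -> Prop) w : U w ->
  (forall q, U q -> \forall q' \near q & h \near (0 : 'rV[R]_n), Q q' h) ->
  \forall h \near (0 : 'rV[R]_n), forall t : R, t \in `[0, 1]%R ->
    Q (p + t *: (w - p)) (t *: h).
Proof.
move=> Uw HQ.
have /compact_near_coveringP nc := @segment_compact R 0 1.
apply: filterS (nc 'rV[R]_n (nbhs (0 : 'rV[R]_n))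
  (fun h t => Q (p + t *: (w - p)) (t *: h)) _ _).
  by move=> h Hh t t01; apply: Hh.
move=> t t01; have Uq := starU Uw t01.
have [[A B]/= [nA nB] AB] := HQ _ Uq.
have cA : (fun z : R * 'rV[R]_n => p + z.1 *: (w - p)) z @[z --> ((t, 0) : R * 'rV[R]_n)] -->
    p + t *: (w - p).
  apply: cvgD; first exact: cvg_cst.
  by apply: cvgZr_tmp; exact: cvg_fst.
have cB : (fun z : R * 'rV[R]_n => z.1 *: z.2) z @[z --> ((t, 0) : R * 'rV[R]_n)] -->
    (0 : 'rV[R]_n).
  rewrite -[X in _ --> X](scaler0 _ t).
  have c1 : (fun z : R * 'rV[R]_n => z.1) z
      @[z --> ((t, 0) : R * 'rV[R]_n)] --> (t : R) by exact: cvg_fst.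
  have c2 : (fun z : R * 'rV[R]_n => z.2) z
      @[z --> ((t, 0) : R * 'rV[R]_n)] --> (0 : 'rV[R]_n) by exact: cvg_snd.
  exact: cvgZ c1 c2.
apply: (filterS _ (filterI (near_comp cA nA) (near_comp cB nB))) => -[t' h] /= [At Bh].
exact: (AB (p + t' *: (w - p), t' *: h) (conj At Bh)).
Qed.

(** The weight [t ^ k] makes this family stable under differentiation: the [i]-th
    partial derivative of the mean of [f] with weight [k] is the mean of the
    [i]-th partial derivative of [f] with weight [k + 1]. *)
Definition hadamard_mean k (f : 'rV[R]_n -> R) (w : 'rV[R]_n) : R :=
  integral01 (fun t => t ^+ k * f (p + t *: (w - p))).

Lemma continuous01_hadamard k (f : 'rV[R]_n -> R) (w : 'rV[R]_n) :
  (forall x, U x -> {for x, continuous f}) -> U w ->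
  continuous01 (fun t => t ^+ k * f (p + t *: (w - p))).
Proof.
move=> cf Uw t t01; apply: continuousM; first exact: exprn_continuous.
apply: (@continuous_comp _ _ _ (fun t : R => p + t *: (w - p)) f).
  by apply: cvgD; [exact: cvg_cst|apply: cvgZr_tmp; exact: cvg_id].
by apply: cf; exact: starU.
Qed.

Lemma norm_exp01 k (t : R) : t \in `[0, 1]%R -> `|t ^+ k| <= 1.
Proof.
rewrite in_itv/= => /andP[t0 t1].
by rewrite normrX ger0_norm// exprn_ile1.
Qed.

Lemma continuous_hadamard k f w : (forall x, U x -> {for x, continuous f}) ->
  U w -> {for w, continuous (hadamard_mean k f)}.
Proof.
move=> cf Uw; apply: ((cvgrPdist_le (FF := nbhs_filter w) _ _).2) => e e0.
have HQ q : U q -> \forall q' \near q & h \near (0 : 'rV[R]_n),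
    `|f (q' + h) - f q'| <= e.
  move=> Uq; have e2 : 0 < e / 2 by rewrite divr_gt0.
  have /cvgrPdist_lt/(_ _ e2) cq := cf q Uq.
  have c1 : (fun z : 'rV[R]_n * 'rV[R]_n => z.1 + z.2) z @[z --> ((q, 0) : 'rV[R]_n * 'rV[R]_n)] --> q.
    rewrite -[X in _ --> X]addr0.
    by apply: cvgD; [exact: cvg_fst|exact: cvg_snd].
  have c2 : (fun z : 'rV[R]_n * 'rV[R]_n => z.1) z @[z --> ((q, 0) : 'rV[R]_n * 'rV[R]_n)] --> q.
    exact: cvg_fst.
  apply: filterS (filterI (near_comp c1 cq) (near_comp c2 cq)) => -[x h] /= [H1 H2].
  rewrite -[f (x + h)](subrK (f q)) -addrA [e]splitr.
  by rewrite (le_trans (ler_normD _ _))// lerD// ltW// distrC.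
have := near_segment Uw HQ => HN.
have HU := near_translate oU Uw.
apply: filterS (near_diff w (filterI HN HU)) => w' /= [HN' HU'].
have Uw' : U w' by rewrite -[w'](subrK w) addrC.
rewrite distrC /hadamard_mean.
have L := integral01_linear (-1) (continuous01_hadamard (k := k) cf Uw)
  (continuous01_hadamard (k := k) cf Uw').
rewrite mulN1r in L; rewrite [X in `|X|]addrC -L.
apply: integral01_bound => [|t t01].
  by apply: continuous01_linear; exact: continuous01_hadamard.
rewrite (_ : _ + _ = t ^+ k * (f (p + t *: (w' - p)) - f (p + t *: (w - p))));
  last by ring.
rewrite normrM.
have -> : p + t *: (w' - p) = p + t *: (w - p) + t *: (w' - w).
  by rewrite -addrA -scalerDr [w - p + _]addrC subrKA.
rewrite -[e]mul1r ler_pM//; first exact: norm_exp01.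
exact: HN'.
Qed.

Lemma derive_hadamard k f w (i : 'I_n) : Ck_on 1 U f -> U w ->
  is_derive w 'e_i (hadamard_mean k f) (hadamard_mean k.+1 ('D_'e_i f) w).
Proof.
move=> Cf Uw; have [cf df] := Cf.
have cdf j x : U x -> {for x, continuous ('D_'e_j f)}.
  by move=> Ux; have [_ dj] := df j; exact: (Ck_on_continuous (k := 0) dj Ux).
apply: is_derive_estimate => e e0.
have ei : `|'e_i : 'rV[R]_n| <= 1.
  by apply: norm_le_coord => // j; rewrite !mxE eqxx/= normr_nat; case: eqP.
have HN := near_segment Uw (fun q Uq => strong_diff oU Cf Uq e0).
have HU := near_translate oU Uw.
apply: filterS (near_scale 'e_i (filterI HN HU)) => h /= [HN' HU'].
pose F t := t ^+ k * f (p + t *: (w - p)).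
pose F' t := t ^+ k * f (p + t *: (w + h *: 'e_i - p)).
pose D t := t ^+ k.+1 * 'D_'e_i f (p + t *: (w - p)).
have cF : continuous01 F by exact: continuous01_hadamard.
have cF' : continuous01 F' by exact: continuous01_hadamard.
have cD : continuous01 D by exact: continuous01_hadamard (cdf i) Uw.
have -> : hadamard_mean k f (w + h *: 'e_i) - hadamard_mean k f w -
    h *: hadamard_mean k.+1 ('D_'e_i f) w =
    integral01 (fun t => - h * D t + (-1 * F t + F' t)).
  rewrite integral01_linear//; last exact: continuous01_linear.
  by rewrite integral01_linear// /hadamard_mean /GRing.scale/= -/F -/F' -/D; ring.
apply: integral01_bound => [|t t01].
  by apply: continuous01_linear => //; exact: continuous01_linear.
have := HN' t t01.
have -> : p + t *: (w - p) + t *: (h *: 'e_i) = p + t *: (w + h *: 'e_i - p).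
  by rewrite -addrA -scalerDr addrAC.
have -> : gradient_form f (p + t *: (w - p)) (t *: (h *: 'e_i)) =
    t * h * 'D_'e_i f (p + t *: (w - p)).
  rewrite /gradient_form (bigD1 i)//= big1 ?addr0 => [|j ji].
    by rewrite !mxE !eqxx/= mulr1.
  by rewrite !mxE eqxx/= (negbTE ji) !mulr0 mul0r.
move=> H.
have -> : - h * D t + (-1 * F t + F' t) = t ^+ k *
   (f (p + t *: (w + h *: 'e_i - p)) - f (p + t *: (w - p)) -
    t * h * 'D_'e_i f (p + t *: (w - p))).
  by rewrite /F /F' /D exprS; ring.
rewrite normrM -[leRHS]mul1r ler_pM//; first exact: norm_exp01.
apply: le_trans H _; rewrite ler_wpM2l ?(ltW e0)// !normrZ.
have t1 := norm_exp01 1 t01; rewrite expr1 in t1.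
apply: le_trans (ler_piMl _ t1) _; first by rewrite mulr_ge0.
by rewrite ler_piMr.
Qed.

Lemma Ck_on_hadamard l k f : Ck_on l U f -> Ck_on l U (hadamard_mean k f).
Proof.
elim: l k f => [|l IH] k f Cf; (split; first by
  move=> x Ux; apply: continuous_hadamard => // y; exact: Ck_on_continuous Cf).
  by [].
have C1f : Ck_on 1 U f.
  have [cf df] := Cf; split=> // j; have [d1 d2] := df j; split=> //.
  by split=> // x; exact: Ck_on_continuous d2.
move=> i; split.
  by move=> x Ux; have [] := derive_hadamard k i C1f Ux.
apply: (Ck_on_ext oU) (IH k.+1 ('D_'e_i f) _).
  by move=> x Ux; have [_ ->] := derive_hadamard k i C1f Ux.
by have [_ /(_ i)[]] := Cf.
Qed.

(** The coefficients are the averages over the segment from [p] to [w] of the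
    partial derivatives, by the fundamental theorem of calculus. *)
Lemma hadamard_expansion f : smooth_on U f -> U p ->
  exists g : 'I_n -> 'rV[R]_n -> R, [/\ forall i, smooth_on U (g i),
    forall i, g i p = 'D_'e_i f p &
    forall w, U w -> f w = f p + \sum_i (w 0 i - p 0 i) * g i w].
Proof.
move=> fU Up; exists (fun i => hadamard_mean 0 ('D_'e_i f)); split.
- by move=> i k; apply: Ck_on_hadamard; exact: smooth_on_partial.
- move=> i; rewrite /hadamard_mean.
  rewrite (integral01E (P := fun t => t * 'D_'e_i f p)).
    by rewrite mul1r mul0r subr0.
  have dP (t : R) : is_derive t 1 (fun t => t * 'D_'e_i f p)
      (t ^+ 0 * 'D_'e_i f (p + t *: (p - p))).
    rewrite subrr scaler0 addr0 expr0 mul1r.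
    apply: is_derive_estimate => e e0; near=> h.
    by rewrite /GRing.scale/= (_ : _ - _ = 0) ?normr0 ?mulr_ge0 ?(ltW e0)//; ring.
  split; last by move=> t _; exact: dP.
  by apply: derivable_within_continuous => t _; have [] := dP t.
move=> w Uw; pose P (t : R) := f (p + t *: (w - p)).
have dP (t : R) : t \in `[0, 1]%R -> is_derive t 1 P
    (\sum_i (w - p) 0 i * (t ^+ 0 * 'D_'e_i f (p + t *: (w - p)))).
  move=> t01; have Ut := starU Uw t01.
  have := is_derive_line (smooth_on_derivable (v := w - p) oU fU Ut).
  rewrite (derive_gradient _ oU (fU 1) Ut) /gradient_form.
  by under [X in is_derive _ _ _ X -> _]eq_bigr do rewrite -[X in _ * X]mul1r.
have pP : primitive01 (fun t : R =>
    \sum_i (w - p) 0 i * (t ^+ 0 * 'D_'e_i f (p + t *: (w - p)))) P.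
  split; last by move=> t t01; apply: dP; exact: subset_itv_oo_cc.
  by apply: derivable_within_continuous => t /dP[].
have cD i : continuous01 (fun t => t ^+ 0 * 'D_'e_i f (p + t *: (w - p))).
  have cDi x : U x -> {for x, continuous ('D_'e_i f)}.
    by move=> Ux; exact: (Ck_on_continuous (smooth_on_partial i fU 0) Ux).
  exact: (continuous01_hadamard (k := 0) cDi Uw).
have c0 : continuous01 (fun _ : R => 0 : R).
  by move=> t _; exact: cst_continuous.
have I0 : integral01 (fun _ : R => 0 : R) = 0.
  have := integral01_linear (-1) c0 c0.
  by rewrite mulr0 addr0 mulN1r addNr.
have Es i : (fun t : R => (w - p) 0 i * (t ^+ 0 * 'D_'e_i f (p + t *: (w - p)))) =
    (fun t => (w - p) 0 i * (t ^+ 0 * 'D_'e_i f (p + t *: (w - p))) + 0).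
  by apply/funext => t; rewrite addr0.
have := integral01E pP; rewrite integral01_sum; last first.
  by move=> i; rewrite Es; exact: continuous01_linear (cD i) c0.
rewrite /P scale1r scale0r addr0 [p + (w - p)]addrC subrK => E.
rewrite -[LHS](subrK (f p)) -E addrC; congr (f p + _); apply: eq_bigr => i _.
by rewrite Es (integral01_linear _ (cD i) c0) I0 addr0 !mxE.
Unshelve. all: by end_near. Qed.

End Hadamard.

(** * Bump functions *)

Section Bump.
Context {R : realType}.

(** The exponents [j] are needed to differentiate [exp (- 1 / s)]: the derivative
    of [flat j] is a combination of [flat j.+1] and [flat j.+2]. *)
Definition flat (j : nat) (s : R) : R :=
  if 0 < s then s^-1 ^+ j * expR (- s^-1) else 0.

Lemma flat_le0 j s : s <= 0 -> flat j s = 0.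
Proof. by rewrite /flat ltNge => ->. Qed.

Lemma flat_gt0 j s : 0 < s -> 0 < flat j s.
Proof. by move=> s0; rewrite /flat s0 mulr_gt0 ?expR_gt0// exprn_gt0 ?invr_gt0. Qed.

Lemma flat_ge0 j s : 0 <= flat j s.
Proof.
by have [/flat_le0->//|/flat_gt0/ltW] := lerP s 0.
Qed.

Lemma flatS j s : flat j s = s * flat j.+1 s.
Proof.
rewrite /flat; case: ifP => [s0|_]; last by rewrite mulr0.
by rewrite exprS !mulrA mulfV ?mul1r// gt_eqF.
Qed.

(** The exponential series dominates each of its terms; the linear bound gives
    both continuity and the vanishing of the derivative at [0]. *)
Lemma flat_bound j s : 0 < s -> flat j s <= (j.+1)`!%:R * s.
Proof.
move=> s0; have s'0 : 0 <= s^-1 by rewrite invr_ge0 ltW.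
have f0 : (0 : R) < (j.+1)`!%:R by rewrite ltr0n fact_gt0.
have E1 : s^-1 ^+ j.+1 / (j.+1)`!%:R <= expR s^-1.
  by apply: le_trans (expR_ge1Dxn j s'0); rewrite lerDr.
have p0 : 0 < s^-1 ^+ j.+1 / (j.+1)`!%:R by rewrite divr_gt0// exprn_gt0 ?invr_gt0.
rewrite /flat s0 expRN.
apply: (@le_trans _ _ (s^-1 ^+ j * (s^-1 ^+ j.+1 / (j.+1)`!%:R)^-1)).
  by rewrite ler_wpM2l ?exprn_ge0// lef_pV2// posrE expR_gt0.
have K : s^-1 ^+ j * s ^+ j = 1 by rewrite -exprMn mulVf ?expr1n// gt_eqF.
rewrite invfM invrK -exprVn invrK exprS.
have -> (x y z : R) : x * (s * y * z) = x * y * (z * s) by ring.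
by rewrite K mul1r.
Qed.

Lemma is_derive_inv (s : R) : s != 0 ->
  is_derive s 1 (fun t : R => t^-1) (- s^-1 ^+ 2).
Proof.
move=> s0; split; first exact: (@derivableV _ _ id).
rewrite (@deriveV _ _ id)// derive_id [_ *: _]mulr1.
by rewrite exprVn.
Qed.

Lemma is_derive_flat (j : nat) (s : R) :
  is_derive (s : R) 1 (flat j) (- j%:R * flat j.+1 s + flat j.+2 s).
Proof.
have [s0|s0|->] := ltgtP s 0.
- rewrite !flat_le0 ?ltW// mulr0 addr0.
  apply: (@near_eq_is_derive _ _ _ (cst 0)) => //.
  near=> t; rewrite flat_le0// ltW//; near: t; exact: lt_nbhsl.
- have dV := is_derive_inv (lt0r_neq0 s0).
  have dX := is_deriveX j dV.
  have dN := is_deriveN dV.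
  have dE := is_derive1_comp (is_derive_expR _) dN.
  have := is_deriveM dX dE => dM.
  apply: (@near_eq_is_derive _ _ _ ((fun t : R => t^-1) ^+ j *
      (expR \o - (fun t : R => t^-1)))).
    near=> t; rewrite /flat ifT; last by near: t; exact: lt_nbhsr.
    by rewrite !fctE.
  apply: is_derive_eq.
  rewrite /flat s0 !fctE /GRing.scale/=.
  case: (j) => [|k] /=; first by rewrite !expr0; ring.
  by rewrite !exprS; ring.
- rewrite !flat_le0// mulr0 addr0; apply: is_derive_estimate => e e0.
  have f0 : (0 : R) < (j.+2)`!%:R by rewrite ltr0n fact_gt0.
  near=> h; rewrite add0r scaler0 subr0 [flat j 0]flat_le0// subr0 [h *: 1]mulr1.
  have [h0|h0] := lerP h 0.
    by rewrite flat_le0// normr0 mulr_ge0// ltW.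
  rewrite ger0_norm ?flat_ge0// gtr0_norm// flatS mulrC ler_wpM2r ?(ltW h0)//.
  apply: le_trans (flat_bound _ h0) _.
  rewrite mulrC -ler_pdivlMr// ltW// -[h]gtr0_norm//; near: h.
  exact: (@near_norm R R^o _ (divr_gt0 e0 f0)).
Unshelve. all: by end_near. Qed.

Lemma smooth_on_flat n (U : set 'rV[R]_n) (f : 'rV[R]_n -> R) j :
  open U -> smooth_on U f -> smooth_on U (fun x => flat j (f x)).
Proof.
move=> oU fU k; elim: k j => [|k IH] j; (split; first by
  move=> x Ux; apply: continuous_comp; first exact: smooth_on_continuous fU Ux;
  apply: differentiable_continuous; apply/derivable1_diffP;
  have [] := is_derive_flat j (f x)).
  by [].
have dfl y : differentiable (flat j) y.
  by apply/derivable1_diffP; have [] := is_derive_flat j y.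
move=> i.
have dc x : U x -> is_derive x 'e_i (flat j \o f)
    ('D_'e_i f x * (- j%:R * flat j.+1 (f x) + flat j.+2 (f x))).
  move=> Ux.
  have [d1 e1] := chain_rule (smooth_on_derivable (v := 'e_i) oU fU Ux) (dfl (f x)).
  split=> //; rewrite e1.
  have [d2 e2] := is_derive_flat j (f x).
  have [_] := derivable_scale ('D_'e_i f x) d2.
  by rewrite [_ *: 1]mulr1 => ->; rewrite e2.
split; first by move=> x /dc[].
apply: (@Ck_on_ext _ _ _ oU _ (fun x => 'D_'e_i f x * (- j%:R * flat j.+1 (f x)
  + flat j.+2 (f x)))).
  by move=> x /dc[_ ->].
apply: (Ck_onM oU); first exact: smooth_on_partial.
apply: (Ck_onD oU); last exact: IH.
by apply: (Ck_onM oU); [exact: Ck_on_cst|exact: IH].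
Qed.

Definition bump_fun n (p : 'rV[R]_n) (r : R) (w : 'rV[R]_n) : R :=
  flat 0 (r ^+ 2 - \sum_i (w 0 i - p 0 i) ^+ 2).

Lemma smooth_on_bump n (U : set 'rV[R]_n) p r : open U ->
  smooth_on U (bump_fun p r).
Proof.
move=> oU; apply: (smooth_on_flat _ oU).
apply: (smooth_on_ext oU (f := fun w => r ^+ 2 + (-1) *
    \sum_i (w 0 i + - p 0 i) * (w 0 i + - p 0 i))).
  by move=> w _; rewrite mulN1r; under eq_bigr do rewrite -expr2.
apply: (smooth_onD oU); first exact: smooth_on_cst.
apply: (smooth_onM oU); first exact: smooth_on_cst.
apply: (smooth_on_sum _ oU) => i.
suff H : smooth_on U (fun w : 'rV[R]_n => w 0 i + - p 0 i) by exact: smooth_onM.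
by apply: (smooth_onD oU); [exact: smooth_on_coord|exact: smooth_on_cst].
Qed.

Lemma bump_ge0 n (p : 'rV[R]_n) r w : 0 <= bump_fun p r w.
Proof. exact: flat_ge0. Qed.

Lemma bump_center n (p : 'rV[R]_n) r : 0 < r -> 0 < bump_fun p r p.
Proof.
move=> r0; apply: flat_gt0; rewrite big1 ?subr0 ?exprn_gt0// => i _.
by rewrite subrr expr0n.
Qed.

Lemma bump_out n (p : 'rV[R]_n) r w : 0 < r -> bump_fun p r w != 0 -> `|w - p| < r.
Proof.
move=> r0; apply: contraNT; rewrite -leNgt => rw; apply/eqP/flat_le0.
have wp0 : 0 < `|w - p| by exact: lt_le_trans rw.
have [i wi] : exists i, `|w - p| = `|(w - p) 0 i|.
  have [|[j i] E] := @mx_norm_neq0 _ _ _ (w - p); first by rewrite gt_eqF.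
  by exists i; rewrite {1}/Num.Def.normr/= E ord1.
rewrite subr_le0 (bigD1 i)//=; apply: ler_wpDr.
  by apply: sumr_ge0 => j _; exact: sqr_ge0.
rewrite -[leRHS]real_normK ?num_real// ler_sqr ?nnegrE ?(ltW r0)//.
by move: rw; rewrite wi !mxE.
Qed.

End Bump.

(** * Amenability of solvable groups *)

Section Mean.
Context {R : realType}.

Definition bounded_fun_by (T : Type) (C : R) (f : T -> R) : Prop :=
  forall x, `|f x| <= C.

Definition is_mean (T : Type) (m : (T -> R) -> R) : Prop :=
  [/\ forall (a C D : R) f g, bounded_fun_by C f -> bounded_fun_by D g ->
        m (fun x => a * f x + g x) = a * m f + m g,
      forall C f, bounded_fun_by C f -> `|m f| <= C &
      m (fun=> 1) = 1].

Section MeanTheory.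
Context {T : Type} (m : (T -> R) -> R) (mm : is_mean m).

Lemma bounded_fun_cst (a : R) : bounded_fun_by `|a| (fun _ : T => a).
Proof. by []. Qed.

Lemma bounded_linear (a C D : R) (f g : T -> R) :
  bounded_fun_by C f -> bounded_fun_by D g ->
  bounded_fun_by (`|a| * C + D) (fun x => a * f x + g x).
Proof.
move=> fC gD x; apply: le_trans (ler_normD _ _) _.
by rewrite lerD// normrM ler_wpM2l.
Qed.

Lemma mean_cst a : m (fun=> a) = a.
Proof.
have [L _ m1] := mm; have b := bounded_fun_cst.
have m0 : m (fun=> 0) = 0.
  have := L (-1) _ _ _ _ (b 0) (b 0).
  by rewrite (_ : (fun=> _) = (fun=> 0)) ?mulN1r ?addNr//; apply/funext => x;
    rewrite addr0 mulr0.
by have := L a _ _ _ _ (b 1) (b 0); rewrite m1 m0 mulr1 addr0.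
Qed.

Lemma meanD C D f g : bounded_fun_by C f -> bounded_fun_by D g ->
  m (fun x => f x + g x) = m f + m g.
Proof.
have [L _ _] := mm => fC gD; rewrite -[m f]mul1r -(L _ _ _ _ _ fC gD).
by congr m; apply/funext => x; rewrite mul1r.
Qed.

Lemma mean_ge0 C f : bounded_fun_by C f -> (forall x, 0 <= f x) -> 0 <= m f.
Proof.
move=> fC f0; have [L B _] := mm.
have := L (-1) _ _ _ _ fC (bounded_fun_cst (C / 2)).
have := B (C / 2) (fun x => -1 * f x + C / 2).
rewrite mean_cst mulN1r => H E; rewrite E in H.
have /H : bounded_fun_by (C / 2) (fun x => -1 * f x + C / 2).
  move=> x; have := fC x; rewrite (ger0_norm (f0 x)); have := f0 x.
  by rewrite ler_norml; lra.
by rewrite ler_norml; lra.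
Qed.

Lemma le_mean C D f g : bounded_fun_by C f -> bounded_fun_by D g ->
  (forall x, f x <= g x) -> m f <= m g.
Proof.
move=> fC gD fg; have [L _ _] := mm.
have := mean_ge0 (bounded_linear (-1) fC gD); rewrite (L _ _ _ _ _ fC gD).
by rewrite mulN1r addrC subr_ge0; apply=> x; rewrite addrC mulN1r subr_ge0.
Qed.

End MeanTheory.

Definition rtranslate (G : groupType) (g : G) (f : G -> R) : G -> R :=
  fun x => f (x * g)%g.

Lemma rtranslateM (G : groupType) (g h : G) f :
  rtranslate g (rtranslate h f) = rtranslate (g * h)%g f.
Proof. by apply/funext => x; rewrite /rtranslate mulgA. Qed.

Lemma bounded_rtranslate (G : groupType) (g : G) C f :
  bounded_fun_by C f -> bounded_fun_by C (rtranslate g f).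
Proof. by move=> fC x; exact: fC. Qed.

Definition right_invariant (G : groupType) (K : set G) (m : (G -> R) -> R) :
    Prop :=
  forall g C f, K g -> bounded_fun_by C f -> m (rtranslate g f) = m f.

Section UltraLimit.
Context {I : Type} (F : set_system I) {FU : UltraFilter F}.

Lemma ultra_cvg (a : I -> R) C : (forall i, `|a i| <= C) -> cvg (a @ F).
Proof.
move=> aC; have aF : (a @ F) `[- C, C]%classic.
  by apply: (@filterE _ F) => i /=; rewrite in_itv/= -ler_norml; exact: aC.
have [l [_ al]] := @segment_compact R (- C) C (a @ F) _ aF.
apply/cvg_ex; exists l => A lA.
have [//|FnA] := in_ultra_setVsetC (a @^-1` A) FU.
by have [x [nAx Ax]] := al (~` A) A FnA lA.
Qed.

Lemma is_mean_lim (T : Type) (m : I -> (T -> R) -> R) :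
  (forall i, is_mean (m i)) -> is_mean (fun f => lim (m i f @[i --> F])).
Proof.
move=> mm.
have cv C f : bounded_fun_by C f -> cvg (m i f @[i --> F]).
  by move=> fC; apply: (@ultra_cvg _ C) => i; have [_ B _] := mm i; exact: B.
split.
- move=> a C D f g fC gD.
  rewrite (_ : (fun i => m i _) = (fun i => a * m i f + m i g)); last first.
    by apply/funext => i; have [L _ _] := mm i; exact: L fC gD.
  apply: cvg_lim => //; apply: cvgD; last exact: cv gD.
  by apply: cvgMl_tmp; exact: cv fC.
- move=> C f fC; have c := cv _ _ fC.
  have B i : `|m i f| <= C by have [_ B _] := mm i; exact: B.
  rewrite ler_norml; apply/andP; split.
    by apply: limr_ge => //; near=> i; have := B i; rewrite ler_norml => /andP[].
  by apply: limr_le => //; near=> i; have := B i; rewrite ler_norml => /andP[].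
- rewrite (_ : (fun i => m i _) = (fun i => 1)); last first.
    by apply/funext => i; have [_ _ ->] := mm i.
  by apply: cvg_lim => //; exact: cvg_cst.
Unshelve. all: by end_near. Qed.

End UltraLimit.

(** If [K] is abelian modulo [H], an [H]-invariant mean can be averaged over the
    powers of finitely many elements of [K].  The averages remain [H]-invariant
    because [K] acts commutatively on [H]-invariant means, and become invariant
    under [K] in the limit. *)
Section AbelianExtension.
Context {G : groupType} (H K : set G).
Hypothesis HK : H `<=` K.
Hypothesis KV : forall x, K x -> K x^-1%g.
Hypothesis KX : forall x k, K x -> K (x ^+ k)%g.
Hypothesis KR : forall x y, K x -> K y -> H [~ x, y]%g.

Let ext_mean (m : (G -> R) -> R) := is_mean m /\ right_invariant H m.

Lemma ext_mean_commute m g g' C f : ext_mean m -> K g -> K g' -> bounded_fun_by C f ->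
  m (rtranslate g (rtranslate g' f)) = m (rtranslate g' (rtranslate g f)).
Proof.
move=> [_ mH] Kg Kg' fC; rewrite !rtranslateM commgCV -(rtranslateM [~ g^-1, g'^-1]%g).
apply: (mH _ C); first by apply: KR; exact: KV.
exact: bounded_rtranslate.
Qed.

(** The average of the translates of [m] by the products of powers
    [g_1 ^ k_1 ... g_l ^ k_l] with [0 <= k_i <= N]. *)
Fixpoint cesaro (m : (G -> R) -> R) (N : nat) (s : seq G) (f : G -> R) : R :=
  if s is g :: s' then
    N.+1%:R^-1 * \sum_(k < N.+1) cesaro m N s' (rtranslate (g ^+ k)%g f)
  else m f.

Lemma ler_average (N : nat) (a : nat -> R) C : (forall k, `|a k| <= C) ->
  `|N.+1%:R^-1 * \sum_(k < N.+1) a k| <= C.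
Proof.
move=> aC; rewrite normrM normfV normr_nat ler_pdivrMl ?ltr0n//.
apply: le_trans (ler_norm_sum _ _ _) _.
apply: (@le_trans _ _ (\sum_(k < N.+1) C)); first exact: ler_sum.
by rewrite sumr_const card_ord mulr_natl.
Qed.

Lemma cesaro_ext_mean m N s : ext_mean m -> (forall g, g \in s -> K g) ->
  ext_mean (cesaro m N s).
Proof.
move=> gm; elim: s => [|g s IH] Ks //=.
have Kg : K g by apply: Ks; rewrite mem_head.
have {}IH : ext_mean (cesaro m N s).
  by apply: IH => h hs; apply: Ks; rewrite in_cons hs orbT.
have [[L B m1] inv] := IH; split; first split.
- move=> a C D f f' fC fD; rewrite mulrCA -mulrDr; congr (_ * _).
  rewrite mulr_sumr -big_split/=; apply: eq_bigr => k _.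
  apply: (L a C D (rtranslate _ f) (rtranslate _ f'));
    exact: bounded_rtranslate.
- by move=> C f fC; apply: (@ler_average N (fun k =>
    cesaro m N s (rtranslate (g ^+ k)%g f))) => k; apply: B; exact: bounded_rtranslate.
- rewrite (eq_bigr (fun=> 1)) => [|k _]; last exact: m1.
  by rewrite sumr_const card_ord mulVf.
- move=> h C f Hh fC; congr (_ * _); apply: eq_bigr => k _.
  rewrite (ext_mean_commute IH (KX k Kg) (HK Hh) fC).
  by apply: (inv h C) => //; exact: bounded_rtranslate.
Qed.

Lemma cesaro_almost_invariant m N s g C f : ext_mean m ->
  (forall g, g \in s -> K g) -> g \in s -> bounded_fun_by C f ->
  `|cesaro m N s (rtranslate g f) - cesaro m N s f| <= N.+1%:R^-1 * (2 * C).
Proof.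
move=> gm; elim: s f => [|g' s IH] f Ks //=.
have Ks' h : h \in s -> K h by move=> hs; apply: Ks; rewrite in_cons hs orbT.
have Kg' : K g' by apply: Ks; rewrite mem_head.
have gs := cesaro_ext_mean N gm Ks'.
have [[_ B _] _] := gs.
(* For the outermost factor the sum telescopes; for an inner one the translation
   commutes past the powers of [g']. *)
rewrite in_cons -mulrBr -sumrB => /predU1P[->|sg] fC.
  rewrite (eq_bigr (fun k : 'I_N.+1 => cesaro m N s (rtranslate (g' ^+ k.+1)%g f) -
      cesaro m N s (rtranslate (g' ^+ k)%g f))); last first.
    by move=> k _; rewrite rtranslateM -expgSr.
  rewrite -(big_mkord xpredT (fun k => cesaro m N s (rtranslate (g' ^+ k.+1)%g f) -
      cesaro m N s (rtranslate (g' ^+ k)%g f))) telescope_sumr//.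
  rewrite normrM normfV normr_nat ler_wpM2l//.
  apply: le_trans (ler_normB _ _) _; rewrite mulr2n mulrDl mul1r.
  by rewrite lerD//; apply: B; exact: bounded_rtranslate.
apply: (@ler_average N (fun k => cesaro m N s (rtranslate (g' ^+ k)%g (rtranslate g f))
  - cesaro m N s (rtranslate (g' ^+ k)%g f))) => k.
rewrite (ext_mean_commute gs (KX k Kg') (Ks' _ sg) fC).
by apply: IH => //; exact: bounded_rtranslate.
Qed.

(** An ultrafilter on the pairs made of a finite list of elements of [K] and an
    exponent bound, finer than the order filter, selects a limit of the
    averages. *)
Lemma mean_extension : K 1%g -> (exists m, ext_mean m) ->
  exists m, is_mean m /\ right_invariant K m.
Proof.
move=> K1 [m gm].
pose D := [set i : seq G * nat | forall g, g \in i.1 -> K g].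
pose B (i : seq G * nat) : set (seq G * nat) :=
  [set j | [/\ D j, {subset i.1 <= j.1} & (i.2 <= j.2)%N]].
have PF : ProperFilter (filter_from D B).
  apply: filter_from_proper; last first.
    by move=> i Di; exists i; split.
  apply: filter_from_filter; first by exists ([::], 0%N).
  move=> i j Di Dj; exists (i.1 ++ j.1, maxn i.2 j.2).
    by move=> g /=; rewrite mem_cat => /orP[/Di|/Dj].
  move=> k [Dk /= sub]; rewrite geq_max => /andP[ik jk].
  by split; split=> // g gi; apply: sub; rewrite mem_cat gi ?orbT.
have [F [FU sF]] := ultraFilterLemma PF.
pose m_ (i : seq G * nat) := if pselect (D i) then cesaro m i.2 i.1 else m.
have gm_ i : ext_mean (m_ i).
  by rewrite /m_; case: pselect => // Di; exact: cesaro_ext_mean.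
exists (fun f => lim (m_ i f @[i --> F])); split.
  by apply: is_mean_lim => i; have [] := gm_ i.
move=> g C f Kg fC.
have fC' := bounded_rtranslate g fC.
have cv f' : bounded_fun_by C f' -> cvg (m_ i f' @[i --> F]).
  move=> f'C; apply: (@ultra_cvg _ F _ _ C) => i.
  by have [[_ B' _] _] := gm_ i; exact: B'.
apply/eqP; rewrite -subr_eq0 -(limB (cv _ fC') (cv _ fC)); apply/eqP.
apply: cvg_lim => //; apply/cvgrPdist_le => e e0.
have [N HN] : exists N : nat, N.+1%:R^-1 * (2 * C) <= e.
  pose N := Num.truncn (2 * C / e); exists N.
  rewrite ler_pdivrMl ?ltr0n// -ler_pdivrMr//.
  by apply: ltW; exact: truncnS_gt.
apply: (sF _); exists ([:: g], N).
  by move=> h; rewrite inE => /eqP->.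
move=> [s N'] [/= Ds sub NN']; rewrite sub0r normrN.
have mE : m_ (s, N') = cesaro m N' s by rewrite /m_; case: pselect.
rewrite -[X in `|X|]/(m_ (s, N') (rtranslate g f) - m_ (s, N') f) mE.
have C0 : 0 <= C by exact: le_trans (normr_ge0 _) (fC 1%g).
have gs : g \in s by apply: sub; rewrite mem_head.
apply: le_trans (cesaro_almost_invariant N' gm Ds gs fC) _.
apply: le_trans HN; rewrite ler_wpM2r ?mulr_ge0// lef_pV2 ?posrE ?ltr0n//.
by rewrite ler_nat ltnS.
Qed.

End AbelianExtension.

Section Solvable.
Context {G : groupType}.

Lemma subgroup_gen_sub (A : set G) : A `<=` subgroup_gen A.
Proof. by move=> x Ax H [_]; exact. Qed.

Lemma subgroup_gen_min (A H : set G) :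
  is_subgroup H -> A `<=` H -> subgroup_gen A `<=` H.
Proof. by move=> sH AH x; apply; split. Qed.

Lemma subgroup_gen_subgroup (A : set G) : is_subgroup (subgroup_gen A).
Proof.
split=> [H [[H1 _] _] //|x y Ax Ay H [sH AH]].
by have [_ HM] := sH; apply: HM; [exact: Ax|exact: Ay].
Qed.

Lemma derived_series_subgroup k : is_subgroup (@derived_series G k).
Proof. by case: k => [|k] //=; exact: subgroup_gen_subgroup. Qed.

Lemma subgroupV (H : set G) x : is_subgroup H -> H x -> H x^-1%g.
Proof. by move=> [H1 HM] Hx; rewrite -[x^-1%g]mul1g; exact: HM. Qed.

Lemma subgroupM (H : set G) x y : is_subgroup H -> H x -> H y -> H (x * y)%g.
Proof.
by move=> sH Hx Hy; rewrite -[y]invgK; apply: sH.2 => //; exact: subgroupV.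
Qed.

Lemma subgroupX (H : set G) x k : is_subgroup H -> H x -> H (x ^+ k)%g.
Proof.
move=> sH Hx; elim: k => [|k IH]; first by rewrite expg0; exact: sH.1.
by rewrite expgS; exact: subgroupM.
Qed.

Lemma derived_series_sub k : @derived_series G k.+1 `<=` derived_series k.
Proof.
have sk := derived_series_subgroup k.
apply: subgroup_gen_min => // z [x [y [Dx Dy ->]]].
rewrite commgEl conjgE; apply: subgroupM (subgroupV sk Dx) _ => //.
by apply: subgroupM (subgroupV sk Dy) _ => //; exact: subgroupM.
Qed.

(** Induction along the derived series, from the evaluation at [1], which is a
    mean invariant under the trivial group. *)
Lemma solvable_mean : solvable_group G ->
  exists m : (G -> R) -> R, is_mean m /\ right_invariant setT m.
Proof.
move=> [k Dk].
suff H j : (j <= k)%N -> exists m : (G -> R) -> R,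
    is_mean m /\ right_invariant (derived_series (k - j)) m.
  by have := H k (leqnn k); rewrite subnn.
elim: j => [_|j IH jk].
  exists (fun f => f 1%g); split; first by split=> // C f; exact.
  by rewrite subn0 Dk => g C f -> _; rewrite /rtranslate mulg1.
have kj : (k - j)%N = (k - j.+1).+1 by rewrite subnSK.
have := IH (ltnW jk); rewrite kj => IHj.
have sk := derived_series_subgroup (k - j.+1).
apply: mean_extension IHj.
- exact: derived_series_sub.
- by move=> x; exact: subgroupV.
- by move=> x l; exact: subgroupX.
- by move=> x y Dx Dy; apply: subgroup_gen_sub; exists x, y.
- exact: sk.1.
Qed.

End Solvable.

End Mean.

(** * Smooth functions on manifolds *)

Lemma open_preimage_in (S T : topologicalType) (O : set S) (F : S -> T)
    (W : set T) : open O -> open W -> (forall x, O x -> {for x, continuous F}) ->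
  open [set x | O x /\ W (F x)].
Proof.
move=> oO oW cF; rewrite openE => x [Ox WFx].
apply: filterI; first exact: open_nbhs_nbhs.
by apply: (cF _ Ox); exact: open_nbhs_nbhs.
Qed.

Section ManifoldFunctions.
Context {R : realType} {n : nat} {M : manifoldType R n}.
Implicit Types (c d : chart R n M) (f g : M -> R).

Lemma chart_cod_fun c x : chart_dom c x -> chart_cod c (chart_fun c x).
Proof. by exists x. Qed.

Lemma chart_inv_dom c v : chart_cod c v -> chart_dom c (chart_inv c v).
Proof. by case=> x cx <-; rewrite chart_funK. Qed.

Lemma chart_invK c v : chart_cod c v -> chart_fun c (chart_inv c v) = v.
Proof. by case=> x cx <-; rewrite chart_funK. Qed.

Lemma open_cod c : open (chart_cod c). Proof. exact: chart_cod_open. Qed.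

Lemma open_cod_preimage c (O : set M) :
  open O -> open [set v | chart_cod c v /\ O (chart_inv c v)].
Proof.
move=> oO; apply: open_preimage_in => //; first exact: open_cod.
exact: chart_inv_continuous.
Qed.

Lemma open_dom_preimage c (W : set 'rV[R]_n) :
  open W -> open [set x | chart_dom c x /\ W (chart_fun c x)].
Proof.
move=> oW; apply: open_preimage_in => //; first exact: chart_dom_open.
exact: chart_fun_continuous.
Qed.

Lemma overlapE c d : chart_fun c @` (chart_dom c `&` chart_dom d) =
  [set v | chart_cod c v /\ chart_dom d (chart_inv c v)].
Proof.
apply/seteqP; split=> v /=.
  by case=> x [cx dx] <-; rewrite chart_funK//; split=> //; exists x.
by case=> [[x cx <-]]; rewrite chart_funK// => dx; exists x.
Qed.

(** By compatibility of the atlas, smoothness is a local property that can be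
    checked in one chart around each point. *)
Lemma smooth_local f :
  (forall p, exists c, [/\ atlas M c, chart_dom c p & exists2 W, open W /\
     W (chart_fun c p) & smooth_on (W `&` chart_cod c) (f \o chart_inv c)]) ->
  smooth (manifold_smooth M) f.
Proof.
move=> fl c0 ac0; apply: smooth_on_local => u c0u.
pose x := chart_inv c0 u.
have c0x : chart_dom c0 x by exact: chart_inv_dom.
have [c [ac cx [W [oW Wx] fW]]] := fl x.
have sT := atlas_compatible _ _ ac0 ac.
rewrite overlapE in sT.
set O := [set v | _ /\ _] in sT.
have oO : open O by apply: open_cod_preimage; exact: chart_dom_open.
have cT v : O v -> {for v, continuous (chart_fun c \o chart_inv c0)}.
  by move=> Ov; apply: continuous_rV => j; exact: smooth_on_continuous (sT j) Ov.
have oWc : open (W `&` chart_cod c) by apply: openI => //; exact: open_cod.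
pose V := [set v | O v /\ (W `&` chart_cod c) (chart_fun c (chart_inv c0 v))].
have oV : open V.
  exact: (open_preimage_in (F := chart_fun c \o chart_inv c0) oO oWc cT).
exists V.
  by split; split => //; exact: chart_cod_fun.
apply: (smooth_on_ext oV (f := (f \o chart_inv c) \o (chart_fun c \o chart_inv c0))).
  by move=> v [[_ Ov] _] /=; rewrite chart_funK.
apply: (smooth_on_comp oV oWc _ _ fW) => [v []//|].
by move=> j; apply: smooth_onS (sT j) => v [].
Qed.

Lemma smooth_near_eq f :
  (forall p : M, exists2 g, smooth (manifold_smooth M) g & \forall y \near p, f y = g y) ->
  smooth (manifold_smooth M) f.
Proof.
move=> fl; apply: smooth_local => p.
have [c ac cp] := atlas_cover p.
exists c; split => //.
have [g sg fgp] := fl p.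
have : nbhs p [set y | f y = g y] by exact: fgp.
rewrite nbhsE => -[Q [oO Op] fg].
have oV := open_cod_preimage (c := c) oO.
exists [set v | chart_cod c v /\ Q (chart_inv c v)].
  by split => //; split; [exact: chart_cod_fun|rewrite chart_funK].
have oV' := openI oV (open_cod (c := c)).
apply: (smooth_on_ext oV' (f := g \o chart_inv c)).
  by move=> v [[_ Ov] _] /=; rewrite fg.
by apply: smooth_onS (sg c ac) => v [].
Qed.

Lemma smooth_continuous f : smooth (manifold_smooth M) f -> continuous f.
Proof.
move=> sf p; have [c ac cp] := atlas_cover p.
have E : {near p, (f \o chart_inv c) \o chart_fun c =1 f}.
  have : \forall x \near p, chart_dom c x.
    by apply: open_nbhs_nbhs; split => //; exact: chart_dom_open.
  by apply: filterS => x cx /=; rewrite chart_funK.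
rewrite /continuous_at -[X in _ --> X](nbhs_singleton E).
apply: cvg_trans; first exact: (near_eq_cvg E).
apply: continuous_comp; first exact: chart_fun_continuous.
by apply: (smooth_on_continuous (sf c ac)); exact: chart_cod_fun.
Qed.

End ManifoldFunctions.

Section RowBlocks.
Context {R : realType} {n : nat}.

Lemma lsubmx_continuous : continuous (fun v : 'rV[R]_(n + n) => lsubmx v).
Proof.
move=> v; apply: continuous_rV => j; rewrite (_ : (fun _ => _) =
  (fun y : 'rV[R]_(n + n) => y 0 (lshift n j))); last first.
  by apply/funext => y; rewrite mxE.
exact: (@coord_continuous R 1 (n + n) 0 _ v).
Qed.

Lemma rsubmx_continuous : continuous (fun v : 'rV[R]_(n + n) => rsubmx v).
Proof.
move=> v; apply: continuous_rV => j; rewrite (_ : (fun _ => _) =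
  (fun y : 'rV[R]_(n + n) => y 0 (rshift n j))); last first.
  by apply/funext => y; rewrite mxE.
exact: (@coord_continuous R 1 (n + n) 0 _ v).
Qed.

Lemma smooth_row_mxl (U : set 'rV[R]_n) (e : 'rV[R]_n) :
  open U -> smooth_map_on U (fun u => row_mx u e).
Proof.
move=> oU j; case: (splitP j) => k jk.
  have -> : j = lshift n k by exact: val_inj.
  apply: (smooth_on_ext oU) (smooth_on_coord k oU) => u _.
  by rewrite row_mxEl.
have -> : j = rshift n k by exact: val_inj.
apply: (smooth_on_ext oU) (smooth_on_cst (e 0 k) oU) => u _.
by rewrite row_mxEr.
Qed.

Lemma smooth_row_mxr (U : set 'rV[R]_n) (e : 'rV[R]_n) :
  open U -> smooth_map_on U (fun u => row_mx e u).
Proof.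
move=> oU j; case: (splitP j) => k jk.
  have -> : j = lshift n k by exact: val_inj.
  apply: (smooth_on_ext oU) (smooth_on_cst (e 0 k) oU) => u _.
  by rewrite row_mxEl.
have -> : j = rshift n k by exact: val_inj.
apply: (smooth_on_ext oU) (smooth_on_coord k oU) => u _.
by rewrite row_mxEr.
Qed.

Lemma derive_row_mxr (F : 'rV[R]_(n + n) -> R) (u w v : 'rV[R]_n) :
  'D_v (fun w => F (row_mx u w)) w = 'D_(row_mx 0 v) F (row_mx u w).
Proof.
rewrite /derive; congr (lim (_ @ 0^')); apply/funext => h /=.
by rewrite scale_row_mx add_row_mx scaler0 add0r.
Qed.

Lemma derive_row_mxl (F : 'rV[R]_(n + n) -> R) (u w v : 'rV[R]_n) :
  'D_v (fun u => F (row_mx u w)) u = 'D_(row_mx v 0) F (row_mx u w).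
Proof.
rewrite /derive; congr (lim (_ @ 0^')); apply/funext => h /=.
by rewrite scale_row_mx add_row_mx scaler0 add0r.
Qed.

End RowBlocks.

(** * Invariant derivations of functions on a Lie group *)

Section LieGroupCalculus.
Context {R : realType} {n : nat} {G : lieGroupType R n}.
Implicit Types (c d : chart R n G) (f g : G -> R).
Local Notation S := (manifold_smooth G).

Lemma mul_cvg (T : topologicalType) (F : set_system T) {FF : Filter F}
    (a b : T -> G) (x y : G) : a @ F --> x -> b @ F --> y ->
  (fun t => (a t * b t)%g) @ F --> (x * y)%g.
Proof.
move=> ax by_; apply: (cvg_comp2 ax by_).
exact: (@lie_mul_continuous R n G (x, y)).
Qed.

Lemma nbhs_mul (V : set G) : nbhs (1%g : G) V -> exists U W : set G,
  [/\ nbhs (1%g : G) U, nbhs (1%g : G) W & forall u w, U u -> W w -> V (u * w)%g].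
Proof.
move=> nV.
have ca : (fun z : G * G => z.1) z @[z --> ((1%g, 1%g) : G * G)] --> (1%g : G).
  exact: cvg_fst.
have cb : (fun z : G * G => z.2) z @[z --> ((1%g, 1%g) : G * G)] --> (1%g : G).
  exact: cvg_snd.
have cd : (fun z : G * G => (z.1 * z.2)%g) z @[z --> ((1%g, 1%g) : G * G)]
    --> (1%g : G).
  by rewrite -[X in _ --> X](mulg1 (1%g : G)); apply: mul_cvg.
have [[U W] /= [nU nW] UW] : nbhs ((1%g, 1%g) : G * G)
    (fun z : G * G => V (z.1 * z.2)%g) by exact: near_comp cd nV.
by exists U, W; split=> // u w Uu Ww; exact: (UW (u, w) (conj Uu Ww)).
Qed.

Lemma lmul_continuous (a : G) : continuous (fun x : G => (a * x)%g).
Proof. by move=> x; apply: mul_cvg; [exact: cvg_cst|exact: cvg_id]. Qed.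

Lemma rmul_continuous (a : G) : continuous (fun x : G => (x * a)%g).
Proof. by move=> x; apply: mul_cvg; [exact: cvg_id|exact: cvg_cst]. Qed.

(** The product of [G] read in a pair of charts.  Differentiating along the two
    blocks of coordinates gives the right and the left invariant fields. *)
Definition mul_chart c1 c2 (v : 'rV[R]_(n + n)) : G :=
  (chart_inv c1 (lsubmx v) * chart_inv c2 (rsubmx v))%g.

Definition cod2 c1 c2 : set 'rV[R]_(n + n) :=
  [set v | chart_cod c1 (lsubmx v) /\ chart_cod c2 (rsubmx v)].

Lemma open_cod2 c1 c2 : open (cod2 c1 c2).
Proof.
have -> : cod2 c1 c2 = (fun v => lsubmx v) @^-1` (chart_cod c1) `&`
  (fun v => rsubmx v) @^-1` (chart_cod c2) by [].
apply: openI.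
  by apply: open_comp; [move=> x _; exact: lsubmx_continuous|exact: open_cod].
by apply: open_comp; [move=> x _; exact: rsubmx_continuous|exact: open_cod].
Qed.

Lemma mul_chart_continuous c1 c2 v :
  cod2 c1 c2 v -> {for v, continuous (mul_chart c1 c2)}.
Proof.
move=> [v1 v2].
have H1 : {for v, continuous (chart_inv c1 \o (fun v => lsubmx v))}.
  by apply: continuous_comp; [exact: lsubmx_continuous|exact: chart_inv_continuous].
have H2 : {for v, continuous (chart_inv c2 \o (fun v => rsubmx v))}.
  by apply: continuous_comp; [exact: rsubmx_continuous|exact: chart_inv_continuous].
exact: (mul_cvg H1 H2).
Qed.

Lemma smooth_mul_chart c1 c2 f : atlas G c1 -> atlas G c2 -> smooth S f ->
  smooth_on (cod2 c1 c2) (f \o mul_chart c1 c2).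
Proof.
move=> a1 a2 sf; apply: smooth_on_local => v0 Uv0.
have [c3 a3 c3p] := atlas_cover (mul_chart c1 c2 v0).
pose V := [set v | cod2 c1 c2 v /\ chart_dom c3 (mul_chart c1 c2 v)].
have oV : open V.
  apply: open_preimage_in; [exact: open_cod2|exact: chart_dom_open|].
  by move=> v; exact: mul_chart_continuous.
exists V; first by split.
apply: (smooth_on_ext oV (f := (f \o chart_inv c3) \o
    (chart_fun c3 \o mul_chart c1 c2))).
  by move=> v [_ vd] /=; rewrite chart_funK.
apply: (smooth_on_comp oV (open_cod (c := c3)) _ _ (sf _ a3)).
  by move=> v [_ vd]; exact: chart_cod_fun.
move=> j; apply: smooth_onS (lie_mul_smooth c1 c2 c3 a1 a2 a3 j).
by move=> v [[v1 v2] v3].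
Qed.

Lemma smooth_ltranslate (a : G) f : smooth S f -> smooth S (fun x => f (a * x)%g).
Proof.
move=> sf; apply: smooth_local => p.
have [c2 a2 c2p] := atlas_cover p; have [c1 a1 c1a] := atlas_cover a.
exists c2; split => //; exists setT; first by split => //; exact: openT.
rewrite setTI; have oU := open_cod (c := c2).
apply: (smooth_on_ext oU (f := (f \o mul_chart c1 c2) \o
    (fun u => row_mx (chart_fun c1 a) u))).
  by move=> u _; rewrite /= /mul_chart row_mxKl row_mxKr chart_funK.
apply: (smooth_on_comp oU (open_cod2 (c1 := c1) (c2 := c2)) _ _
  (smooth_mul_chart a1 a2 sf)); last exact: smooth_row_mxr.
move=> u cu; split; rewrite ?row_mxKl ?row_mxKr//; exact: chart_cod_fun.
Qed.

Lemma smooth_rtranslate (a : G) f : smooth S f -> smooth S (fun x => f (x * a)%g).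
Proof.
move=> sf; apply: smooth_local => p.
have [c1 a1 c1p] := atlas_cover p; have [c2 a2 c2a] := atlas_cover a.
exists c1; split => //; exists setT; first by split => //; exact: openT.
rewrite setTI; have oU := open_cod (c := c1).
apply: (smooth_on_ext oU (f := (f \o mul_chart c1 c2) \o
    (fun u => row_mx u (chart_fun c2 a)))).
  by move=> u _; rewrite /= /mul_chart row_mxKl row_mxKr chart_funK.
apply: (smooth_on_comp oU (open_cod2 (c1 := c1) (c2 := c2)) _ _
  (smooth_mul_chart a1 a2 sf)); last exact: smooth_row_mxl.
move=> u cu; split; rewrite ?row_mxKl ?row_mxKr//; exact: chart_cod_fun.
Qed.

Definition chart1 : chart R n G := s2val (cid2 (atlas_cover (1%g : G))).

Lemma atlas_chart1 : atlas G chart1.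
Proof. by rewrite /chart1; case: cid2. Qed.

Lemma chart1_dom : chart_dom chart1 1%g.
Proof. by rewrite /chart1; case: cid2. Qed.

Definition origin : 'rV[R]_n := chart_fun chart1 1%g.

Lemma cod_origin : chart_cod chart1 origin.
Proof. exact: chart_cod_fun chart1_dom. Qed.

Lemma inv_origin : chart_inv chart1 origin = 1%g.
Proof. exact: chart_funK chart1_dom. Qed.

(** The left and the right invariant fields with value [v] at the identity, as
    operators on arbitrary functions; a derivative at one fixed point of one
    fixed chart makes the invariance visible. *)
Definition lfield (v : 'rV[R]_n) (f : G -> R) (x : G) : R :=
  'D_v (fun w => f (x * chart_inv chart1 w)%g) origin.

Definition rfield (v : 'rV[R]_n) (f : G -> R) (x : G) : R :=
  'D_v (fun w => f (chart_inv chart1 w * x)%g) origin.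

Lemma lfield_chart c v f u : 
  lfield v f (chart_inv c u) =
  'D_(row_mx 0 v) (f \o mul_chart c chart1) (row_mx u origin).
Proof.
rewrite -derive_row_mxr /lfield; congr ('D_v _ origin); apply/funext => w.
by rewrite /= /mul_chart row_mxKl row_mxKr.
Qed.

Lemma rfield_chart c v f u :
  rfield v f (chart_inv c u) =
  'D_(row_mx v 0) (f \o mul_chart chart1 c) (row_mx origin u).
Proof.
rewrite -derive_row_mxl /rfield; congr ('D_v _ origin); apply/funext => w.
by rewrite /= /mul_chart row_mxKl row_mxKr.
Qed.

Lemma smooth_lfield v f : smooth S f -> smooth S (lfield v f).
Proof.
move=> sf; apply: smooth_local => p; have [c ac cp] := atlas_cover p.
exists c; split => //; exists setT; first by split => //; exact: openT.
rewrite setTI; have oU := open_cod (c := c).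
pose F := 'D_(row_mx 0 v) (f \o mul_chart c chart1).
apply: (smooth_on_ext oU (f := F \o (fun u => row_mx u origin))).
  by move=> u _; rewrite /= lfield_chart.
have oC := open_cod2 (c1 := c) (c2 := chart1).
apply: (smooth_on_comp oU oC _ (smooth_row_mxl _ oU)
  (smooth_on_derive _ oC (smooth_mul_chart ac atlas_chart1 sf))).
move=> u cu; split; rewrite ?row_mxKl ?row_mxKr//; exact: cod_origin.
Qed.

Lemma smooth_rfield v f : smooth S f -> smooth S (rfield v f).
Proof.
move=> sf; apply: smooth_local => p; have [c ac cp] := atlas_cover p.
exists c; split => //; exists setT; first by split => //; exact: openT.
rewrite setTI; have oU := open_cod (c := c).
pose F := 'D_(row_mx v 0) (f \o mul_chart chart1 c).
apply: (smooth_on_ext oU (f := F \o (fun u => row_mx origin u))).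
  by move=> u _; rewrite /= rfield_chart.
have oC := open_cod2 (c1 := chart1) (c2 := c).
apply: (smooth_on_comp oU oC _ (smooth_row_mxr _ oU)
  (smooth_on_derive _ oC (smooth_mul_chart atlas_chart1 ac sf))).
move=> u cu; split; rewrite ?row_mxKl ?row_mxKr//; exact: cod_origin.
Qed.

Lemma derivable_ltranslate f x : smooth S f ->
  differentiable (fun w => f (x * chart_inv chart1 w)%g) origin.
Proof.
move=> sf; have := smooth_ltranslate x sf => /(_ _ atlas_chart1).
move=> /smooth_on_differentiable; apply; [exact: open_cod|exact: cod_origin].
Qed.

Lemma lfield_ltranslate v f (a x : G) :
  lfield v (fun y => f (a * y)%g) x = lfield v f (a * x)%g.
Proof. by rewrite /lfield; under eq_fun do rewrite mulgA. Qed.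

Lemma lfield_local v f g (x : G) : {near x, f =1 g} ->
  lfield v f x = lfield v g x.
Proof.
move=> fg; apply: near_eq_derive.
have c : {for origin, continuous (fun w => (x * chart_inv chart1 w)%g)}.
  apply: (@continuous_comp _ _ _ (chart_inv chart1) (fun y => (x * y)%g)).
    exact: chart_inv_continuous cod_origin.
  exact: lmul_continuous.
move: c; rewrite /prop_for /continuous_at inv_origin mulg1 => c.
exact: (c _ fg).
Qed.

Lemma lfield_linear v (a : R) f g x : smooth S f -> smooth S g ->
  lfield v (fun y => a * f y + g y) x = a * lfield v f x + lfield v g x.
Proof.
move=> sf sg; rewrite /lfield.
have df : derivable (fun w => f (x * chart_inv chart1 w)%g) origin v.
  exact: diff_derivable (derivable_ltranslate x sf).
have dg : derivable (fun w => g (x * chart_inv chart1 w)%g) origin v.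
  exact: diff_derivable (derivable_ltranslate x sg).
rewrite (_ : (fun w => _) = a *: (fun w => f (x * chart_inv chart1 w)%g) +
    (fun w => g (x * chart_inv chart1 w)%g)); last by [].
by rewrite (deriveD (derivableZ (k := a) df) dg) (deriveZ a df).
Qed.

Lemma lfieldM v f g x : smooth S f -> smooth S g ->
  lfield v (fun y => f y * g y) x = lfield v f x * g x + f x * lfield v g x.
Proof.
move=> sf sg; rewrite /lfield.
have df : derivable (fun w => f (x * chart_inv chart1 w)%g) origin v.
  exact: diff_derivable (derivable_ltranslate x sf).
have dg : derivable (fun w => g (x * chart_inv chart1 w)%g) origin v.
  exact: diff_derivable (derivable_ltranslate x sg).
rewrite (_ : (fun w => _) = (fun w => f (x * chart_inv chart1 w)%g) *
    (fun w => g (x * chart_inv chart1 w)%g)); last by [].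
by rewrite (deriveM df dg) inv_origin mulg1 addrC /GRing.scale/= [_ * g x]mulrC.
Qed.

(** Left and right translations commute, hence so do the fields that generate
    them; infinitesimally this is the equality of mixed partial derivatives. *)
Lemma lfield_rfield v w f x : smooth S f ->
  lfield w (rfield v f) x = rfield v (lfield w f) x.
Proof.
move=> sf; pose F u := f (chart_inv chart1 (lsubmx u) * x * chart_inv chart1 (rsubmx u))%g.
have sF : smooth_on (cod2 chart1 chart1) F.
  apply: smooth_on_local => u0 [u1 u2].
  have [c3 a3 c3p] := atlas_cover (chart_inv chart1 (lsubmx u0) * x)%g.
  have [c4 a4 c4x] := atlas_cover x.
  pose h u := chart_fun c3 (chart_inv chart1 u * x)%g.
  have ch : {in chart_cod chart1,
      continuous (fun u => (chart_inv chart1 u * x)%g)}.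
    move=> u /set_mem cu.
    apply: (@continuous_comp _ _ _ (chart_inv chart1) (fun y => (y * x)%g)).
      exact: chart_inv_continuous.
    exact: rmul_continuous.
  pose W := [set u | chart_cod chart1 u /\ chart_dom c3 (chart_inv chart1 u * x)%g].
  have oW : open W.
    apply: open_preimage_in; [exact: open_cod|exact: chart_dom_open|].
    by move=> u /mem_set; exact: ch.
  have sh : smooth_map_on W h.
    move=> j; pose U' := [set u : 'rV[R]_(n + n) |
      [/\ chart_cod chart1 (lsubmx u), chart_cod c4 (rsubmx u) &
          chart_dom c3 (chart_inv chart1 (lsubmx u) * chart_inv c4 (rsubmx u))%g]].
    have oU' : open U'.
      rewrite (_ : U' = [set u | cod2 chart1 c4 u /\
        chart_dom c3 (mul_chart chart1 c4 u)]); last first.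
        by apply/seteqP; split=> u; [case=> [? ? ?]; split|case=> [[? ?] ?]; split].
      apply: open_preimage_in; [exact: open_cod2|exact: chart_dom_open|].
      by move=> u; exact: mul_chart_continuous.
    apply: (smooth_on_ext oW (f := (fun u => (chart_fun c3 \o mul_chart chart1 c4) u 0 j)
       \o (fun u => row_mx u (chart_fun c4 x)))).
      by move=> u _; rewrite /= /mul_chart row_mxKl row_mxKr chart_funK.
    apply: (smooth_on_comp oW oU' _ (smooth_row_mxl _ oW)
      (lie_mul_smooth chart1 c4 c3 atlas_chart1 a4 a3 j)).
    move=> u [cu du]; split; rewrite ?row_mxKl ?row_mxKr ?chart_funK//.
    exact: chart_cod_fun.
  pose V := [set u : 'rV[R]_(n + n) | W (lsubmx u) /\ chart_cod chart1 (rsubmx u)].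
  have oV : open V.
    have -> : V = (fun v => lsubmx v) @^-1` W `&`
      (fun v => rsubmx v) @^-1` (chart_cod chart1) by [].
    apply: openI.
      by apply: open_comp => // u _; exact: lsubmx_continuous.
    by apply: open_comp; [move=> u _; exact: rsubmx_continuous|exact: open_cod].
  exists V; first by split.
  apply: (smooth_on_ext oV (f := (f \o mul_chart c3 chart1) \o
      (fun u => row_mx (h (lsubmx u)) (rsubmx u)))).
    by move=> u [[_ du] _]; rewrite /= /mul_chart row_mxKl row_mxKr chart_funK.
  apply: (smooth_on_comp oV (open_cod2 (c1 := c3) (c2 := chart1)) _ _
    (smooth_mul_chart a3 atlas_chart1 sf)).
    move=> u [[_ du] cu]; split; rewrite ?row_mxKl ?row_mxKr//.
    exact: chart_cod_fun.
  move=> j; case: (splitP j) => k jk.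
    have -> : j = lshift n k by exact: val_inj.
    apply: (smooth_on_ext oV (f := (fun w => h w 0 k) \o (fun u => lsubmx u))).
      by move=> u _; rewrite row_mxEl.
    apply: (smooth_on_comp oV oW _ _ (sh k)); first by move=> u [].
    move=> i; apply: (smooth_on_ext oV) (smooth_on_coord (lshift n i) oV) => u _.
    by rewrite mxE.
  have -> : j = rshift n k by exact: val_inj.
  apply: (smooth_on_ext oV) (smooth_on_coord (rshift n k) oV) => u _.
  by rewrite row_mxEr mxE.
have oC := open_cod2 (c1 := chart1) (c2 := chart1).
have C0 : cod2 chart1 chart1 (row_mx origin origin).
  by split; rewrite ?row_mxKl ?row_mxKr; exact: cod_origin.
have := derive_commute (row_mx v 0) (row_mx 0 w) oC sF C0.
rewrite -derive_row_mxr -derive_row_mxl.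
have -> : (fun w0 => 'D_(row_mx v 0) F (row_mx origin w0)) =
    (fun w0 => rfield v f (x * chart_inv chart1 w0)%g).
  apply/funext => w0; rewrite -derive_row_mxl /rfield.
  congr ('D_v _ origin); apply/funext => u.
  by rewrite /F row_mxKl row_mxKr mulgA.
have -> // : (fun u => 'D_(row_mx 0 w) F (row_mx u origin)) =
    (fun u => lfield w f (chart_inv chart1 u * x)%g).
apply/funext => u; rewrite -derive_row_mxr /lfield.
congr ('D_w _ origin); apply/funext => w0.
by rewrite /F row_mxKl row_mxKr.
Qed.

End LieGroupCalculus.

(** * Left invariant vector fields and cut-off functions *)

Lemma ltr_gap (R : realType) (a b c e : R) :
  b < a - e -> a <= b + c -> e < c.
Proof. lra. Qed.

Section LeftInvariantFields.
Context {R : realType} {n : nat} {G : lieGroupType R n}.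
Local Notation S := (manifold_smooth G).
Local Notation c1 := (@chart1 R n G).
Local Notation o1 := (@origin R n G).

Fact lfield_vfield_subproof v :
  (fun f : smooth_fun S => to_smooth (smooth_lfield v (smooth_funP f)))
  \in @vfield_pred R G S.
Proof.
apply/asboolP; split=> [a f g|f g]; apply: smooth_fun_eq => p /=.
  by rewrite lfield_linear//; exact: smooth_funP.
by rewrite lfieldM//; exact: smooth_funP.
Qed.

Definition lfield_vfield v : vfield S := VField (lfield_vfield_subproof v).

Fact lfield_algebra_subproof v : lfield_vfield v \in @left_invariant_pred R n G.
Proof.
apply/asboolP => a f g fg x /=; rewrite -lfield_ltranslate.
by congr lfield; apply/funext.
Qed.

Definition lfield_algebra v : lie_algebra G :=
  LeftInvariant (lfield_algebra_subproof v).

Lemma lfield_algebraE v (f : smooth_fun S) x : lfield_algebra v f x = lfield v f x.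
Proof. by []. Qed.

(** Functions on the ball of radius [r] of the chart at the identity that vanish
    off the concentric ball of radius [r / 2] extend by zero to smooth functions
    on the group, since the image of the smaller closed ball is compact, hence
    closed. *)
Section CutOff.
Variables (r : R) (r0 : 0 < r).
Hypothesis rcod : forall w : 'rV[R]_n, `|w - o1| < r -> chart_cod c1 w.

Let domr : set G := [set x | chart_dom c1 x /\ `|chart_fun c1 x - o1| < r].

Definition chart_extension (h : 'rV[R]_n -> R) (x : G) : R :=
  if `[< domr x >] then h (chart_fun c1 x) else 0.

Lemma chart_extensionE h w : `|w - o1| < r ->
  chart_extension h (chart_inv c1 w) = h w.
Proof.
move=> wr; rewrite /chart_extension asboolT ?chart_invK//; first exact: rcod.
by split; [exact: chart_inv_dom (rcod wr)|rewrite chart_invK//; exact: rcod].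
Qed.

Lemma open_ballo (e : R) : open [set w : 'rV[R]_n | `|w - o1| < e].
Proof.
rewrite openE => w /= we.
have d0 : 0 < e - `|w - o1| by rewrite subr_gt0.
apply: filterS (near_dist w d0) => y; rewrite ltrBrDr; apply: le_lt_trans.
by rewrite -[y - o1](subrKA w) ler_normD.
Qed.

Let K : set G := chart_inv c1 @` [set w | `|w - o1| <= r / 2].

Lemma compact_chart_ball : compact (chart_inv c1 @` [set w | `|w - o1| <= r / 2]).
Proof.
apply: continuous_compact.
  apply: continuous_in_subspaceT => w; rewrite inE /= => wr.
  apply: chart_inv_continuous; apply: rcod; apply: le_lt_trans wr _.
  by rewrite ltr_pdivrMr// ltr_pMr// ltr1n.
apply: bounded_closed_compact.
  exists (r / 2 + `|o1|); split; first exact: num_real.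
  move=> M rM w /= wr; apply: ltW; apply: le_lt_trans rM.
  by rewrite -[w in leLHS](subrK o1) (le_trans (ler_normD _ _))// lerD2r.
rewrite -openC openE => w /= /negP; rewrite -ltNge => wr.
have d0 : 0 < `|w - o1| - r / 2 by rewrite subr_gt0.
apply: filterS (near_dist w d0) => y yw /=; apply/negP; rewrite -ltNge.
have := ler_distD y w o1; rewrite [`|w - y|]distrC.
exact: ltr_gap yw.
Qed.

Let closedK : closed K.
Proof.
apply: compact_closed; first exact: manifold_hausdorff.
exact: compact_chart_ball.
Qed.

Lemma smooth_chart_extension h :
  smooth_on [set w | `|w - o1| < r] h ->
  (forall w, `|w - o1| < r -> h w != 0 -> `|w - o1| <= r / 2) ->
  smooth S (chart_extension h).
Proof.
move=> sh hK; apply: smooth_local => p.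
have [[pd pr]|np] := pselect (domr p).
  exists c1; split; [exact: atlas_chart1|exact: pd|].
  exists [set w | `|w - o1| < r]; first by split => //; exact: open_ballo.
  have oW := openI (@open_ballo r) (open_cod (c := c1)).
  apply: (smooth_on_ext oW (f := h)).
    by move=> w [wr _]; rewrite /= chart_extensionE.
  by apply: smooth_onS sh => w [].
have [c ac cp] := atlas_cover p.
have oK : open (~` K) by rewrite openC.
have oV := open_cod_preimage (c := c) oK.
exists c; split => //.
exists [set v | chart_cod c v /\ (~` K) (chart_inv c v)].
  split => //; split; first exact: chart_cod_fun.
  rewrite chart_funK// => -[w /= wr E]; apply: np; rewrite -E.
  have wr' : `|w - o1| < r.
    by apply: le_lt_trans wr _; rewrite ltr_pdivrMr// ltr_pMr// ltr1n.
  have wc := rcod wr'.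
  by split; [exact: chart_inv_dom|rewrite chart_invK].
have oV' := openI oV (open_cod (c := c)).
apply: (smooth_on_ext oV') (smooth_on_cst 0 oV') => v [[_ nK] _] /=.
rewrite /chart_extension; case: asboolP => // -[xd xr].
apply/esym/eqP/negPn/negP => /(hK _ xr) x2; apply: nK.
by exists (chart_fun c1 (chart_inv c v)) => //; rewrite chart_funK.
Qed.

Lemma chart_extension_near0 h z :
  (forall w, `|w - o1| < r -> h w != 0 -> `|w - o1| <= r / 2) ->
  ~ (chart_dom c1 z /\ `|chart_fun c1 z - o1| < r) ->
  \forall y \near z, chart_extension h y = 0.
Proof.
move=> hK nz; have nK : (~` K) z.
  move=> -[w /= wr E]; apply: nz; rewrite -E.
  have wr' : `|w - o1| < r.
    by apply: le_lt_trans wr _; rewrite ltr_pdivrMr// ltr_pMr// ltr1n.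
  have wc := rcod wr'.
  by split; [exact: chart_inv_dom|rewrite chart_invK].
have oK : open (~` K) by rewrite openC.
apply: filterS (open_nbhs_nbhs (conj oK nK)) => y nKy.
rewrite /chart_extension; case: asboolP => // -[yd yr].
apply/eqP/negPn/negP => /(hK _ yr) y2; apply: nKy.
by exists (chart_fun c1 y) => //; rewrite chart_funK.
Qed.

Definition bump1 : G -> R := chart_extension (bump_fun o1 (r / 2)).

Lemma smooth_bumpM h : smooth_on [set w | `|w - o1| < r] h ->
  smooth S (chart_extension (fun w => bump_fun o1 (r / 2) w * h w)).
Proof.
have r2 : 0 < r / 2 by rewrite divr_gt0.
move=> sh; apply: smooth_chart_extension.
  by apply: (smooth_onM (@open_ballo r)) => //; apply: smooth_on_bump; exact: open_ballo.
move=> w _; rewrite mulf_eq0 negb_or => /andP[b0 _].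
by apply: ltW; exact: bump_out r2 b0.
Qed.

Lemma smooth_bump1 : smooth S bump1.
Proof.
have r2 : 0 < r / 2 by rewrite divr_gt0.
apply: smooth_chart_extension; first by apply: smooth_on_bump; exact: open_ballo.
by move=> w _ b0; apply: ltW; exact: bump_out r2 b0.
Qed.

Lemma bump1_ge0 x : 0 <= bump1 x.
Proof. by rewrite /bump1 /chart_extension; case: asboolP => // _; exact: bump_ge0. Qed.

Lemma bump1_one : 0 < bump1 1%g.
Proof.
rewrite -inv_origin /bump1 chart_extensionE ?subrr ?normr0//.
by apply: bump_center; rewrite divr_gt0.
Qed.

Lemma bump1_near0 z : ~ (chart_dom c1 z /\ `|chart_fun c1 z - o1| < r) ->
  \forall y \near z, bump1 y = 0.
Proof.
have r2 : 0 < r / 2 by rewrite divr_gt0.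
apply: chart_extension_near0 => w _ b0.
by apply: ltW; exact: bump_out r2 b0.
Qed.

End CutOff.
End LeftInvariantFields.

(** * Tangent vectors at the identity *)

Section TangentCalculus.
Context {R : realType} {M : Type} {S : smooth_structure R M} {p : M}.
Variable D : tangent S p.
Implicit Types f g : smooth_fun S.

Lemma tangentP a f g : D (a *: f + g) = a * D f + D g.
Proof. by have /asboolP[L _] := tangent_valP D. Qed.

Lemma tangentM f g : D (f * g) = D f * g p + f p * D g.
Proof. by have /asboolP[_ L] := tangent_valP D. Qed.

Lemma tangent0 : D 0 = 0.
Proof.
have := tangentP (-1) 0 0.
by rewrite scaler0 addr0 mulN1r addNr.
Qed.

Lemma tangentD f g : D (f + g) = D f + D g.
Proof. by rewrite -[f]scale1r tangentP mul1r scale1r. Qed.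

Lemma tangentZ a f : D (a *: f) = a * D f.
Proof. by rewrite -[_ *: _]addr0 tangentP tangent0 addr0. Qed.

Lemma tangent_sum (I : Type) (r : seq I) (F : I -> smooth_fun S) :
  D (\sum_(i <- r) F i) = \sum_(i <- r) D (F i).
Proof.
elim: r => [|i r IH]; first by rewrite !big_nil tangent0.
by rewrite !big_cons tangentD IH.
Qed.

Lemma smooth_fun_sumE (I : Type) (r : seq I) (F : I -> smooth_fun S) (x : M) :
  (\sum_(i <- r) F i : smooth_fun S) x = \sum_(i <- r) F i x.
Proof. by elim: r => [|i r IH]; rewrite ?big_nil// !big_cons -IH. Qed.

End TangentCalculus.

Section TangentAtOne.
Context {R : realType} {n : nat} {G : lieGroupType R n}.
Local Notation S := (manifold_smooth G).
Local Notation c1 := (@chart1 R n G).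
Local Notation o1 := (@origin R n G).

Lemma chart1_radius (V : set G) : nbhs 1%g V -> exists2 r : R, 0 < r &
  forall w : 'rV[R]_n, `|w - o1| < r -> chart_cod c1 w /\ V (chart_inv c1 w).
Proof.
move=> V1.
have cV : nbhs o1 [set w | V (chart_inv c1 w)].
  have := chart_inv_continuous (cod_origin (G := G)).
  by rewrite /prop_for /continuous_at inv_origin => /(_ V V1).
have co : nbhs o1 (chart_cod c1).
  by apply: open_nbhs_nbhs; split; [exact: open_cod|exact: cod_origin].
have : nbhs o1 (chart_cod c1 `&` [set w | V (chart_inv c1 w)]) by exact: filterI.
move=> /nbhs_ballP[r /= r0 rV].
by exists r => // w wr; apply: rV; rewrite -ball_normE /= distrC.
Qed.

Lemma lfield_gradient v (f : G -> R) : smooth S f ->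
  lfield v f 1%g = \sum_i v 0 i * 'D_'e_i (f \o chart_inv c1) o1.
Proof.
move=> sf; rewrite /lfield; under eq_fun do rewrite mul1g.
exact: (derive_gradient _ (open_cod (c := c1)) (sf _ atlas_chart1 1) cod_origin).
Qed.

(** Hadamard's expansion [f = f(1) + sum_i x_i g_i], cut off by the square of a
    bump function [chi], is an identity between global functions.  A derivation
    [D] at the identity sees it through the values [D (chi x_i)] only: the
    contributions of [D chi] to both sides cancel. *)
Lemma tangent_one_lfield (D : tangent S (1%g : G)) :
  exists v, forall f : smooth_fun S, D f = lfield v f 1%g.
Proof.
have [r r0 rcod'] := chart1_radius (filterT : nbhs (1%g : G) setT).
have rcod (w : 'rV[R]_n) : `|w - o1| < r -> chart_cod c1 w by move=> /rcod'[].
have oB := @open_ballo R n G r.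
pose chi := to_smooth (smooth_bump1 r0 rcod).
pose x_ (i : 'I_n) (w : 'rV[R]_n) : R := w 0 i + - o1 0 i.
have sx i : smooth_on [set w : 'rV[R]_n | `|w - o1| < r] (x_ i).
  by apply: smooth_onD => //; [exact: smooth_on_coord|exact: smooth_on_cst].
pose A i := to_smooth (smooth_bumpM r0 rcod (sx i)).
pose c : R := chi 1%g.
have c0 : c != 0 by rewrite gt_eqF//; exact: bump1_one.
have A1 i : A i 1%g = 0.
  rewrite -inv_origin /= chart_extensionE ?subrr ?normr0//.
  by rewrite /x_ subrr mulr0.
exists (\row_i (D (A i) / c)) => f.
have sf := smooth_funP f.
have ball_star (w : 'rV[R]_n) (t : R) : `|w - o1| < r -> t \in `[0, 1]%R ->
    `|o1 + t *: (w - o1) - o1| < r.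
  move=> wr; rewrite in_itv/= => /andP[t0 t1].
  rewrite addrC addKr normrZ ger0_norm//.
  by apply: le_lt_trans wr; rewrite ler_piMl.
have Bo : `|o1 - o1| < r by rewrite subrr normr0.
have sfB : smooth_on [set w : 'rV[R]_n | `|w - o1| < r] (f \o chart_inv c1).
  by apply: smooth_onS (sf _ atlas_chart1) => w; exact: rcod.
have [g [sg g1 fE]] := hadamard_expansion oB ball_star sfB Bo.
pose B i := to_smooth (smooth_bumpM r0 rcod (sg i)).
have B1 i : B i 1%g = c * 'D_'e_i (f \o chart_inv c1) o1.
  rewrite /c -[in LHS]inv_origin -[in RHS]inv_origin /= /bump1.
  by rewrite !chart_extensionE// g1.
have E : f * (chi * chi) = f 1%g *: (chi * chi) + \sum_i A i * B i.
  apply: smooth_fun_eq => p.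
  rewrite /= !fctE smooth_fun_sumE /= /bump1.
  have [[pd pr]|np] := pselect (chart_dom c1 p /\ `|chart_fun c1 p - o1| < r).
    rewrite -(chart_funK pd) !chart_extensionE//.
    under eq_bigr do rewrite !fctE !chart_extensionE//.
    have /= := fE _ pr; rewrite inv_origin => ->.
    rewrite mulrDl /GRing.scale/=; congr (_ + _).
    rewrite mulr_suml; apply: eq_bigr => i _.
    by rewrite /x_; ring.
  rewrite /chart_extension asboolF//.
  rewrite big1 => [|i _]; last by rewrite !fctE asboolF// mul0r.
  by rewrite addr0 !mulr0 /GRing.scale/= mulr0.
have := congr1 D E.
rewrite !tangentM tangentD tangentZ !tangentM tangent_sum.
under eq_bigr do rewrite tangentM A1 mul0r addr0 B1.
rewrite lfield_gradient//.
rewrite -/c /= !fctE -[bump1 r 1%g]/c => H.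
apply: (mulfI (mulf_neq0 c0 c0)).
rewrite mulr_sumr.
have F i : c * c * ((\row_i (D (A i) / c)) 0 i * 'D_'e_i (f \o chart_inv c1) o1) =
    D (A i) * (c * 'D_'e_i (f \o chart_inv c1) o1).
  by rewrite mxE; move: ('D_'e_i _ _) (D (A i)) => x y; field.
under [RHS]eq_bigr do rewrite F.
apply: (@addrI _ (f 1%g * (D chi * c + c * D chi))).
by rewrite -H; ring.
Qed.

Lemma lie_algebra_lfield (X : lie_algebra G) : exists v, X = lfield_algebra v.
Proof.
have [v Xv] := tangent_one_lfield (vfield_at X (1%g : G)).
exists v; apply/val_inj/vfield_eq => f x.
pose g := to_smooth (smooth_ltranslate x (smooth_funP f)).
have /asboolP XL := left_invariant_valP X.
have := XL x f g (fun=> erefl) 1%g; rewrite mulg1 => <-.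
have /= -> := Xv g.
by rewrite lfield_ltranslate mulg1.
Qed.

End TangentAtOne.

(** * Invariant means and cocompact lattices *)

Section CosetSpace.
Context {R : realType} {n : nat} {G : lieGroupType R n} (Gamma : groupClosed G).
Local Notation M := (coset_space Gamma).
Local Notation pr := (coset_proj Gamma).

(** A set-theoretic section of the projection, through which an invariant
    function on [G] defines a function on the quotient. *)
Definition crepr (q : M) : G := repr (q : {eq_quot (coset_equiv Gamma)}%qT).

Lemma creprK q : pr (crepr q) = q.
Proof. exact: (reprK (q : {eq_quot (coset_equiv Gamma)}%qT)). Qed.

Lemma coset_projP x y : pr x = pr y <-> (y * x^-1)%g \in Gamma.
Proof. exact: (rwP (@eqmodP _ (coset_equiv Gamma) x y)). Qed.

Lemma coset_projM g x : g \in Gamma -> pr (g * x)%g = pr x.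
Proof. by move=> gG; apply/esym/coset_projP; rewrite mulgK. Qed.

Lemma creprP x : exists2 g, g \in Gamma & crepr (pr x) = (g * x)%g.
Proof.
exists (crepr (pr x) * x^-1)%g; last by rewrite mulgVK.
by apply/coset_projP; rewrite creprK.
Qed.

Lemma coset_proj_open (O : set G) : open O -> open (pr @` O).
Proof.
move=> oO; have -> : open (pr @` O) = open (pr @^-1` (pr @` O)) by [].
rewrite openE => x [y Oy /coset_projP xy].
have oV : open (fun z => O ((y * x^-1) * z)%g).
  by apply: open_comp => // z _; exact: lmul_continuous.
have : nbhs x (fun z => O ((y * x^-1) * z)%g).
  by apply: open_nbhs_nbhs; split => //=; rewrite mulgVK.
apply: filterS => z Oz /=; exists ((y * x^-1) * z)%g => //.
apply: coset_projM; rewrite -[(y * x^-1)%g]invgK gpredV.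
by rewrite invgF.
Qed.

End CosetSpace.

Section Lattice.
Context {R : realType} {n : nat} {G : lieGroupType R n} {Gamma : groupClosed G}.
Local Notation S := (manifold_smooth G).
Local Notation M := (coset_space Gamma).
Local Notation pr := (coset_proj Gamma).
Local Notation c1 := (@chart1 R n G).
Local Notation o1 := (@origin R n G).
Hypothesis Gl : lattice Gamma.

(** Compactness of the quotient turns locally uniform statements about
    [Gamma]-invariant properties into uniform ones. *)
Lemma lattice_uniform (I : Type) (F : set_system I) (P : I -> G -> Prop) :
  Filter F ->
  (forall i g x, g \in Gamma -> P i x -> P i (g * x)%g) ->
  (forall x : G, \forall x' \near x & i \near F, P i x') ->
  \forall i \near F, forall x, P i x.
Proof.
move=> FF Pinv Ploc; have [_ /compact_near_coveringP nc] := Gl.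
apply: filterS (nc I F (fun i q => P i (crepr q)) FF _).
  move=> i Pi x; have := Pi (pr x) Logic.I; have [g gG ->] := creprP Gamma x.
  by move=> /(Pinv i g^-1%g); rewrite mulKg gpredV; apply.
move=> q _; have := Ploc (crepr q) => -[[A B] /= [nA nB] AB].
move: nA; rewrite nbhsE => -[Q [oQ Qq] QA].
exists (pr @` Q, B) => /=.
  split=> //; apply: open_nbhs_nbhs; split; first exact: coset_proj_open.
  by exists (crepr q) => //; rewrite creprK.
move=> [_ i] /= [[y Qy <-] Bi]; have [g gG ->] := creprP Gamma y.
by apply: Pinv => //; exact: (AB (y, i) (conj (QA _ Qy) Bi)).
Qed.

Definition invariant_fun (f : G -> R) : Prop :=
  forall g x, g \in Gamma -> f (g * x)%g = f x.

Lemma invariant_bounded f : invariant_fun f -> continuous f ->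
  exists C, bounded_fun_by C f.
Proof.
move=> fi fc.
have : \forall N \near \oo, forall x, `|f x| <= N%:R.
  apply: lattice_uniform => [N g x gG|x]; first by rewrite fi.
  have H1 : \forall x' \near x, `|f x'| <= `|f x| + 1.
    have /cvgrPdist_le/(_ _ ltr01) := fc x; apply: filterS => y xy.
    by rewrite -lerBlDl (le_trans (lerB_dist _ _))// distrC.
  have H2 : \forall N \near \oo, `|f x| + 1 <= N%:R by exact: nbhs_infty_ger.
  exists ([set y | `|f y| <= `|f x| + 1], [set N : nat | `|f x| + 1 <= N%:R]) => //.
  by move=> [y N] /= [H3 H4]; exact: le_trans H3 H4.
by case=> N _ /(_ N (leqnn N)) H; exists N%:R.
Qed.

(** The elements [x v x^-1] of [Gamma] with [v] near [1] are trivial near each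
    [x] by discreteness; the condition on [x] is [Gamma]-invariant. *)
Lemma injectivity_nbhs : \forall v \near (1%g : G), forall x,
  (x * v * x^-1)%g \in Gamma -> v = 1%g.
Proof.
apply: (lattice_uniform (P := fun v x => (x * v * x^-1)%g \in Gamma -> v = 1%g)).
  move=> v g x gG Pv; rewrite invgM !mulgA gpredMr ?gpredV// => H; apply: Pv.
  by move: H; rewrite -!mulgA gpredMl.
move=> x; have [G1 _] := Gl.
have cv : (fun z : G * G => (z.1 * z.2 * z.1^-1)%g) z @[z --> ((x, 1%g) : G * G)]
    --> (1%g : G).
  rewrite -[X in _ --> X](mulgV x) -{2}[x]mulg1.
  have ca : (fun z : G * G => z.1) z @[z --> ((x, 1%g) : G * G)] --> x by exact: cvg_fst.
  have cb : (fun z : G * G => z.2) z @[z --> ((x, 1%g) : G * G)] --> (1%g : G) by exact: cvg_snd.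
  apply: mul_cvg; first exact: mul_cvg.
  exact: (cvg_comp _ _ ca (@lie_inv_continuous R n G x)).
have H := G1 1%g gpred1.
have := near_comp cv H; apply: filterS => -[y v] /= Hv /Hv /divg1_eq E.
by apply: (@mulgI _ y); rewrite mulg1.
Qed.

Lemma invariant_lfield v f : invariant_fun f -> invariant_fun (lfield v f).
Proof.
move=> fi g x gG; rewrite -lfield_ltranslate.
by have -> : (fun y => f (g * y)%g) = f by apply/funext => y; exact: fi.
Qed.

(** A curve through the identity with velocity [v]; it replaces the one-parameter
    subgroup, as only its first order behaviour is used. *)
Definition curve v (t : R) : G := chart_inv c1 (o1 + t *: v).

Lemma curve_cvg v : curve v t @[t --> (0 : R)] --> (1%g : G).
Proof.
rewrite -inv_origin.
have c : o1 + t *: v @[t --> (0 : R)] --> o1.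
  rewrite -[X in _ --> X]addr0 -[X in _ + X](scale0r v).
  by apply: cvgD; [exact: cvg_cst|apply: cvgZr_tmp; exact: cvg_id].
exact: (cvg_comp _ _ c (chart_inv_continuous cod_origin)).
Qed.

Lemma row_mx_continuousl (c : chart R n G) (x : G) : chart_dom c x ->
  row_mx (chart_fun c y) o1 @[y --> x] --> row_mx (chart_fun c x) o1.
Proof.
move=> cx; apply: (continuous_rV (F := fun y => row_mx (chart_fun c y) o1)) => j.
case: (splitP j) => k jk.
  have -> : j = lshift n k by exact: val_inj.
  rewrite /prop_for /continuous_at row_mxEl.
  rewrite (_ : (fun y => _) = (fun u : 'rV[R]_n => u 0 k) \o chart_fun c); last first.
    by apply/funext => y; rewrite row_mxEl.
  exact: (cvg_comp _ _ (chart_fun_continuous cx) (@coord_continuous R 1 n 0 k _)).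
have -> : j = rshift n k by exact: val_inj.
rewrite /prop_for /continuous_at row_mxEr.
rewrite (_ : (fun y => _) = fun=> o1 0 k); first exact: cvg_cst.
by apply/funext => y; rewrite row_mxEr.
Qed.

Lemma row_mx_continuousr (c : chart R n G) (x : G) : chart_dom c x ->
  row_mx o1 (chart_fun c y) @[y --> x] --> row_mx o1 (chart_fun c x).
Proof.
move=> cx; apply: (continuous_rV (F := fun y => row_mx o1 (chart_fun c y))) => j.
case: (splitP j) => k jk.
  have -> : j = lshift n k by exact: val_inj.
  rewrite /prop_for /continuous_at row_mxEl.
  rewrite (_ : (fun y => _) = fun=> o1 0 k); first exact: cvg_cst.
  by apply/funext => y; rewrite row_mxEl.
have -> : j = rshift n k by exact: val_inj.
rewrite /prop_for /continuous_at row_mxEr.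
rewrite (_ : (fun y => _) = (fun u : 'rV[R]_n => u 0 k) \o chart_fun c); last first.
  by apply/funext => y; rewrite row_mxEr.
exact: (cvg_comp _ _ (chart_fun_continuous cx) (@coord_continuous R 1 n 0 k _)).
Qed.

Lemma strong_derive N (U : set 'rV[R]_N) (F : 'rV[R]_N -> R) p h :
  open U -> smooth_on U F -> U p -> forall e, 0 < e ->
  \forall q \near p & t \near (0 : R),
    `|F (q + t *: h) - F q - t * 'D_h F q| <= e * `|t|.
Proof.
move=> oU sF Up e e0.
have h1 : 0 < `|h| + 1 by rewrite ltr_wpDl.
have e'0 : 0 < e / (`|h| + 1) by rewrite divr_gt0.
have [[A B] /= [nA nB] AB] := strong_diff oU (sF 1) Up e'0.
exists (A `&` U, [set t | B (t *: h)]) => /=.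
  split; first by apply: filterI => //; exact: open_nbhs_nbhs.
  exact: near_scale.
move=> [q t] /= [[Aq Uq] Bt]; have := AB (q, t *: h) (conj Aq Bt) => /=.
rewrite -(derive_gradient _ oU (sF 1) Uq).
have [_ ->] := derivable_scale t (smooth_on_derivable (v := h) oU sF Uq).
move/le_trans; apply; rewrite normrZ mulrCA [leRHS]mulrC ler_wpM2l//.
by rewrite mulrAC ler_pdivrMr// ler_wpM2l ?(ltW e0)// lerDl.
Qed.

Lemma lfield_estimate v f (x : G) : smooth S f -> forall e, 0 < e ->
  \forall y \near x & t \near (0 : R),
    `|f (y * curve v t)%g - f y - t * lfield v f y| <= e * `|t|.
Proof.
move=> sf e e0; have [c ac cx] := atlas_cover x.
have oC := open_cod2 (c1 := c) (c2 := c1).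
have Cp : cod2 c c1 (row_mx (chart_fun c x) o1).
  by split; rewrite ?row_mxKl ?row_mxKr; [exact: chart_cod_fun|exact: cod_origin].
have [[A B] /= [nA nB] AB] := strong_derive (row_mx 0 v) oC
  (smooth_mul_chart ac atlas_chart1 sf) Cp e0.
exists ([set y | A (row_mx (chart_fun c y) o1)] `&` chart_dom c, B) => /=.
  split => //; apply: filterI.
    exact: near_comp (row_mx_continuousl cx) nA.
  by apply: open_nbhs_nbhs; split => //; exact: chart_dom_open.
move=> [y t] /= [[Ay cy] Bt]; have := AB (_, t) (conj Ay Bt) => /=.
rewrite -lfield_chart scale_row_mx add_row_mx scaler0 addr0 /mul_chart.
by rewrite !row_mxKl !row_mxKr chart_funK// inv_origin mulg1.
Qed.

Lemma rfield_estimate v f (x : G) : smooth S f -> forall e, 0 < e ->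
  \forall y \near x & t \near (0 : R),
    `|f (curve v t * y)%g - f y - t * rfield v f y| <= e * `|t|.
Proof.
move=> sf e e0; have [c ac cx] := atlas_cover x.
have oC := open_cod2 (c1 := c1) (c2 := c).
have Cp : cod2 c1 c (row_mx o1 (chart_fun c x)).
  by split; rewrite ?row_mxKl ?row_mxKr; [exact: cod_origin|exact: chart_cod_fun].
have [[A B] /= [nA nB] AB] := strong_derive (row_mx v 0) oC
  (smooth_mul_chart atlas_chart1 ac sf) Cp e0.
exists ([set y | A (row_mx o1 (chart_fun c y))] `&` chart_dom c, B) => /=.
  split => //; apply: filterI.
    exact: near_comp (row_mx_continuousr cx) nA.
  by apply: open_nbhs_nbhs; split => //; exact: chart_dom_open.
move=> [y t] /= [[Ay cy] Bt]; have := AB (_, t) (conj Ay Bt) => /=.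
rewrite -rfield_chart scale_row_mx add_row_mx scaler0 addr0 /mul_chart.
by rewrite !row_mxKl !row_mxKr chart_funK// inv_origin mul1g.
Qed.

Section InvariantMean.
Variable m : (G -> R) -> R.
Hypotheses (mm : is_mean m) (mi : right_invariant setT m).

(** The derivative is the limit of [(f (x c(t)) - f x) / t] for a curve [c],
    uniformly in [x] by compactness, and the mean of each difference quotient
    vanishes by invariance. *)
Lemma mean_lfield v f : smooth S f -> invariant_fun f -> m (lfield v f) = 0.
Proof.
move=> sf fi.
have [C fC] := invariant_bounded fi (smooth_continuous sf).
have [D fD] := invariant_bounded (invariant_lfield v fi)
  (smooth_continuous (smooth_lfield v sf)).
apply/eqP; rewrite -normr_le0; apply/ler_addgt0Pr => e e0; rewrite add0r.
pose P (t : R) x := `|f (x * curve v t)%g - f x - t * lfield v f x| <= e * `|t|.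
have Pi t g x : g \in Gamma -> P t x -> P t (g * x)%g.
  have Fi := invariant_lfield v fi.
  by move=> gG; rewrite /P -mulgA !(fi _ _ gG) (Fi _ _ gG).
have : \forall t \near (0 : R), forall x, P t x.
  apply: (@lattice_uniform R (nbhs (0 : R)) P _ Pi) => x.
  exact: lfield_estimate.
move=> /nbhs_ballP[d /= d0 dH].
pose t := d / 2; have t0 : 0 < t by rewrite divr_gt0.
have {}dH : forall x, `|f (x * curve v t)%g - f x - t * lfield v f x| <= e * t.
  have := dH t; rewrite /P (gtr0_norm t0); apply.
  rewrite -ball_normE /= sub0r normrN (gtr0_norm t0) ltr_pdivrMr// ltr_pMr//.
  by rewrite ltr1n.
have fC' := bounded_rtranslate (curve v t) fC.
have := (let: And3 _ B _ := mm in B) _ _ dH.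
have -> : (fun x => f (x * curve v t)%g - f x - t * lfield v f x) =
    (fun x => - t * lfield v f x + (-1 * f x + rtranslate (curve v t) f x)).
  by apply/funext => x; rewrite /rtranslate; ring.
have [L _ _] := mm.
rewrite (L _ _ _ _ _ fD (bounded_linear (-1) fC fC')) (L _ _ _ _ _ fC fC').
rewrite (mi (g := curve v t) (C := C) _ fC)// mulN1r addNr addr0 mulNr normrN.
by rewrite normrM (gtr0_norm t0) mulrC ler_pM2r.
Qed.

Lemma bounded_sum (s : seq G) (C : R) (f : G -> R) : bounded_fun_by C f ->
  bounded_fun_by (C *+ size s) (fun x => \sum_(g <- s) f (x * g)%g).
Proof.
move=> fC x; elim: s => [|g s IH]; first by rewrite big_nil normr0.
by rewrite big_cons mulrS (le_trans (ler_normD _ _))// lerD.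
Qed.

Lemma mean_sum_rtranslate (s : seq G) (C : R) (f : G -> R) : bounded_fun_by C f ->
  m (fun x => \sum_(g <- s) f (x * g)%g) = (size s)%:R * m f.
Proof.
move=> fC; elim: s => [|g s IH].
  rewrite mul0r -[RHS](mean_cst mm 0); congr m.
  by apply/funext => x; rewrite big_nil.
have -> : (fun x => \sum_(h <- g :: s) f (x * h)%g) =
    (fun x => rtranslate g f x + \sum_(h <- s) f (x * h)%g).
  by apply/funext => x; rewrite big_cons.
rewrite (meanD mm (bounded_rtranslate g fC) (bounded_sum s fC)) IH.
by rewrite (mi (C := C) _ fC)// -natr1 mulrDl mul1r addrC.
Qed.

(** Finitely many right translates of the set [f > f(x0) / 2] cover the compact
    quotient, so that a sum of translates of [f] is bounded from below. *)
Lemma mean_gt0 f (x0 : G) : invariant_fun f -> continuous f ->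
  (forall x, 0 <= f x) -> 0 < f x0 -> 0 < m f.
Proof.
move=> fi fc f0 fx0; have [C fC] := invariant_bounded fi fc.
(* compactness, in the form of a filter on finite lists of translations *)
pose B (s : seq G) : set (seq G) := [set s' : seq G | {subset s <= s'}].
have FF : Filter (filter_from setT B).
  apply: filter_from_filter; first by exists [::].
  move=> s s' _ _; exists (s ++ s') => // u us; split=> g gs; apply: us.
    by rewrite mem_cat gs.
  by rewrite mem_cat gs orbT.
have : \forall s \near filter_from setT B, forall x, exists2 g, g \in s &
    f x0 / 2 < f (x * g)%g.
  apply: (lattice_uniform (P := fun (s : seq G) x => exists2 g, g \in s &
    f x0 / 2 < f (x * g)%g)) => [s h x hG [g gs gx]|x].
    by exists g => //; rewrite -mulgA fi.
  exists ([set y | f x0 / 2 < f (y * (x^-1 * x0))%g], B [:: (x^-1 * x0)%g]) => /=.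
    split; last by exists [:: (x^-1 * x0)%g].
    have oV : open [set y | f x0 / 2 < f (y * (x^-1 * x0))%g].
      apply: (@open_comp _ _ (fun y => f (y * (x^-1 * x0))%g) [set z | f x0 / 2 < z]).
        move=> y _; apply: (@continuous_comp _ _ _ (fun y => (y * (x^-1 * x0))%g) f).
          exact: rmul_continuous.
        exact: fc.
      exact: open_gt.
    apply: open_nbhs_nbhs; split => //=.
    by rewrite mulVKg ltr_pdivrMr// ltr_pMr// ltr1n.
  move=> [y s] /= [yx sB]; exists (x^-1 * x0)%g => //.
  by apply: sB; rewrite mem_head.
case=> s _ /(_ s (fun _ => id)) H.
have : f x0 / 2 <= (size s)%:R * m f.
  rewrite -(mean_sum_rtranslate s fC) -[X in X <= _](mean_cst mm).
  apply: (le_mean mm (bounded_fun_cst (f x0 / 2)) (bounded_sum s fC)) => x.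
  have [g gs gx] := H x; apply: ltW; apply: lt_le_trans gx _.
  by rewrite (big_rem g)//= lerDl sumr_ge0.
move=> H'; rewrite lt_neqAle (mean_ge0 mm fC f0) andbT.
apply/eqP => m0; move: H'; rewrite -m0 mulr0 leNgt divr_gt0//.
Qed.

End InvariantMean.
End Lattice.

(** * Periodization *)

Section Periodization.
Context {R : realType} {n : nat} {G : lieGroupType R n} {Gamma : groupClosed G}.
Local Notation S := (manifold_smooth G).
Local Notation Q := (quotient_smooth Gamma).
Local Notation pr := (coset_proj Gamma).

(** The translates [x V] meet the orbits of [Gamma] in at most one point, and near
    each point [y0] this happens for at most one element of [Gamma].  Sums over
    orbits of functions with support in [x V] thus have a single term, locally
    given by a fixed element. *)
Definition wandering (V : set G) : Prop :=
  forall x y0 : G, exists2 g0, g0 \in Gamma &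
    \forall y \near y0, forall g, g \in Gamma -> g <> g0 -> ~ V (x^-1 * (g * y))%g.

(** Two visits of [x V] by orbits of nearby points give an element of [Gamma]
    conjugate to an element near [1], which is trivial by
    [injectivity_nbhs]. *)
Lemma wandering_exists : lattice Gamma ->
  exists2 V : set G, nbhs (1%g : G) V & wandering V.
Proof.
move=> Gl; pose V0 : set G := [set v | forall x : G,
  (x * v * x^-1)%g \in Gamma -> v = 1%g].
have nV0 : nbhs (1%g : G) V0 := injectivity_nbhs Gl.
have nV : exists2 V : set G, nbhs (1%g : G) V &
    forall a b, V a -> V b -> V0 (a * b^-1)%g.
  have ca : (fun z : G * G => z.1) z @[z --> ((1%g, 1%g) : G * G)] --> (1%g : G).
    exact: cvg_fst.
  have cb : (fun z : G * G => z.2) z @[z --> ((1%g, 1%g) : G * G)] --> (1%g : G).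
    exact: cvg_snd.
  have cd : (fun z : G * G => (z.1 * z.2^-1)%g) z @[z --> ((1%g, 1%g) : G * G)]
      --> (1%g : G).
    rewrite -[X in _ --> X](mulgV (1%g : G)); apply: mul_cvg => //.
    exact: (cvg_comp _ _ cb (@lie_inv_continuous R n G 1%g)).
  have [[A B] /= [nA nB] AB] := near_comp cd nV0.
  exists (A `&` B); first exact: filterI.
  by move=> a b [Aa _] [_ Bb]; exact: (AB (a, b) (conj Aa Bb)).
have {nV} [V nV VV] := nV.
have [V1 [W [nV1 nW VW]]] := nbhs_mul nV.
exists V1 => // x y0.
have nY : \forall y \near y0, W (y^-1 * y0)%g.
  have c : (y^-1 * y0)%g @[y --> y0] --> (1%g : G).
    rewrite -[X in _ --> X](mulVg y0); apply: mul_cvg; last exact: cvg_cst.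
    exact: (@lie_inv_continuous R n G y0).
  exact: near_comp c nW.
pose bad (g : G) := g \in Gamma /\
  exists2 y, W (y^-1 * y0)%g & V1 (x^-1 * (g * y))%g.
have bad_uniq g g' : bad g -> bad g' -> g = g'.
  move=> [gG [y Wy Vy]] [gG' [y' Wy' Vy']].
  have simp h z : (x^-1 * (h * z) * (z^-1 * y0))%g = (x^-1 * (h * y0))%g.
    by rewrite -!mulgA mulVKg.
  have H1 := VW _ _ Vy Wy; have H2 := VW _ _ Vy' Wy'.
  rewrite !simp in H1 H2.
  pose v := (x^-1 * (g * y0) * (x^-1 * (g' * y0))^-1)%g.
  have vE : (x * v * x^-1)%g = (g * g'^-1)%g.
    by rewrite /v !invgM invgK !mulgA mulgV mul1g !mulgK.
  have v1 : v = 1%g by apply: (VV _ _ H1 H2 x); rewrite vE gpredF.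
  by apply: divg1_eq; rewrite -vE v1 mulg1 mulgV.
have [[g0 bg0]|nobad] := pselect (exists g, bad g).
  exists g0; first by case: bg0.
  apply: filterS nY => y Wy g gG gg0 Vg; apply: gg0; apply: bad_uniq bg0.
  by split => //; exists y.
exists 1%g; first exact: gpred1.
apply: filterS nY => y Wy g gG _ Vg; apply: nobad; exists g.
by split => //; exists y.
Qed.

Section Fixed.
Variables (V : set G) (wV : wandering V).

(** Inclusion in [V] of the closed support of [f]. *)
Definition supported (f : G -> R) : Prop :=
  forall z, ~ V z -> \forall y \near z, f y = 0.

Lemma supported0 f z : supported f -> ~ V z -> f z = 0.
Proof. by move=> fV /fV /nbhs_singleton. Qed.

Lemma supported_lfield v f : supported f -> supported (lfield v f).
Proof.
move=> fV z /fV; rewrite -nbhs_nearE => /nbhs_interior; apply: filterS => y /= fy.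
rewrite (@lfield_local R n G v f (fun=> 0) y fy).
exact: derive_cst.
Qed.

Lemma supportedM f g : supported f -> supported (fun z => f z * g z).
Proof. by move=> fV z /fV; apply: filterS => y ->; rewrite mul0r. Qed.

(** The element of [Gamma] that brings [y] to [x V], when there is one. *)
Definition visit (x y : G) : G := s2val (cid2 (wV x y)).

Lemma visit_Gamma x y : visit x y \in Gamma.
Proof. by rewrite /visit; case: cid2. Qed.

Lemma visitP x y g : g \in Gamma -> g <> visit x y -> ~ V (x^-1 * (g * y))%g.
Proof.
rewrite /visit; case: cid2 => g0 /= g0G H.
by have := nbhs_singleton H; exact.
Qed.

(** The sum of [f (x^-1 g y)] over [g] in [Gamma], for [f] supported in [V]. *)
Definition periodize (x : G) (f : G -> R) (y : G) : R :=
  f (x^-1 * (visit x y * y))%g.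

Lemma periodizeE x f y g0 : supported f -> g0 \in Gamma ->
  (forall g, g \in Gamma -> g <> g0 -> ~ V (x^-1 * (g * y))%g) ->
  periodize x f y = f (x^-1 * (g0 * y))%g.
Proof.
move=> fV g0G H; rewrite /periodize; have [->//|/eqP vg0] := eqVneq (visit x y) g0.
have f0 z := @supported0 f z fV.
rewrite !f0//; first by apply: visitP => // E; exact: vg0.
by apply: H vg0; exact: visit_Gamma.
Qed.

Lemma periodize_near (x y0 : G) : exists2 g0, g0 \in Gamma &
  \forall y \near y0, forall f, supported f ->
    periodize x f y = f (x^-1 * (g0 * y))%g.
Proof.
have [g0 g0G H] := wV x y0; exists g0 => //.
by apply: filterS H => y H f fV; exact: periodizeE.
Qed.

Lemma periodize_invariant x f : supported f -> invariant_fun (Gamma := Gamma) (periodize x f).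
Proof.
move=> fV g y gG; have vG := visit_Gamma x y.
have E : (visit x y * g^-1 * (g * y))%g = (visit x y * y)%g by rewrite mulgA mulgVK.
rewrite (periodizeE (g0 := (visit x y * g^-1)%g)) ?E ?gpredF// => h hG hv.
rewrite [(h * (g * y))%g]mulgA; apply: visitP; first by rewrite gpredMl.
by move=> H; apply: hv; rewrite -H mulgK.
Qed.

Lemma smooth_periodize x f : smooth S f -> supported f -> smooth S (periodize x f).
Proof.
move=> sf fV; apply: smooth_near_eq => y0.
have [g0 g0G H] := periodize_near x y0.
exists (fun y => f (x^-1 * (g0 * y))%g).
  apply: (smooth_ltranslate (f := fun y => f (x^-1 * y)%g) g0).
  exact: smooth_ltranslate.
by apply: filterS H => y; apply.
Qed.

Lemma lfield_periodize v x f y : supported f ->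
  lfield v (periodize x f) y = periodize x (lfield v f) y.
Proof.
move=> fV; have lV := supported_lfield v fV; have [g0 g0G H] := periodize_near x y.
have -> := nbhs_singleton H (lfield v f) lV.
rewrite -!lfield_ltranslate; apply: lfield_local.
by apply: filterS H => z; apply.
Qed.

Lemma periodize_bound x C f : bounded_fun_by C f -> bounded_fun_by C (periodize x f).
Proof. by move=> fC y; exact: fC. Qed.

Lemma periodize_center f x : supported f -> V 1%g -> periodize x f x = f 1%g.
Proof.
move=> fV V1; rewrite (periodizeE (g0 := 1%g)) ?gpred1//.
  by rewrite mul1g mulVg.
move=> g gG g1 Vg.
have H : visit x x = 1%g.
  apply/eqP/negPn/negP => /eqP H.
  have := visitP (gpred1 (s := Gamma)) (fun E => H (esym E)).
  by rewrite mul1g mulVg; apply.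
by have := @visitP x x _ gG; rewrite H; apply.
Qed.

Lemma quotient_periodize_smooth x f : smooth S f -> supported f ->
  smooth Q (fun q => periodize x f (crepr q)).
Proof.
move=> sf fV; rewrite /= (_ : _ \o _ = periodize x f).
  exact: smooth_periodize.
apply/funext => y /=; have [g gG ->] := creprP Gamma y.
exact: periodize_invariant.
Qed.

Lemma periodize_crepr x f y : supported f ->
  periodize x f (crepr (pr y)) = periodize x f y.
Proof.
by move=> fV; have [g gG ->] := creprP Gamma y; exact: periodize_invariant.
Qed.

End Fixed.
End Periodization.

(** * Tangent spaces of the quotient *)

Section TangentQuotient.
Context {R : realType} {n : nat} {G : lieGroupType R n} {Gamma : groupClosed G}.
Local Notation S := (manifold_smooth G).
Local Notation Q := (quotient_smooth Gamma).
Local Notation pr := (coset_proj Gamma).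
Local Notation c1 := (@chart1 R n G).

Lemma bump_exists (V : set G) : nbhs (1%g : G) V ->
  exists chi : G -> R, [/\ smooth S chi, supported V chi,
    forall x, 0 <= chi x & 0 < chi 1%g].
Proof.
move=> /chart1_radius[r r0 rV].
have rcod (w : 'rV[R]_n) : `|w - origin (G := G)| < r -> chart_cod c1 w.
  by move=> /rV[].
exists (bump1 r); split.
- exact: smooth_bump1.
- move=> z nVz; apply: bump1_near0 => // -[zd zr]; apply: nVz.
  by have [_] := rV _ zr; rewrite chart_funK.
- by move=> x; exact: bump1_ge0.
- exact: bump1_one.
Qed.

(** A derivation [v] at the class of [x] becomes a derivation at the identity of
    [G] by evaluating it on the periodizations of [chi f], with a correction
    that makes up for [chi] not being constant near the identity; derivations
    at the identity are values of left invariant fields. *)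
Lemma tangent_quotient (x : G) (v : tangent Q (pr x)) : lattice Gamma ->
  exists Y : lie_algebra G, v = dcoset_proj Gamma (vfield_at Y x).
Proof.
move=> Gl; have [V nV wV] := wandering_exists Gl.
have [chi [schi cV chi0 c0]] := bump_exists nV.
have V1 := nbhs_singleton nV.
pose c := chi 1%g; have cn0 : c != 0 by rewrite gt_eqF.
have sA (f : smooth_fun S) : smooth S (fun z => chi z * f z).
  exact: (smoothM schi (smooth_funP f)).
have spA (f : smooth_fun S) : supported V (fun z => chi z * f z).
  exact: supportedM.
pose A f := to_smooth (quotient_periodize_smooth wV x (sA f) (spA f)).
have Ax f : A f (pr x) = c * f 1%g.
  rewrite -[LHS]/(periodize wV x (fun z => chi z * f z) (crepr (pr x))).
  by rewrite (periodize_crepr wV x x (spA f)) (periodize_center wV x (spA f) V1).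
(* the point of [V] that represents [q], if any *)
pose z (q : coset_space Gamma) := (x^-1 * (visit wV x (crepr q) * crepr q))%g.
have AE (f : smooth_fun S) q : A f q = chi (z q) * f (z q) by [].
have Alin (a : R) (f g : smooth_fun S) : A (a *: f + g) = a *: A f + A g.
  apply: smooth_fun_eq => q.
  rewrite -[RHS]/(a * A f q + A g q) !AE.
  rewrite -[(_ + _ : smooth_fun S) _]/(a * f (z q) + g (z q)); ring.
have AM (f g : smooth_fun S) : A f * A g = A 1 * A (f * g).
  apply: smooth_fun_eq => q.
  rewrite -[LHS]/(A f q * A g q) -[RHS]/(A 1 q * A (f * g) q) !AE.
  rewrite -[(f * g) _]/(f (z q) * g (z q)) -[(1 : smooth_fun S) _]/(1 : R); ring.
pose D (f : smooth_fun S) := c^-1 * (v (A f) - f 1%g * v (A 1)).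
have DP : D \in tangent_pred (1%g : G).
  apply/asboolP; split=> [a f g|f g].
    rewrite /D Alin tangentP -[(_ + _ : smooth_fun S) _]/(a * f 1%g + g 1%g); ring.
  have := congr1 v (AM f g); rewrite !tangentM !Ax.
  rewrite (_ : (1 : smooth_fun S) 1%g = 1)// mulr1 => E.
  apply: (mulfI cn0); rewrite /D [(f * g) 1%g]/(f 1%g * g 1%g).
  rewrite mulrA mulfV// mul1r.
  transitivity (v (A f) * g 1%g + f 1%g * v (A g) - f 1%g * g 1%g * v (A 1)
     - f 1%g * g 1%g * v (A 1)); last by field.
  congr (_ - _); apply: (mulfI cn0).
  apply: (@addrI _ (v (A 1) * (c * (f 1%g * g 1%g)))).
  rewrite -E; ring.
have [v0 Dv0] := tangent_one_lfield (Tangent DP).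
exists (lfield_algebra v0); apply/val_inj/funext => f /=.
pose F := to_smooth (smooth_ltranslate (n := n) (G := G) x (smooth_funP f : smooth S (f \o pr))).
have := Dv0 F; rewrite /= /D.
have -> : F 1%g = f (pr x) by rewrite /= mulg1.
have -> : A F = A 1 * f.
  apply: smooth_fun_eq => q.
  rewrite AE -[RHS]/(A 1 q * f q) AE -[(1 : smooth_fun S) _]/(1 : R) mulr1.
  congr (_ * f _); rewrite /= /z mulVKg coset_projM ?creprK//.
  exact: visit_Gamma.
rewrite tangentM Ax (_ : (1 : smooth_fun S) 1%g = 1)// mulr1.
rewrite (lfield_ltranslate v0 (f \o pr) x) mulg1 => <-.
by field.
Qed.

End TangentQuotient.

(** * The adjoint action *)

Section VectorFieldTheory.
Context {R : realType} {M : Type} {S : smooth_structure R M}.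
Implicit Types (X : vfield S) (f : smooth_fun S).

Lemma vfield0 X : X 0 = 0.
Proof. by have := vfieldB X 0 0; rewrite !subrr. Qed.

Lemma vfieldZ X (a : R) f : X (a *: f) = a *: X f.
Proof. by have := vfieldP X a f 0; rewrite vfield0 !addr0. Qed.

Lemma vfieldN X f : X (- f) = - X f.
Proof. by rewrite -scaleN1r vfieldZ scaleN1r. Qed.

Lemma vfield1 X : X 1 = 0.
Proof.
have := vfieldM X 1 1; rewrite !mulr1 mul1r => E.
by apply: (@addrI _ (X 1)); rewrite addr0 -E.
Qed.

End VectorFieldTheory.

Section Adjoint.
Context {R : realType} {n : nat} {G : lieGroupType R n}.
Local Notation S := (manifold_smooth G).
Implicit Types (X Y Z : lie_algebra G) (f : smooth_fun S).

Lemma lie_algebra_eq X Y : (forall f p, X f p = Y f p) -> X = Y.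
Proof. by move=> XY; apply/val_inj/vfield_eq. Qed.

Lemma lie_algebraDE X Y f p : (X + Y) f p = X f p + Y f p.
Proof. by []. Qed.

Lemma lie_algebraZE (a : R) X f p : (a *: X) f p = a * X f p.
Proof. by []. Qed.

Lemma lie_algebra_lieE X Y f p : (lie X Y : lie_algebra G) f p = X (Y f) p - Y (X f) p.
Proof. by []. Qed.

Lemma lie_algebraC X Y : lie X Y = - lie Y X.
Proof.
apply: lie_algebra_eq => f p.
rewrite -[(- lie Y X) f p]/(- ((lie Y X : lie_algebra G) f p)) !lie_algebra_lieE.
by rewrite opprB.
Qed.

Lemma lie_algebraDl X Y Z : lie (X + Y) Z = lie X Z + lie Y Z.
Proof. by rewrite -[X]scale1r lieP !scale1r. Qed.

Lemma lie_algebra0l Z : lie (0 : lie_algebra G) Z = 0.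
Proof. by apply: (@addrI _ (lie 0 Z)); rewrite -lie_algebraDl !addr0. Qed.

Lemma lie_algebraZl a X Z : lie (a *: X) Z = a *: lie X Z.
Proof. by rewrite -[a *: X]addr0 lieP lie_algebra0l addr0. Qed.

Lemma lie_algebraDr X Y Z : lie Z (X + Y) = lie Z X + lie Z Y.
Proof. by rewrite lie_algebraC lie_algebraDl opprD -!lie_algebraC. Qed.

Lemma lie_algebraZr a X Z : lie Z (a *: X) = a *: lie Z X.
Proof. by rewrite lie_algebraC lie_algebraZl -scalerN -lie_algebraC. Qed.

Fact adjoint_subproof1 z X :
  (fun f => to_smooth (smooth_rtranslate (G := G) z^-1%g (smooth_funP
     (X (to_smooth (smooth_rtranslate (G := G) z (smooth_funP f))))))) \in
  @vfield_pred R G S.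
Proof.
pose T f := to_smooth (smooth_rtranslate (G := G) z (smooth_funP f)).
apply/asboolP; split=> [a f g|f g]; apply: smooth_fun_eq => p.
  have E : T (a *: f + g) = a *: T f + T g by exact: smooth_fun_eq.
  by rewrite -[LHS]/(X (T (a *: f + g)) (p * z^-1)%g) E vfieldP.
have E : T (f * g) = T f * T g by exact: smooth_fun_eq.
rewrite -[LHS]/(X (T (f * g)) (p * z^-1)%g) E vfieldM.
rewrite -[LHS]/(X (T f) (p * z^-1)%g * T g (p * z^-1)%g +
  T f (p * z^-1)%g * X (T g) (p * z^-1)%g).
by rewrite /= !mulgVK.
Qed.

Fact adjoint_subproof2 z X :
  VField (adjoint_subproof1 z X) \in @left_invariant_pred R n G.
Proof.
apply/asboolP => a f g fg x /=.
have /asboolP XL := left_invariant_valP X.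
by rewrite -mulgA; apply: XL => y /=; rewrite fg mulgA.
Qed.

(** Conjugation of [X] by the right translation by [z] is the adjoint action,
    as left translations do not affect [X]. *)
Definition adjoint z X : lie_algebra G := LeftInvariant (adjoint_subproof2 z X).

Definition rtrans (z : G) f : smooth_fun S :=
  to_smooth (smooth_rtranslate (G := G) z (smooth_funP f)).

Lemma adjointE z X f x : adjoint z X f x = X (rtrans z f) (x * z^-1)%g.
Proof. by []. Qed.

Lemma adjoint_lie z X Y : adjoint z (lie X Y) = lie (adjoint z X) (adjoint z Y).
Proof.
apply: lie_algebra_eq => f x; rewrite adjointE !lie_algebra_lieE !adjointE.
have E W : rtrans z (adjoint z W f) = W (rtrans z f).
  by apply: smooth_fun_eq => y; rewrite /= mulgK.
by rewrite !E.
Qed.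

Lemma adjoint_eq0 z X : adjoint z X = 0 -> X = 0.
Proof.
move=> X0; apply: lie_algebra_eq => f x.
have E : rtrans z (rtrans z^-1%g f) = f.
  by apply: smooth_fun_eq => y; rewrite /= mulgK.
have := adjointE z X (rtrans z^-1%g f) (x * z)%g.
by rewrite X0 E mulgK => <-.
Qed.

Lemma rfield_adjoint v z f :
  rfield v f z = adjoint z (lfield_algebra v) f z.
Proof.
rewrite adjointE lfield_algebraE mulgV /rfield /lfield.
by under [in RHS]eq_fun do rewrite /= mul1g.
Qed.

(** An automorphism preserves the derived algebra, spanned by [B], and the
    relation [[A, B] = B] then forces the coefficient of [A] to be [1]. *)
Lemma adjoint_affine (A B : lie_algebra G) z : lie A B = B -> B <> 0 ->
  (forall Z, exists a b, Z = a *: A + b *: B) ->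
  exists b, adjoint z A = A + b *: B.
Proof.
move=> AB B0 span.
have [a [b Ea]] := span (adjoint z A); have [p [q Eb]] := span (adjoint z B).
have BB : lie B B = 0 by exact: liexx.
have BA : lie B A = - B by rewrite lie_algebraC AB.
have E := adjoint_lie z A B; rewrite AB Eb Ea in E.
move: E; rewrite lie_algebraDl !lie_algebraDr !lie_algebraZl !lie_algebraZr.
rewrite AB BA BB liexx !scaler0 add0r addr0 scalerN scalerN !scalerA -scalerBl.
move=> E.
have p0 : p = 0.
  have := congr1 (fun Z => lie Z B) E.
  rewrite lie_algebraDl !lie_algebraZl AB BB !scaler0 addr0 => /eqP.
  by rewrite scaler_eq0 => /orP[/eqP//|/eqP].
move: E; rewrite p0 scale0r add0r mulr0 subr0 => /eqP.
rewrite -subr_eq0 -scalerBl scaler_eq0 => /orP[|/eqP//].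
rewrite -{1}[q]mul1r -mulrBl mulf_eq0 subr_eq0 => /orP[/eqP a1|/eqP q0].
  by exists b; rewrite Ea -a1 scale1r.
by case: B0; apply: (@adjoint_eq0 z); rewrite Eb p0 q0 !scale0r addr0.
Qed.

End Adjoint.

(** * Absence of lattices in the affine group of the line *)

Section NoAffineLattice.
Context {R : realType} {n : nat} {G : lieGroupType R n} {Gamma : groupClosed G}.
Local Notation S := (manifold_smooth G).
Local Notation c1 := (@chart1 R n G).
Local Notation o1 := (@origin R n G).
Hypothesis Gl : lattice Gamma.

Lemma wanderingS (V W : set G) : W `<=` V -> wandering (Gamma := Gamma) V ->
  wandering (Gamma := Gamma) W.
Proof.
move=> WV wV x y0; have [g0 g0G H] := wV x y0; exists g0 => //.
by apply: filterS H => y H g gG gg0 /WV; exact: H.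
Qed.

Lemma compact_nbhs1 (V : set G) : nbhs (1%g : G) V ->
  exists K : set G, [/\ compact K, nbhs (1%g : G) K & K `<=` V].
Proof.
move=> /chart1_radius[r r0 rV].
have rcod (w : 'rV[R]_n) : `|w - o1| < r -> chart_cod c1 w by move=> /rV[].
have r2 : 0 < r / 2 by rewrite divr_gt0.
have r2r : r / 2 < r by rewrite ltr_pdivrMr// ltr_pMr// ltr1n.
exists (chart_inv c1 @` [set w | `|w - o1| <= r / 2]); split.
- exact: compact_chart_ball.
- have oV := open_dom_preimage c1 (@open_ballo R n G (r / 2)).
  have : nbhs (1%g : G) [set x | chart_dom c1 x /\ `|chart_fun c1 x - o1| < r / 2].
    apply: open_nbhs_nbhs; split => //=; split; first exact: chart1_dom.
    by rewrite /origin subrr normr0.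
  apply: filterS => x [xd xr]; exists (chart_fun c1 x); first exact: ltW.
  by rewrite chart_funK.
- move=> _ [w /= wr <-]; have := rV w (le_lt_trans wr r2r).
  by case.
Qed.

Lemma compact_uniform (K : set G) (I : Type) (F : set_system I)
    (P : I -> G -> Prop) : Filter F -> compact K ->
  (forall x, K x -> \forall x' \near x & i \near F, P i x') ->
  \forall i \near F, forall x, K x -> P i x.
Proof.
move=> FF /compact_near_coveringP nc H.
by apply: filterS (nc I F P FF H) => i Pi x; exact: Pi.
Qed.

Lemma compact_bounded_fun (K : set G) (f : G -> R) : compact K -> continuous f ->
  exists C, forall x, K x -> `|f x| <= C.
Proof.
move=> cK fc.
have : \forall N \near \oo, forall x, K x -> `|f x| <= N%:R.
  apply: (compact_uniform (P := fun N x => `|f x| <= N%:R) _ cK) => x Kx.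
  have H1 : \forall x' \near x, `|f x'| <= `|f x| + 1.
    have /cvgrPdist_le/(_ _ ltr01) := fc x; apply: filterS => y xy.
    by rewrite -lerBlDl (le_trans (lerB_dist _ _))// distrC.
  have H2 : \forall N \near \oo, `|f x| + 1 <= N%:R by exact: nbhs_infty_ger.
  exists ([set y | `|f y| <= `|f x| + 1], [set N : nat | `|f x| + 1 <= N%:R]) => //.
  by move=> [y N] /= [H3 H4]; exact: le_trans H3 H4.
by case=> N _ /(_ N (leqnn N)) H; exists N%:R.
Qed.

Lemma translate_support (V V' U : set G) (f : G -> R) (a : G) :
  supported V' f -> (forall u v, U u -> V' v -> V (u * v)%g) -> U a^-1%g ->
  supported V (fun z => f (a * z)%g).
Proof.
move=> fV' UV Ua z nVz.
have nz : ~ V' (a * z)%g.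
  by move=> V'z; apply: nVz; have := UV _ _ Ua V'z; rewrite mulKg.
have c : (a * y)%g @[y --> z] --> (a * z)%g by exact: lmul_continuous.
exact: (near_comp c (fV' _ nz)).
Qed.

Lemma rfield_uniform v (V V' U : set G) (f : G -> R) : compact V ->
  smooth S f -> supported V' f -> nbhs (1%g : G) U -> U 1%g ->
  (forall u w, U u -> V' w -> V (u * w)%g) -> forall e, 0 < e ->
  \forall t \near (0 : R), forall z,
    `|f (curve v t * z)%g - f z - t * rfield v f z| <= e * `|t|.
Proof.
move=> cV sf fV' nU U1 UV e e0.
have V'V : V' `<=` V by move=> z V'z; have := UV _ _ U1 V'z; rewrite mul1g.
pose P (t : R) z := `|f (curve v t * z)%g - f z - t * rfield v f z| <= e * `|t|.
have HV : \forall t \near (0 : R), forall z, V z -> P t z.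
  apply: (@compact_uniform V R (nbhs (0 : R)) P _ cV) => z Vz.
  exact: rfield_estimate.
have HU : \forall t \near (0 : R), U (curve v t)^-1%g.
  have c : (curve v t)^-1%g @[t --> (0 : R)] --> (1%g : G).
    rewrite -[X in _ --> X]invg1.
    exact: (cvg_comp _ _ (curve_cvg (G := G) v) (@lie_inv_continuous R n G 1%g)).
  exact: near_comp c nU.
apply: filterS (filterI HV HU) => t [Ht Ut] z.
have [Vz|nVz] := pselect (V z); first exact: Ht.
have f0 := supported0 (translate_support fV' UV Ut) nVz.
have nV'z : ~ V' z by move=> /V'V.
rewrite /= in f0; rewrite f0 (supported0 fV' nV'z).
have -> : rfield v f z = 0.
  rewrite /rfield; have nz := fV' _ nV'z.
  rewrite -[RHS](derive_cst (V := 'rV[R]_n) (0 : R) o1 v).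
  apply: near_eq_derive.
  have c : {for o1, continuous (fun w => (chart_inv c1 w * z)%g)}.
    apply: (@continuous_comp _ _ _ (chart_inv c1) (fun y => (y * z)%g)).
      exact: chart_inv_continuous cod_origin.
    exact: rmul_continuous.
  move: c; rewrite /prop_for /continuous_at inv_origin mul1g => c.
  exact: (c _ nz).
by rewrite mulr0 !subr0 normr0 mulr_ge0// ltW.
Qed.

Lemma periodize_translate (V : set G) (wV : wandering (Gamma := Gamma) V)
    (f : G -> R) (a x y : G) :
  supported V f -> supported V (fun z => f (a * z)%g) ->
  periodize wV x (fun z => f (a * z)%g) y = periodize wV (x * a^-1)%g f y.
Proof.
move=> fV faV; have E g : ((x * a^-1)^-1 * (g * y) = a * (x^-1 * (g * y)))%g.
  by rewrite invgF -mulgA.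
rewrite /periodize E.
have [->//|/eqP vv] := eqVneq (visit wV (x * a^-1)%g y) (visit wV x y).
have n1 := visitP (wV := wV) (visit_Gamma wV (x * a^-1)%g y) vv.
have n2 := visitP (wV := wV) (visit_Gamma wV x y) (fun H => vv (esym H)).
rewrite (supported0 faV n1) -E.
exact: (supported0 fV n2).
Qed.

Variable m : (G -> R) -> R.
Hypotheses (mm : is_mean m) (mi : right_invariant setT m).

(** A group with a lattice is unimodular, and this Lie algebra is not.  In terms
    of the mean: let [phi >= 0] have small support, and let [h x] be the mean of
    the periodization of [phi] translated by [x], a bounded function of [x].
    The right invariant field of [A] at [z] is [A + b(z) B] with [b] the adjoint
    cocycle, and the choice [phi = chi (B f0)] makes [b phi] smooth, with
    [R_A phi = A phi + B (b phi) - phi].  The mean kills the left invariant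
    derivatives of periodizations, so that [t |-> h (x c(t)^-1)] has derivative
    [- h x] at [0] for a curve [c] with velocity [A]: following it backwards,
    [h] grows by a fixed amount at each step of fixed size, which contradicts
    its boundedness. *)
Lemma no_affine_lattice (A B : lie_algebra G) : lie A B = B -> B <> 0 ->
  (forall Z, exists a b, Z = a *: A + b *: B) -> False.
Proof.
move=> AB B0 span.
have [al Aal] := lie_algebra_lfield A; have [be Bbe] := lie_algebra_lfield B.
have [f0 f0p] : exists f0 : smooth_fun S, 0 < B f0 1%g.
  have [[f fB]|nf] := pselect (exists f : smooth_fun S, B f 1%g != 0).
    have [Bf|Bf|Bf] := ltgtP (B f 1%g) 0; last by rewrite Bf eqxx in fB.
      by exists (- f); rewrite vfieldN -[(- _ : smooth_fun S) _]/(- B f 1%g) oppr_gt0.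
    by exists f.
  case: B0; apply: lie_algebra_eq => f x; apply/eqP/negPn/negP => fx.
  apply: nf; exists (to_smooth (smooth_ltranslate x (smooth_funP f))).
  by move: fx; rewrite Bbe /= lfield_ltranslate mulg1.
have [V0 nV0 wV0] := wandering_exists Gl.
have [V [cV nV VV0]] := compact_nbhs1 nV0.
have wV := wanderingS VV0 wV0.
have [U [V' [nU nV' UV]]] := nbhs_mul nV.
have U1 := nbhs_singleton nU.
have V'V : V' `<=` V by move=> z V'z; have := UV _ _ U1 V'z; rewrite mul1g.
have nW : nbhs (1%g : G) (V' `&` [set z | 0 < B f0 z]).
  apply: filterI => //.
  have oB : open [set z | 0 < B f0 z].
    apply: (@open_comp _ _ (B f0 : G -> R) [set y | 0 < y]).
      by move=> y _; exact: smooth_continuous (smooth_funP _) y.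
    exact: open_gt.
  by apply: open_nbhs_nbhs.
have [chi [schi chiW chi0 chi1]] := bump_exists nW.
pose phi z := chi z * B f0 z.
have sphi : smooth S phi by exact: (smoothM schi (smooth_funP (B f0))).
have phiW : supported (V' `&` [set z | 0 < B f0 z]) phi by exact: supportedM.
have phiV' : supported V' phi by move=> z nz; apply: phiW => -[].
have supV f : supported V' f -> supported V f.
  by move=> fV' z nz; apply: fV' => /V'V.
have chiV' : supported V' chi by move=> z nz; apply: chiW => -[].
have phi_ge0 z : 0 <= phi z.
  have [[_ Bz]|nz] := pselect ((V' `&` [set z | 0 < B f0 z]) z).
    by rewrite mulr_ge0// ltW.
  by rewrite (supported0 phiW nz).
pose b z := sval (cid (adjoint_affine z AB B0 span)).
have rE z (f : smooth_fun S) : rfield al f z = lfield al f z + b z * lfield be f z.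
  have E : adjoint z A = A + b z *: B by exact: svalP (cid (adjoint_affine z AB B0 span)).
  rewrite rfield_adjoint -Aal E.
  by rewrite lie_algebraDE lie_algebraZE {1}Aal {1}Bbe.
(* this is [b phi], in a form that shows its smoothness *)
pose bphi z := chi z * (rfield al f0 z - lfield al f0 z).
have bphiE z : bphi z = b z * phi z.
  by rewrite /bphi rE /phi Bbe /=; ring.
have sr : smooth S (fun z => rfield al f0 z - lfield al f0 z).
  have sf0 := smooth_funP f0.
  exact: (smoothB (smooth_rfield al sf0) (smooth_lfield al sf0)).
have sbphi : smooth S bphi by exact: (smoothM schi sr).
have bphiV' : supported V' bphi by exact: supportedM.
have key z : rfield al phi z = lfield al phi z + lfield be bphi z - phi z.
  have sf0 := smooth_funP f0; have sBf := smooth_funP (B f0).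
  have sl := smooth_lfield al sf0; have srr := smooth_rfield al sf0.
  have Al (f : smooth_fun S) : (A f : G -> R) = lfield al f by rewrite Aal.
  have Bl (f : smooth_fun S) : (B f : G -> R) = lfield be f by rewrite Bbe.
  rewrite -[phi]/(to_smooth sphi : G -> R) rE /= (lfieldM al z schi sBf).
  rewrite (lfieldM be z schi sBf) (lfieldM be z schi sr).
  rewrite (_ : (fun z => rfield al f0 z - lfield al f0 z) =
    (fun z => -1 * lfield al f0 z + rfield al f0 z)); last first.
    by apply/funext => y; ring.
  rewrite (lfield_linear be (-1) z sl srr) (lfield_rfield al be z sf0) -(Bl f0) rE.
  have := lie_algebra_lieE A B f0 z; rewrite AB (Al (B f0)) (Bl (A f0)) (Al f0).
  have Bz : lfield be f0 z = B f0 z by rewrite (Bl f0).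
  move=> E; have {}E : lfield be (lfield al f0) z = lfield al (B f0) z - B f0 z.
    by rewrite E opprB addrC subrK.
  rewrite rE /phi E Bz; ring.
pose h x := m (periodize wV x phi).
have mrphi x : m (periodize wV x (rfield al phi)) = - h x.
  have E1 : periodize wV x (rfield al phi) =
      (fun y => lfield al (periodize wV x phi) y +
       (-1 * periodize wV x phi y + lfield be (periodize wV x bphi) y)).
    apply/funext => y; rewrite (lfield_periodize wV al x y (supV _ phiV')).
    rewrite (lfield_periodize wV be x y (supV _ bphiV')).
    rewrite /periodize key; ring.
  have sp := smooth_periodize wV x sphi (supV _ phiV').
  have ip := periodize_invariant wV x (supV _ phiV').
  have sb := smooth_periodize wV x sbphi (supV _ bphiV').
  have ib := periodize_invariant wV x (supV _ bphiV').
  have [C1 b1] := invariant_bounded Gl (invariant_lfield al ip)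
    (smooth_continuous (smooth_lfield al sp)).
  have [C2 b2] := invariant_bounded Gl ip (smooth_continuous sp).
  have [C3 b3] := invariant_bounded Gl (invariant_lfield be ib)
    (smooth_continuous (smooth_lfield be sb)).
  rewrite E1 (meanD mm b1 (bounded_linear (-1) b2 b3)).
  rewrite (mean_lfield Gl mm mi al sp ip) add0r.
  have [Lm _ _] := mm; rewrite (Lm _ _ _ _ _ b2 b3).
  by rewrite (mean_lfield Gl mm mi be sb ib) addr0 mulN1r.
have bnd f : continuous f -> supported V' f -> exists C, bounded_fun_by C f.
  move=> cf fV'; have [C HC] := compact_bounded_fun cV cf; exists `|C| => z.
  have [Vz|nVz] := pselect (V z); first exact: le_trans (HC z Vz) (ler_norm _).
  by rewrite (supported0 (supV _ fV') nVz) normr0.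
have [C phiC] := bnd _ (smooth_continuous sphi) phiV'.
have rV' : supported V' (rfield al phi).
  move=> z nz; have := phiV' _ nz; rewrite -nbhs_nearE => /nbhs_interior.
  apply: filterS => y /= fy; rewrite -[phi]/(to_smooth sphi : G -> R) rE /=.
  rewrite !(@lfield_local R n G _ phi (fun=> 0) y fy) /lfield.
  by rewrite !derive_cst mulr0 addr0.
have [D rD] := bnd _ (smooth_continuous (smooth_rfield al sphi)) rV'.
have step e : 0 < e -> \forall t \near (0 : R), forall x,
    `|h (x * (curve al t)^-1)%g - h x + t * h x| <= e * `|t|.
  move=> e0; have H := rfield_uniform al cV sphi phiV' nU U1 UV e0.
  have HU : \forall t \near (0 : R), U (curve al t)^-1%g.
    have c : (curve al t)^-1%g @[t --> (0 : R)] --> (1%g : G).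
      rewrite -[X in _ --> X]invg1.
      exact: (cvg_comp _ _ (curve_cvg (G := G) al) (@lie_inv_continuous R n G 1%g)).
    exact: near_comp c nU.
  apply: filterS (filterI H HU) => t [Ht Ut] x.
  have sT := translate_support phiV' UV Ut.
  have bp := periodize_bound wV x phiC.
  have bt : bounded_fun_by C (periodize wV x (fun z => phi (curve al t * z)%g)).
    by move=> y; exact: phiC.
  have br := periodize_bound wV x rD.
  have hE : h (x * (curve al t)^-1)%g =
      m (periodize wV x (fun z => phi (curve al t * z)%g)).
    congr m; apply/funext => y.
    by rewrite (periodize_translate wV x y (supV _ phiV') sT).
  have [Lm Bm _] := mm.
  have := Bm (e * `|t|) (fun y => - t * periodize wV x (rfield al phi) y +
    (-1 * periodize wV x phi y +
     periodize wV x (fun z => phi (curve al t * z)%g) y)).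
  rewrite (Lm _ _ _ _ _ br (bounded_linear (-1) bp bt)) (Lm _ _ _ _ _ bp bt).
  rewrite mrphi -hE -/(h x).
  rewrite (_ : - t * - h x + (-1 * h x + h (x * (curve al t)^-1)%g) =
    h (x * (curve al t)^-1)%g - h x + t * h x); last by ring.
  apply=> y; rewrite /periodize.
  rewrite (_ : _ + _ = phi (curve al t * (x^-1 * (visit wV x y * y)))%g -
    phi (x^-1 * (visit wV x y * y))%g -
    t * rfield al phi (x^-1 * (visit wV x y * y))%g); last by ring.
  exact: Ht.
have hC x : `|h x| <= C.
  by have [_ Bm _] := mm; apply: Bm; exact: periodize_bound.
have h1 : 0 < h 1%g.
  apply: (mean_gt0 Gl mm mi (x0 := 1%g)).
  - exact: periodize_invariant (supV _ phiV').
  - by apply: smooth_continuous; exact: smooth_periodize (supV _ phiV').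
  - by move=> y; exact: phi_ge0.
  rewrite (periodize_center wV 1%g (supV _ phiV') (nbhs_singleton nV)).
  by rewrite /phi mulr_gt0.
set eta := h 1%g in h1.
have eta2 : 0 < eta / 2 by rewrite divr_gt0.
have /nbhs_ballP[d /= d0 dH] := step _ eta2.
pose s := d / 2; have s0 : 0 < s by rewrite divr_gt0.
have {}dH x : `|h (x * (curve al (- s))^-1)%g - h x + - s * h x| <= eta / 2 * s.
  have := dH (- s); rewrite normrN (gtr0_norm s0); apply.
  rewrite -ball_normE /= sub0r opprK (gtr0_norm s0) ltr_pdivrMr// ltr_pMr//.
  by rewrite ltr1n.
have grow k : exists x, eta + k%:R * (s * (eta / 2)) <= h x.
  elim: k => [|k [x hx]]; first by exists 1%g; rewrite mul0r addr0.
  exists (x * (curve al (- s))^-1)%g.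
  have etax : eta <= h x.
    by apply: le_trans hx; rewrite lerDl mulr_ge0// mulr_ge0// ltW.
  move: (dH x); rewrite ler_norml => /andP[H _].
  have H2 : s * (h x - eta) >= 0 by rewrite mulr_ge0 ?subr_ge0// ltW.
  rewrite -natr1 mulrDl mul1r; move: hx H H2.
  by move: (h x) (h _) (k%:R * _) => u v w; clear; lra.
(* after more than [C / (s eta / 2)] steps [h] exceeds its bound [C] *)
pose N := Num.truncn (C / (s * (eta / 2))).
have [x hx] := grow N.+1.
have := le_trans hx (le_trans (ler_norm _) (hC x)).
have se : 0 < s * (eta / 2) by rewrite mulr_gt0.
have := truncnS_gt (C / (s * (eta / 2))); rewrite -/N ltr_pdivrMr// => NC.
move=> H; have H2 : N.+1%:R * (s * (eta / 2)) <= C.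
  by apply: le_trans H; rewrite lerDr ltW.
by have := lt_le_trans NC H2; rewrite ltxx.
Qed.

End NoAffineLattice.

(** * Left invariant fields on the quotient *)

Section Descent.
Context {R : realType} {n : nat} {G : lieGroupType R n} {Gamma : groupClosed G}.
Local Notation S := (manifold_smooth G).
Local Notation Q := (quotient_smooth Gamma).
Local Notation pr := (coset_proj Gamma).
Implicit Types (Y Z W : lie_algebra G) (f g : smooth_fun Q).

Definition pullback f : smooth_fun S :=
  comp_smooth (S := S) (S' := Q) (phi := pr) (fun _ Sk => Sk) f.

Lemma pullbackE f x : pullback f x = f (pr x). Proof. by []. Qed.

Lemma pullback_invariant f : invariant_fun (Gamma := Gamma) (pullback f).
Proof. by move=> g x gG; rewrite !pullbackE coset_projM. Qed.

Lemma lie_algebra_invariant Y f : invariant_fun (Gamma := Gamma) (Y (pullback f)).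
Proof.
by have [v ->] := lie_algebra_lfield Y; apply: invariant_lfield; exact: pullback_invariant.
Qed.

Fact descend_smooth Y f : smooth Q (fun q => Y (pullback f) (crepr q)).
Proof.
have E : (fun q => Y (pullback f) (crepr q)) \o pr = Y (pullback f).
  apply/funext => x /=; have [g gG ->] := creprP Gamma x.
  exact: lie_algebra_invariant.
rewrite -[smooth Q _]/(smooth S ((fun q => Y (pullback f) (crepr q)) \o pr)) E.
exact: smooth_funP (Y (pullback f)).
Qed.

Fact descend_subproof Y :
  (fun f => to_smooth (descend_smooth Y f)) \in @vfield_pred R _ Q.
Proof.
apply/asboolP; split=> [a f g|f g]; apply: smooth_fun_eq => q.
  have E : pullback (a *: f + g) = a *: pullback f + pullback g by exact: smooth_fun_eq.
  by rewrite -[LHS]/(Y (pullback (a *: f + g)) (crepr q)) E vfieldP.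
have E : pullback (f * g) = pullback f * pullback g by exact: smooth_fun_eq.
rewrite -[LHS]/(Y (pullback (f * g)) (crepr q)) E vfieldM.
rewrite -[LHS]/(Y (pullback f) (crepr q) * pullback g (crepr q) +
  pullback f (crepr q) * Y (pullback g) (crepr q)).
by rewrite !pullbackE creprK.
Qed.

(** The image of [Y] under the projection: [Y] preserves the functions invariant
    under left translations by [Gamma]. *)
Definition descend Y : vfield Q := VField (descend_subproof Y).

Lemma descendE Y f x : descend Y f (pr x) = Y (pullback f) x.
Proof.
rewrite -[LHS]/(Y (pullback f) (crepr (pr x))); have [g gG ->] := creprP Gamma x.
exact: lie_algebra_invariant.
Qed.

Lemma coset_eqP (F F' : coset_space Gamma -> R) :
  (forall x, F (pr x) = F' (pr x)) -> forall q, F q = F' q.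
Proof. by move=> FF q; rewrite -(creprK q). Qed.

Lemma descend_lie Y Z : lie (descend Y) (descend Z) = descend (lie Y Z).
Proof.
have E W f : pullback (descend W f) = W (pullback f).
  by apply: smooth_fun_eq => x; rewrite pullbackE descendE.
apply: vfield_eq => f; apply: coset_eqP => x.
rewrite descendE lie_algebra_lieE.
rewrite -[LHS]/(descend Y (descend Z f) (pr x) - descend Z (descend Y f) (pr x)).
by rewrite !descendE !E.
Qed.

Lemma descend_at Y x : vfield_at (descend Y) (pr x) = dcoset_proj Gamma (vfield_at Y x).
Proof. by apply/val_inj/funext => f; exact: descendE. Qed.

Fact scale_vfield_subproof (h : smooth_fun Q) (X : vfield Q) :
  (fun f => h * X f) \in @vfield_pred R _ Q.
Proof.
apply/asboolP; split=> [a f g|f g]; apply: smooth_fun_eq => q.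
  rewrite vfieldP -[LHS]/(h q * (a * X f q + X g q)).
  by rewrite -[RHS]/(a * (h q * X f q) + h q * X g q); ring.
rewrite vfieldM -[LHS]/(h q * (X f q * g q + f q * X g q)).
by rewrite -[RHS]/(h q * X f q * g q + f q * (h q * X g q)); ring.
Qed.

Definition scale_vfield h X : vfield Q := VField (scale_vfield_subproof h X).

Lemma scale_vfield_at h X q : vfield_at (scale_vfield h X) q = h q *: vfield_at X q.
Proof. by apply/val_inj/funext => f. Qed.

Hypothesis Gl : lattice Gamma.

(** The periodization of a bump function with small support. *)
Lemma quotient_bump (x : G) (O : set G) : nbhs x O ->
  exists2 h : smooth_fun Q, h (pr x) = 1 &
    forall y, h (pr y) != 0 -> exists2 g, g \in Gamma & O (g * y)%g.
Proof.
move=> nO; have [V nV wV] := wandering_exists Gl.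
have nW : nbhs (1%g : G) (V `&` [set z | O (x * z)%g]).
  apply: filterI => //.
  have c : (x * z)%g @[z --> (1%g : G)] --> (x * 1)%g by exact: lmul_continuous.
  by rewrite mulg1 in c; exact: near_comp c nO.
have [chi [schi chiW _ chi1]] := bump_exists nW.
have chiV : supported V chi by move=> z nz; apply: chiW => -[].
have sp := quotient_periodize_smooth wV x schi chiV.
exists ((chi 1%g)^-1 *: to_smooth sp).
  rewrite -[LHS]/((chi 1%g)^-1 * periodize wV x chi (crepr (pr x))).
  rewrite periodize_crepr// periodize_center// ?mulVf// ?gt_eqF//.
  exact: nbhs_singleton.
move=> y; rewrite -[(_ *: _ : smooth_fun Q) _]/((chi 1%g)^-1 *
  periodize wV x chi (crepr (pr y))).
rewrite periodize_crepr// mulf_eq0 negb_or => /andP[_ py].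
exists (visit wV x y); first exact: visit_Gamma.
have [[_]|nW'] := pselect ((V `&` [set z | O (x * z)%g]) (x^-1 * (visit wV x y * y))%g).
  by rewrite /= mulVKg.
by move: py; rewrite /periodize (supported0 chiW nW') eqxx.
Qed.

Variable m : (G -> R) -> R.
Hypotheses (mm : is_mean m) (mi : right_invariant setT m).

Lemma mean_descend Y f : m (fun x => descend Y f (pr x)) = 0.
Proof.
have [v Yv] := lie_algebra_lfield Y.
rewrite (_ : (fun x => _) = lfield v (pullback f)); last first.
  by apply/funext => x; rewrite descendE Yv.
exact: (mean_lfield Gl mm mi v (smooth_funP (pullback f)) (@pullback_invariant f)).
Qed.

Lemma pullback_bounded f : exists C, bounded_fun_by C (fun x => f (pr x)).
Proof.
apply: (invariant_bounded Gl (@pullback_invariant f)).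
exact: smooth_continuous (smooth_funP (pullback f)).
Qed.

Lemma pullback_continuous f : continuous (fun x => f (pr x)).
Proof. exact: smooth_continuous (smooth_funP (pullback f)). Qed.

(** Strict positivity of the mean: pointwise equalities on the quotient follow
    from one integral. *)
Lemma mean_eq0 f : (forall q, 0 <= f q) -> m (fun x => f (pr x)) = 0 ->
  forall q, f q = 0.
Proof.
move=> f0 mf0 q; apply/eqP; rewrite eq_le f0 andbT leNgt; apply/negP => fq.
have := @mean_gt0 _ _ _ _ Gl m mm mi (fun x => f (pr x)) (crepr q)
  (@pullback_invariant f) (@pullback_continuous f) (fun x => f0 (pr x)).
by rewrite creprK mf0 ltxx => /(_ fq).
Qed.

Section Antisymmetry.
Variable t : lcs Q.
Local Notation om := (lcs_omega t).
Local Notation th := (lcs_theta t).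

Lemma form2_0l p (v : tangent Q p) : om p 0 v = 0.
Proof.
have := form2_linear om (-1) (0 : tangent Q p) 0 v.
by rewrite scaler0 addr0 mulN1r addNr.
Qed.

(** The structure equation at [(X, Y, X)]: the symmetrization grows along [X] at
    the rate [th(X)]. *)
Lemma lcs_symmetrization (X Y : vfield Q) :
  X (eval2 om X Y + eval2 om Y X) = eval1 th X * (eval2 om X Y + eval2 om Y X).
Proof.
have XX : eval2 om X X = 0 by apply: smooth_fun_eq => q; exact: form2_alternating.
have lXX : eval2 om (lie X X) Y = 0.
  apply: smooth_fun_eq => q; rewrite liexx.
  rewrite -[LHS]/(om q (vfield_at 0 q) (vfield_at Y q)).
  have -> : vfield_at (0 : vfield Q) q = 0 by apply/val_inj/funext => f.
  exact: form2_0l.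
have := lcsP t X Y X; rewrite /diff2 XX lXX.
have lYX : eval2 om (lie Y X) X = - eval2 om (lie X Y) X.
  apply: smooth_fun_eq => q.
  rewrite -[LHS]/(om q (vfield_at (lie Y X) q) (vfield_at X q)).
  rewrite -[RHS]/(- om q (vfield_at (lie X Y) q) (vfield_at X q)).
  have -> : vfield_at (lie Y X) q = -1 *: vfield_at (lie X Y) q + 0.
    apply/val_inj/funext => f.
    rewrite -[LHS]/(Y (X f) q - X (Y f) q) -[RHS]/(-1 * (X (Y f) q - Y (X f) q) + 0).
    by ring.
  by rewrite form2_linear form2_0l mulN1r addr0.
rewrite lYX vfield0 vfieldD => E.
apply: etrans (etrans _ E) _; ring.
Qed.

End Antisymmetry.
End Descent.

(** * Skew-symmetry of locally conformal symplectic forms *)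

Section Skew.
Context {R : realType} {n : nat} {G : lieGroupType R n} {Gamma : groupClosed G}.
Local Notation Q := (quotient_smooth Gamma).
Local Notation pr := (coset_proj Gamma).
Variables (s : lie_lcs (lie_algebra G)) (t : lcs Q) (st : induced_lcs s t).
Local Notation om := (lcs_omega t).
Local Notation th := (lcs_theta t).
Local Notation w := (lie_omega s).
Implicit Types (Y Z W : lie_algebra G) (f g h u : smooth_fun Q).

Lemma theta_descend W q : eval1 th (descend W) q = lie_theta s W.
Proof.
apply: (coset_eqP (F' := fun=> lie_theta s W)) => x.
rewrite -[LHS]/(th (pr x) (vfield_at (descend W) (pr x))) descend_at.
by have [] := st W W x.
Qed.

Lemma omega_descend Y Z q : eval2 om (descend Y) (descend Z) q = w Y Z.
Proof.
apply: (coset_eqP (F' := fun=> w Y Z)) => x.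
rewrite -[LHS]/(om (pr x) (vfield_at (descend Y) (pr x)) (vfield_at (descend Z) (pr x))).
by rewrite !descend_at; have [] := st Y Z x.
Qed.

Hypothesis Gl : lattice Gamma.
Variable m : (G -> R) -> R.
Hypotheses (mm : is_mean m) (mi : right_invariant setT m).

(** The function [f], the defect of skew-symmetry of [om] on [W] and [h Y],
    satisfies [W f = a f] with [a = th(W)] constant, and vanishes where the bump
    function [h] does.  Choose [u'] with [u' = 0] and [W u' > 0] at the given
    point.  Then [W (u' f^2) = (W u' + 2 a u') f^2] is nonnegative if the support
    of [h] is small, and its mean is zero; so [f] vanishes. *)
Lemma form2_symmetrization_local W Y (x : G) u :
  descend W u (pr x) != 0 ->
  om (pr x) (vfield_at (descend W) (pr x)) (vfield_at (descend Y) (pr x)) +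
  om (pr x) (vfield_at (descend Y) (pr x)) (vfield_at (descend W) (pr x)) =
  om (pr x) (vfield_at (descend W) (pr x)) 0.
Proof.
set X := descend W => Xu0; set q := pr x.
pose a := lie_theta s W.
pose u' : smooth_fun Q := X u q *: (u - u q *: (1 : smooth_fun Q)).
have Xu' p : X u' p = X u q * X u p.
  by rewrite /u' vfieldZ vfieldB vfieldZ vfield1 scaler0 subr0.
have u'q : u' q = 0.
  by rewrite -[LHS]/(X u q * (u q - u q * 1)) mulr1 subrr mulr0.
pose g : smooth_fun Q := X u' + (2 * a) *: u'.
have gE p : g p = X u q * X u p + 2 * a * u' p by rewrite -Xu'.
have gq : 0 < g q.
  by rewrite gE u'q mulr0 addr0 -expr2 exprn_even_gt0.
have nO : nbhs x [set y : G | 0 < g (pr y)].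
  have := @pullback_continuous _ _ _ Gamma g x; move/cvgrPdist_lt => /(_ _ gq).
  apply: filterS => y /= H.
  have : `|g q - g (pr y)| < g q by exact: H.
  by rewrite ltr_norml => /andP[_]; rewrite ltrBlDr ltrDl.
have [h hq hO] := quotient_bump Gl nO.
pose sy (Y' : vfield Q) : smooth_fun Q := eval2 om X Y' + eval2 om Y' X.
pose V1 := scale_vfield h (descend Y); pose V0 := scale_vfield (0 : smooth_fun Q) (descend Y).
(* Subtracting the value for [0 Y] makes [f] vanish where [h] does. *)
pose f : smooth_fun Q := sy V1 - sy V0.
have Xf p : X f p = a * f p.
  rewrite /f vfieldB /sy !lcs_symmetrization.
  rewrite -[LHS]/(eval1 th X p * sy V1 p - eval1 th X p * sy V0 p).
  by rewrite theta_descend -mulrBr.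
have fE p : f p = om p (vfield_at X p) (h p *: vfield_at (descend Y) p) +
    om p (h p *: vfield_at (descend Y) p) (vfield_at X p) -
    om p (vfield_at X p) 0.
  rewrite -[LHS]/((om p (vfield_at X p) (vfield_at V1 p) +
     om p (vfield_at V1 p) (vfield_at X p)) -
     (om p (vfield_at X p) (vfield_at V0 p) + om p (vfield_at V0 p) (vfield_at X p))).
  have -> : vfield_at V1 p = h p *: vfield_at (descend Y) p := scale_vfield_at _ _ _.
  have -> : vfield_at V0 p = 0.
    by rewrite /V0 scale_vfield_at; apply: scale0r.
  by rewrite form2_0l addr0.
pose F : smooth_fun Q := X (u' * (f * f)).
have FE p : F p = g p * (f p) ^+ 2.
  rewrite /F !vfieldM.
  rewrite -[LHS]/(X u' p * (f p * f p) + u' p * (X f p * f p + f p * X f p)).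
  rewrite Xf -[g p]/(X u' p + 2 * a * u' p).
  by move: (X u' p) (f p) (u' p) => A B C; ring.
have F0 : forall p, 0 <= F p.
  move=> p; rewrite -(creprK p) FE; set y := crepr p.
  have [h0|/hO[k kG Ok]] := eqVneq (h (pr y)) 0.
    by rewrite fE h0 scale0r form2_0l addr0 subrr expr0n mulr0.
  by apply: mulr_ge0; [rewrite -(coset_projM y kG); exact: ltW|exact: sqr_ge0].
have mF : m (fun y => F (pr y)) = 0 := mean_descend Gl mm mi W (u' * (f * f)).
have := mean_eq0 Gl mm mi F0 mF q.
rewrite FE => /eqP; rewrite mulf_eq0 gt_eqF// orFb sqrf_eq0 fE hq scale1r subr_eq0.
by move=> /eqP.
Qed.

Lemma form2_0r (x : G) (v : tangent Q (pr x)) : om (pr x) v 0 = 0.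
Proof.
have [Y ->] := tangent_quotient v Gl; rewrite -descend_at.
have [[u /eqP Yu]|N] := pselect (exists u, descend Y u (pr x) <> 0).
  by have := form2_symmetrization_local Y Yu; rewrite form2_alternating addr0.
suff -> : vfield_at (descend Y) (pr x) = 0 by exact: form2_alternating.
apply/val_inj/funext => u; apply: contrapT => H; apply: N; exists u; exact: H.
Qed.

(** Forms are linear on the left by definition, so that [om v v = 0] does not
    polarize directly; skew-symmetry comes from the mean, through
    [form2_symmetrization_local], whose right-hand side is [om u 0 = 0]. *)
Lemma form2_skew (x : G) (u v : tangent Q (pr x)) :
  om (pr x) u v = - om (pr x) v u.
Proof.
have [Y Yu] := tangent_quotient u Gl; have [Z Zv] := tangent_quotient v Gl.
apply/eqP; rewrite -addr_eq0; apply/eqP.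
have [[f /eqP Yf]|N] := pselect (exists f, descend Y f (pr x) <> 0).
  have := form2_symmetrization_local Z Yf.
  by rewrite form2_0r !descend_at -Yu -Zv.
have -> : u = 0.
  rewrite Yu -descend_at.
  apply/val_inj/funext => f; apply: contrapT => H; apply: N; exists f; exact: H.
by rewrite form2_0l form2_0r addr0.
Qed.

Lemma omega_skew Y Z : w Y Z = - w Z Y.
Proof.
have [<- _] := st Y Z 1%g; have [<- _] := st Z Y 1%g.
exact: form2_skew.
Qed.

Lemma omegaPr (a : R) X Y Z : w Z (a *: X + Y) = a * w Z X + w Z Y.
Proof. by rewrite omega_skew lie_omega_linear opprD -mulrN -!omega_skew. Qed.

End Skew.

(** * Representation of linear functionals *)

(** A row vector lies in the row space of the Gram matrix as soon as it kills the
    kernel of that matrix, whose elements are coordinates of the vector [0] by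
    nondegeneracy.  The spanning family may be linearly dependent. *)
Lemma linear_representation (R : fieldType) (n : nat) (L : lmodType R)
    (phi : 'rV[R]_n -> L) (w : L -> L -> R) (l : L -> R) :
  (forall a u v, phi (a *: u + v) = a *: phi u + phi v) ->
  (forall X, exists v, X = phi v) ->
  (forall a X Y Z, w (a *: X + Y) Z = a * w X Z + w Y Z) ->
  (forall a X Y Z, w Z (a *: X + Y) = a * w Z X + w Z Y) ->
  (forall X, (forall Y, w Y X = 0) -> X = 0) ->
  (forall a X Y, l (a *: X + Y) = a * l X + l Y) ->
  exists X, forall Y, l Y = w X Y.
Proof.
move=> phiP phiS wl wr wn lP.
have expand (F : L -> R) : (forall a X Y, F (a *: X + Y) = a * F X + F Y) ->
    forall v, F (phi v) = \sum_i v 0 i * F (phi 'e_i).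
  move=> FP v.
  have F0 : F 0 = 0.
    by have := FP (-1) 0 0; rewrite scaler0 addr0 mulN1r addNr.
  have phi0 : phi 0 = 0.
    by have := phiP (-1) 0 0; rewrite scaler0 addr0 scaleN1r addNr.
  rewrite {1}[v]row_sum_delta.
  elim/big_rec2: _ => [|i y z _ <-]; first by rewrite phi0.
  by rewrite phiP FP.
pose Om : 'M[R]_n := \matrix_(i, j) w (phi 'e_i) (phi 'e_j).
pose b : 'rV[R]_n := \row_j l (phi 'e_j).
have : (b <= Om)%MS.
  rewrite submxE; apply/eqP/rowP => k; rewrite !mxE.
  pose u : 'rV[R]_n := \row_j (cokermx Om) j k.
  have u0 : phi u = 0.
    apply: wn => Y; have [v ->] := phiS Y.
    rewrite (expand (fun X => w X (phi u))) => [|a X Z]; last exact: wl.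
    rewrite big1 // => i _; rewrite (expand (w (phi 'e_i))); last by move=> *; exact: wr.
    have /matrixP/(_ i k) := mulmx_coker Om; rewrite !mxE => E.
    rewrite -[X in _ * X = _](_ : 0 = _) ?mulr0// -{1}E.
    by apply: eq_bigr => j _; rewrite !mxE mulrC.
  have := expand l lP u; rewrite u0.
  have -> : l 0 = 0 by have := lP (-1) 0 0; rewrite scaler0 addr0 mulN1r addNr.
  move=> E; rewrite [RHS]E; apply: eq_bigr => j _; by rewrite !mxE mulrC.
move=> /submxP[d bE]; exists (phi d) => Y; have [v ->] := phiS Y.
rewrite (expand l lP) (expand (w (phi d))); last by move=> *; exact: wr.
apply: eq_bigr => j _; congr (_ * _).
rewrite (expand (fun X => w X (phi 'e_j))) => [|a X Z]; last exact: wl.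
have /rowP/(_ j) := bE; rewrite !mxE => ->.
by apply: eq_bigr => i _; rewrite !mxE.
Qed.

Section Representation.
Context {R : realType} {n : nat} {G : lieGroupType R n}.
Implicit Types (X Y Z : lie_algebra G).

Lemma lie_algebra_eq_one X Y : (forall f, X f 1%g = Y f 1%g) -> X = Y.
Proof.
move=> XY; apply: lie_algebra_eq => f x.
pose g := to_smooth (smooth_ltranslate x (smooth_funP f)).
have /asboolP XL := left_invariant_valP X.
have /asboolP YL := left_invariant_valP Y.
have := XL x f g (fun=> erefl) 1%g; have := YL x f g (fun=> erefl) 1%g.
by rewrite mulg1 => <- <-.
Qed.

Lemma lfield_algebraP a (u v : 'rV[R]_n) :
  lfield_algebra (G := G) (a *: u + v) = a *: lfield_algebra u + lfield_algebra v.
Proof.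
apply: lie_algebra_eq_one => f; rewrite lie_algebraDE lie_algebraZE !lfield_algebraE.
rewrite !lfield_gradient; try exact: smooth_funP.
rewrite mulr_sumr -big_split; apply: eq_bigr => i _ /=.
by rewrite !mxE; ring.
Qed.

End Representation.

(** * Automorphisms of the induced structure *)

Section Automorphism.
Context {R : realType} {n : nat} {G : lieGroupType R n} {Gamma : groupClosed G}.
Local Notation Q := (quotient_smooth Gamma).
Local Notation pr := (coset_proj Gamma).
Variables (s : lie_lcs (lie_algebra G)) (t : lcs Q) (st : induced_lcs s t).
Local Notation om := (lcs_omega t).
Local Notation th := (lcs_theta t).
Local Notation w := (lie_omega s).
Local Notation theta := (lie_theta s).
Implicit Types (Y Z W : lie_algebra G) (f g h u : smooth_fun Q).

Hypothesis Gl : lattice Gamma.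
Variable m : (G -> R) -> R.
Hypotheses (mm : is_mean m) (mi : right_invariant setT m).

Let skew := omega_skew st Gl mm mi.
Let wr := omegaPr st Gl mm mi.

Lemma omega0l Z : w 0 Z = 0.
Proof. by have := lie_omega_linear s (-1) 0 0 Z; rewrite scaler0 addr0 mulN1r addNr. Qed.

Lemma omega_nondegenerate_r Z : (forall Y, w Y Z = 0) -> Z = 0.
Proof.
by move=> wZ; apply: (lie_omega_nondegenerate (l := s)) => Y; rewrite skew wZ oppr0.
Qed.

Lemma omega_representation (l : lie_algebra G -> R) :
  (forall a Y Z, l (a *: Y + Z) = a * l Y + l Z) -> exists Y, forall Z, l Z = w Y Z.
Proof.
apply: (linear_representation (@lfield_algebraP R n G)) => //.
- exact: lie_algebra_lfield.
- exact: lie_omega_linear.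
- exact: omega_nondegenerate_r.
Qed.

Definition qmean f : R := m (fun x => f (pr x)).

Lemma qmeanP a f g : qmean (a *: f + g) = a * qmean f + qmean g.
Proof.
have [L _ _] := mm.
have [C fC] := pullback_bounded Gl f; have [D gD] := pullback_bounded Gl g.
exact: L fC gD.
Qed.

Lemma qmean_descend Y f : qmean (descend Y f) = 0.
Proof. exact: mean_descend. Qed.

Variables (X : vfield Q) (Xt : lcs_automorphisms t X).

Definition lee : smooth_fun Q := eval1 th X.
Definition eta Y : smooth_fun Q := eval2 om X (descend Y).

(** At each point [X] agrees with a left invariant field, which depends on the
    point: pointwise identities reduce to the Lie algebra. *)
Lemma left_invariant_at q : exists X0 : lie_algebra G,
  lee q = theta X0 /\ forall Y, eta Y q = w X0 Y.
Proof.
rewrite -(creprK q); set x := crepr q.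
have [X0 E] := tangent_quotient (vfield_at X (pr x)) Gl; exists X0; split.
  by rewrite -[LHS]/(th (pr x) (vfield_at X (pr x))) E; have [_ <-] := st X0 X0 x.
move=> Y; rewrite -[LHS]/(om (pr x) (vfield_at X (pr x)) (vfield_at (descend Y) (pr x))).
by rewrite E descend_at; have [<- _] := st X0 Y x.
Qed.

Lemma etaP a Y Z : eta (a *: Y + Z) = a *: eta Y + eta Z.
Proof.
apply: smooth_fun_eq => q; have [X0 [_ eE]] := left_invariant_at q.
by rewrite -[RHS]/(a * eta Y q + eta Z q) !eE wr.
Qed.

(** The structure equation contracted with the automorphism [X], that is
    [d eta = th /\ eta - th(X) om], evaluated on left invariant fields. *)
Lemma diff_eta Y Z :
  descend Y (eta Z) = descend Z (eta Y) + eta (lie Y Z) - w Y Z *: lee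
    + theta Y *: eta Z - theta Z *: eta Y.
Proof.
apply: smooth_fun_eq => q.
have /(congr1 (fun f : smooth_fun Q => f q)) := lcsP t X (descend Y) (descend Z).
have /(congr1 (fun f : smooth_fun Q => f q)) := Xt (descend Y) (descend Z).
rewrite -[X in X = _ -> _]/(X (eval2 om (descend Y) (descend Z)) q -
  eval2 om (lie X (descend Y)) (descend Z) q - eval2 om (descend Y) (lie X (descend Z)) q).
rewrite -[X in _ = X -> _]/(0 : R) => H1.
rewrite -[X in X = _ -> _]/(X (eval2 om (descend Y) (descend Z)) q -
  descend Y (eta Z) q + descend Z (eta Y) q
  - eval2 om (lie X (descend Y)) (descend Z) q
  + eval2 om (lie X (descend Z)) (descend Y) q
  - eval2 om (lie (descend Y) (descend Z)) X q).
rewrite -[X in _ = X -> _]/(lee q * eval2 om (descend Y) (descend Z) q -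
  eval1 th (descend Y) q * eta Z q + eval1 th (descend Z) q * eta Y q).
rewrite !(theta_descend st) (omega_descend st) descend_lie => H2.
rewrite -[RHS]/(descend Z (eta Y) q + eta (lie Y Z) q - w Y Z * lee q
  + theta Y * eta Z q - theta Z * eta Y q).
have sk (U V : vfield Q) : eval2 om U V q = - eval2 om V U q.
  rewrite -[LHS]/(om q (vfield_at U q) (vfield_at V q)).
  rewrite -[RHS]/(- om q (vfield_at V q) (vfield_at U q)).
  rewrite -(creprK q); exact: (form2_skew st Gl mm mi).
move: H2; rewrite (sk (lie X (descend Z))) (sk (descend (lie Y Z)) X).
rewrite -[eval2 om X (descend (lie Y Z))]/(eta (lie Y Z)).
move: H1; move: (eval2 om (lie X (descend Y)) (descend Z) q)
  (eval2 om (descend Y) (lie X (descend Z)) q) (X (eval2 om (descend Y) (descend Z)) q)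
  (descend Y (eta Z) q) (descend Z (eta Y) q) (eta (lie Y Z) q) => A B C D E F H1 H2.
have -> : D = C - A - B + E + F - (C - D + E - A + - B - - F) by ring.
rewrite H1 H2; ring.
Qed.

(** The functional [Y |-> mean (u eta(Y))] is [w X' Y] for some left invariant
    [X'].  Averaging [diff_eta] against [u] shows that [X'] satisfies the same
    equation, with [mean (u lee)] in place of [th(X)]; so [X'] is an
    automorphism with [theta X' = mean (u lee)], and this is zero as [s] is of
    the second kind. *)
Lemma mean_lee u : lie_second_kind s -> (forall Y, descend Y u = 0) ->
  qmean (u * lee) = 0.
Proof.
move=> s2 Yu.
have [X' lX] : exists X', forall Y, qmean (u * eta Y) = w X' Y.
  apply: omega_representation => a Y Z; rewrite etaP -qmeanP; congr qmean.
  apply: smooth_fun_eq => q; rewrite -[LHS]/(u q * (a * eta Y q + eta Z q)).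
  by rewrite -[RHS]/(a * (u q * eta Y q) + u q * eta Z q); ring.
have [T tT] : exists T, forall Z, theta Z = w T Z.
  by apply: omega_representation; exact: lie_theta_linear.
have uc : qmean (u * lee) = theta X'.
  rewrite tT skew -lX -[RHS]addr0 -mulN1r.
  have q0 : qmean 0 = 0 by have := qmeanP (-1) 0 0; rewrite scaler0 addr0 mulN1r addNr.
  rewrite -[X in _ + X]q0 -qmeanP; congr qmean; apply: smooth_fun_eq => q.
  rewrite -[LHS]/(u q * lee q) -[RHS]/(-1 * (u q * eta T q) + 0).
  by have [X0 [-> ->]] := left_invariant_at q; rewrite tT skew; ring.
rewrite uc; apply: s2 => Y Z.
have key : w X' (lie Y Z) =
    theta X' * w Y Z - theta Y * w X' Z + theta Z * w X' Y.
  rewrite -uc -!lX.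
  have H : u * descend Y (eta Z) = - w Y Z *: (u * lee) + (theta Y *: (u * eta Z) +
     (- theta Z *: (u * eta Y) + (1 *: (u * eta (lie Y Z)) + u * descend Z (eta Y)))).
    apply: smooth_fun_eq => q; rewrite diff_eta.
    rewrite -[LHS]/(u q * (descend Z (eta Y) q + eta (lie Y Z) q - w Y Z * lee q
      + theta Y * eta Z q - theta Z * eta Y q)).
    rewrite -[RHS]/(- w Y Z * (u q * lee q) + (theta Y * (u q * eta Z q) +
     (- theta Z * (u q * eta Y q) + (1 * (u q * eta (lie Y Z) q) + u q * descend Z (eta Y) q)))).
    ring.
  have parts W f : qmean (u * descend W f) = 0.
    by have := qmean_descend W (u * f); rewrite vfieldM Yu mul0r add0r.
  have := congr1 qmean H; rewrite !qmeanP !parts mul1r addr0 => E.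
  apply/eqP; rewrite -subr_eq0; apply/eqP; rewrite [RHS]E; ring.
have := lie_lcsP s X' Y Z; rewrite /ce_diff2 -key.
rewrite (skew (lie X' Z) Y) (skew (lie Y Z) X').
by move=> E; apply: oppr_inj; rewrite oppr0 opprD; move/eqP: E; rewrite opprK -subr_eq0 addrK => /eqP.
Qed.

(** The twisted differential [d - th /\ _] has square zero, kills [om], and maps
    [eta] to [- th(X) om] by [diff_eta]; hence [d(th(X)) /\ om = 0]. *)
Lemma dlee_omega W Y Z q :
  descend W lee q * w Y Z + descend Y lee q * w Z W + descend Z lee q * w W Y = 0.
Proof.
pose D V f : R := descend V f q.
have E V (U U' : lie_algebra G) : D V (descend U (eta U')) =
    D V (descend U' (eta U)) + D V (eta (lie U U')) - w U U' * D V lee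
    + theta U * D V (eta U') - theta U' * D V (eta U).
  by rewrite /D diff_eta !(vfieldD, vfieldN, vfieldZ).
have E0 (U U' : lie_algebra G) : D U (eta U') =
    D U' (eta U) + eta (lie U U') q - w U U' * lee q
    + theta U * eta U' q - theta U' * eta U q.
  by rewrite /D diff_eta.
have Cm (U U' : lie_algebra G) f : D (lie U U') f = D U (descend U' f) - D U' (descend U f).
  by rewrite /D -descend_lie.
have th0 (U U' : lie_algebra G) : theta (lie U U') = 0.
  by have := lie_theta_closed s U U'; rewrite /ce_diff1 => /eqP; rewrite oppr_eq0 => /eqP.
have J : eta (lie W (lie Y Z)) q + eta (lie Y (lie Z W)) q + eta (lie Z (lie W Y)) q = 0.
  have := congr1 (fun V => eta V q) (lie_jacobi W Y Z).
  have [X0 [_ eE]] := left_invariant_at q; rewrite !eE.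
  have wD U U' : w X0 (U + U') = w X0 U + w X0 U'.
    by have := wr 1 U U' X0; rewrite scale1r mul1r.
  by rewrite !wD => ->; rewrite skew omega0l oppr0.
have eC U U' : eta (lie U U') q = - eta (lie U' U) q.
  have [X0 [_ eE]] := left_invariant_at q; rewrite !eE lie_algebraC.
  by have := wr (-1) (lie U' U) 0 X0; rewrite addr0 scaleN1r mulN1r [w X0 0]skew omega0l oppr0 addr0.
have L := lie_lcsP s W Y Z; rewrite /ce_diff2 in L.
have sW : w (lie W Z) Y = - w (lie Z W) Y.
  by have := lie_omega_linear s (-1) (lie Z W) 0 Y; rewrite addr0 scaleN1r mulN1r omega0l addr0 -lie_algebraC.
rewrite sW in L.
have F1 := E W Y Z; have F2 := E Y Z W; have F3 := E Z W Y.
have K1 := E0 (lie W Y) Z; have K2 := E0 (lie Y Z) W; have K3 := E0 (lie Z W) Y.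
rewrite !th0 !mul0r !addr0 in K1 K2 K3.
rewrite (eC (lie W Y) Z) in K1; rewrite (eC (lie Y Z) W) in K2.
rewrite (eC (lie Z W) Y) in K3.
rewrite !Cm in K1 K2 K3.
have P1 := congr1 ( *%R (theta Z)) (E0 W Y).
have P2 := congr1 ( *%R (theta W)) (E0 Y Z).
have P3 := congr1 ( *%R (theta Y)) (E0 Z W).
have LL := congr1 ( *%R (lee q)) L.
have sk1 := skew W Z; rewrite sk1 in LL.
rewrite -![descend _ lee q]/(D _ lee).
clear - F1 F2 F3 K1 K2 K3 P1 P2 P3 LL J.
lra.
Qed.

(** If the orthogonal of each [W] contains a pair with [w Y Z <> 0], then
    [dlee_omega] gives [W lee = 0] for all [W], and [mean_lee] applies with
    [u = lee]: the mean of [lee ^ 2] is zero. *)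
Lemma isotropic_or_lee0 : lie_second_kind s ->
  (exists W, forall Y Z, w W Y = 0 -> w W Z = 0 -> w Y Z = 0) \/ forall q, lee q = 0.
Proof.
move=> s2; have [|N] := pselect
  (exists W, forall Y Z, w W Y = 0 -> w W Z = 0 -> w Y Z = 0); first by left.
right; have cst W : descend W lee = 0.
  apply: smooth_fun_eq => q; apply: contrapT => Wl; apply: N; exists W => Y Z WY WZ.
  have := dlee_omega W Y Z q; rewrite WY (skew Z W) WZ oppr0 !mulr0 !addr0.
  by move=> /eqP; rewrite mulf_eq0 => /orP[/eqP|/eqP].
have ll := mean_lee s2 cst.
have l2 : forall q, 0 <= (lee * lee) q by move=> q; exact: sqr_ge0.
by move=> q; have /eqP := mean_eq0 Gl mm mi l2 ll q; rewrite mulf_eq0 => /orP[]/eqP.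
Qed.

(** If the orthogonal of some [W] is isotropic, the Lie algebra has dimension at
    most two.  In the abelian case all left invariant fields are automorphisms,
    so that [theta = 0]; the non-abelian Lie algebra of dimension two has no
    lattice. *)
Lemma lee_eq0 : lie_second_kind s -> forall q, lee q = 0.
Proof.
move=> s2; have [[W iso]|//] := isotropic_or_lee0 s2.
have lX q (th0 : forall Z, theta Z = 0) : lee q = 0.
  by have [X0 [->]] := left_invariant_at q.
have wN Y Z : w Y (- Z) = - w Y Z.
  by have := wr (-1) Z 0 Y; rewrite addr0 scaleN1r mulN1r [w Y 0]skew omega0l oppr0 addr0.
have wD Y Z Z' : w Y (Z + Z') = w Y Z + w Y Z'.
  by have := wr 1 Z Z' Y; rewrite scale1r mul1r.
have wZ a Y Z : w Y (a *: Z) = a * w Y Z.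
  by have := wr a Z 0 Y; rewrite addr0 [w Y 0]skew omega0l oppr0 addr0.
have [W0|/eqP Wn0] := eqVneq W 0.
  move=> q; apply: lX => Z; suff -> : Z = 0.
    by have := lie_theta_linear s (-1) 0 0; rewrite scaler0 addr0 mulN1r addNr.
  by apply: (lie_omega_nondegenerate (l := s)) => Y; apply: iso; rewrite W0 omega0l.
have [V WV] : exists V, w W V = 1.
  have [V0 /eqP WV0] : exists V, w W V <> 0.
    apply: contrapT => N; apply: Wn0; apply: (lie_omega_nondegenerate (l := s)) => Y.
    by apply: contrapT => WY; apply: N; exists Y.
  by exists ((w W V0)^-1 *: V0); rewrite wZ mulVf.
have WW := lie_omega_alternating s W; have VV := lie_omega_alternating s V.
(* [W] and [V] form a symplectic basis *)
have basis Z : Z = w Z V *: W + w W Z *: V.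
  apply/eqP; rewrite -subr_eq0; apply/eqP.
  set D := Z - _.
  have DW : w W D = 0 by rewrite /D wD wN wD !wZ WW WV mulr0 add0r mulr1 subrr.
  have DV : w D V = 0.
    rewrite skew /D wD wN wD !wZ VV (skew V W) WV (skew V Z); ring.
  apply: (lie_omega_nondegenerate (l := s)) => Y.
  have : w D (Y - w W Y *: V) = 0.
    by apply: iso => //; rewrite wD wN wZ WV mulr1 subrr.
  by rewrite wD wN wZ DV mulr0 subr0.
have brE Y Z : lie Y Z = (w Y V * w W Z - w W Y * w Z V) *: lie W V.
  rewrite {1}(basis Y) {1}(basis Z) lie_algebraDl !lie_algebraZl !lie_algebraDr.
  rewrite !lie_algebraZr !liexx !scaler0 addr0 add0r !scalerA (lie_algebraC V W).
  by rewrite scalerN -scalerBl.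
have [e0 q|/eqP e0] := eqVneq (lie W V) 0.
  apply: lX => Z; apply: s2 => Y Y'.
  by rewrite brE (brE Z Y') e0 !scaler0 omega0l [w Y 0]skew omega0l oppr0 addr0.
exfalso; set e := lie W V in e0 brE.
set a := w e V; set b := w W e.
have [a0|a0] := eqVneq a 0; last first.
  apply: (no_affine_lattice Gl mm mi (A := - a^-1 *: V) (B := e)) => //.
    rewrite brE -[X in _ = X]scale1r; congr (_ *: _).
    by rewrite (skew _ V) !wZ VV WV -/a; field.
  move=> Z; exists (w Z V * b - a * w W Z), (w Z V / a).
  rewrite {1}(basis Z) [X in _ + _ *: X](basis e) -/a -/b scalerDr !scalerA.
  rewrite [RHS]addrCA -scalerDl divfK//; congr (_ + _).
  suff {1}-> : w W Z = (w Z V * b - a * w W Z) * - a^-1 + w Z V / a * b by [].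
  by field.
have b0 : b != 0.
  by apply/eqP => b0; apply: e0; rewrite (basis e) -/a -/b a0 b0 !scale0r addr0.
apply: (no_affine_lattice Gl mm mi (A := b^-1 *: W) (B := e)) => //.
  rewrite brE -[X in _ = X]scale1r; congr (_ *: _).
  by rewrite (skew _ V) !wZ (skew V W) WW WV -/a -/b a0; field.
move=> Z; exists (w Z V * b), (w W Z / b).
rewrite {1}(basis Z) [X in _ + _ *: X](basis e) -/a -/b a0 scale0r add0r !scalerA.
by rewrite mulfK// divfK.
Qed.

End Automorphism.

Theorem theorem2p1 (R : realType) (n : nat) (G : lieGroupType R n)
  (G_simply_connected : simply_connected R G)
  (G_solvable : solvable_group G)
  (Gamma : groupClosed G) (Gamma_lattice : lattice Gamma)
  (s : lie_lcs (lie_algebra G)) (s_second_kind : lie_second_kind s)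
  (t : lcs (quotient_smooth Gamma)) (st : induced_lcs s t) :
  second_kind t.
Proof.
have [m [mm mi]] := solvable_mean (R := R) G_solvable.
move=> X Xt; have lX := lee_eq0 st Gamma_lattice mm mi Xt s_second_kind.
exact: (@smooth_fun_eq _ _ _ (eval1 (lcs_theta t) X) 0 lX).
Qed.
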